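(* Let $\Omega\subset\mathbb{R}^N$ be a nonempty open bounded connected set, $X=\overline{\Omega}$, $Y\subset\mathbb{R}^N$, $\mu\in\mathcal{P}(X)$, $\nu\in\mathcal{P}(Y)$, $H,K:X\to(0,+\infty)$ in $L^1(X,\mu)$ with $H(x)K(x)<2$ for all $x\in X$, and $\mathcal{A}$ a family of balls covering $X$. Let $u\in\mathrm{Refo}(\mu;\nu)^{H,K}$ be such that $u|_\Omega:\Omega\to\mathbb{R}^N$ is an open map. Then $u|_\Omega$ is locally invertible, i.e. every point of $\Omega$ has a neighborhood on which $u$ is injective.
   Context: For $u:X\to Y$, $x_0\in X$: $e_u(x_0)=\limsup_{x\to x_0,\,x\ne x_0}\frac{|u(x)-u(x_0)|}{|x-x_0|}$, $c_u(x_0)=\limsup_{x\to x_0,\,x\ne x_0}\frac{|x-x_0|}{|u(x)-u(x_0)|}$ (quotient $+\infty$ if $u(x)=u(x_0)$). $\mathrm{Refo}(\mu;\nu)^{H,K}$ is the set of maps $u:X\to Y$ with $u_\#\mu=\nu$ (i.e. $\mu(u^{-1}(A))=\nu(A)$ for Borel $A$) such that for every $x\in X$ there is $B(x,r)\in\mathcal{A}$ with $c_u(y)\le H(x)$, $e_u(y)\le K(x)$ for all $y\in\overline{B}(x,r)\cap\Omega$. *)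

(* Defs.v *)
From HB Require Import structures.
From mathcomp Require Import all_boot all_order all_algebra.
From mathcomp Require Import all_classical all_reals all_analysis.
Set Implicit Arguments. Unset Strict Implicit. Unset Printing Implicit Defensive.
Import Order.TTheory GRing.Theory Num.Theory.
Import numFieldNormedType.Exports.
Local Open Scope classical_set_scope.
Local Open Scope ring_scope.

(* R^N is modelled as row vectors 'rV[R]_N (their canonical topology is the
   usual one); distances are measured with the Euclidean norm below. *)

Definition enorm (R : realType) (N : nat) (v : 'rV[R]_N) : R :=
  Num.sqrt (\sum_(i < N) v ord0 i ^+ 2).

Definition eball (R : realType) (N : nat) (c : 'rV[R]_N) (r : R) : set 'rV[R]_N :=
  [set y | enorm (y - c) < r].
Definition ecball (R : realType) (N : nat) (c : 'rV[R]_N) (r : R) : set 'rV[R]_N :=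
  [set y | enorm (y - c) <= r].

Definition BorelRV (R : realType) (N : nat) :=
  g_sigma_algebraType (@open 'rV[R]_N).

Definition pnbhs_in (R : realType) (N : nat) (D : set 'rV[R]_N) (x0 : 'rV[R]_N)
  : set_system 'rV[R]_N :=
  within (fun y => D y /\ y <> x0) (nbhs x0).

Definition e_u (R : realType) (N : nat) (D : set 'rV[R]_N)
  (u : 'rV[R]_N -> 'rV[R]_N) (x0 : 'rV[R]_N) : \bar R :=
  limf_esup (fun x => (enorm (u x - u x0) / enorm (x - x0))%:E) (pnbhs_in D x0).

Definition c_u (R : realType) (N : nat) (D : set 'rV[R]_N)
  (u : 'rV[R]_N -> 'rV[R]_N) (x0 : 'rV[R]_N) : \bar R :=
  limf_esup (fun x => if u x == u x0 then +oo%E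
                      else (enorm (x - x0) / enorm (u x - u x0))%:E)
            (pnbhs_in D x0).

(* Refo(mu; nu)^{H,K} with respect to Omega, X = closure Omega, Y,
   and the family of balls A (a ball B(c,r) is encoded by the pair (c,r)). *)
Definition Refo (R : realType) (N : nat) (Omega Y : set 'rV[R]_N)
  (mu nu : probability (BorelRV R N) R) (H K : 'rV[R]_N -> R)
  (A : set ('rV[R]_N * R)) (u : 'rV[R]_N -> 'rV[R]_N) : Prop :=
  let X := closure Omega in
  (forall x, X x -> Y (u x)) /\
  (forall B : set (BorelRV R N), measurable B ->
     mu ((X `&` u @^-1` B) : set (BorelRV R N)) = nu B) /\
  (forall x, X x -> exists r, A (x, r) /\
     forall y, ecball x r y -> Omega y ->
       (c_u X u y <= (H x)%:E)%E /\ (e_u X u y <= (K x)%:E)%E).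

(* Main.v *)
(* Take H, K slightly larger than H(x), K(x), still with H K < 2. Near x the map u is K-Lipschitz, and each y has a scale below which |w - y| <= H |u w - u y|. If u were not injective near x, Baire's theorem on the closed set Z of points without local injectivity would give a ball about some z in Z on which one scale serves all of Z; normalize z = u z = 0.

Angle doubling on spheres |a| = tau shows that, because H K < 2, u a and u b do not point in opposite directions when <a, b> >= 0. A partition of unity then gives a continuous G with <G(u a, |a|), a> > 0, so that near the boundary of U = {|u| < s'} the identity is homotopic, through nonvanishing maps, to a map factoring through u.

On Z the map u is injective and takes no value it takes elsewhere, so it is a proper local homeomorphism from U minus Z onto its image. Suppose u a1 = u a2 with a1 <> a2 near 0, and let W be the quasi-component of a1 in U minus Z. Extend the end of the homotopy to Gamma o u: the degree of Gamma o u - a_i on W is 1 or 0 according to whether a_i lies in W, and up to sign it is deg(u, W) deg(Gamma - a_i, u(W)). If a2 lies in W, then deg(u, W) is a multiple of the number of sheets, which is at least 2, and cannot divide 1; otherwise the quasi-component of a2 has the same image as W, and the degrees of Gamma - a_1 on this image would be both zero and nonzero.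

The degree is combinatorial: on a torus grid of mesh 1/n, integrate over W the cup product of the coboundaries of the sign indicators of the coordinates, for large n. The composition formula comes from deforming (y - u x, Gamma y - a) into (y - u x, Gamma (u x) - a) on the product grid. *)
Require Import Defs.
From HB Require Import structures.
From mathcomp Require Import all_boot all_order all_algebra ring lra.
Set Implicit Arguments. Unset Strict Implicit. Unset Printing Implicit Defensive.
Import Order.TTheory GRing.Theory Num.Theory.
Local Open Scope ring_scope.

(** * Cochains on a finite set with commuting shifts *)

(* A cochain [eta : T -> {set I} -> int] assigns to [x] and [S] its value on the cube with lowest vertex [x] and edge directions [S]; [rk] orders the directions, and [dmul s eta] is the cup product of the coboundary of [s] with [eta]. *)
Section Forms.
Variables (I : finType) (rk : I -> nat) (T : finType) (sh : I -> T -> T).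

(** Where 2 comes from: on a sphere |a| = tau the images have norm at least tau/H, and u stretches
    chords at most by K, so the direction of u a turns at most HK times as fast as that of a. Over a
    quarter turn this adds up to less than a half turn. Only points of equal norm are compared,
    hence the second argument of G; the homotopy ends by freezing it at a constant, so that a
    function of u a alone remains.

    The obstacle is that the lower bound has no uniform scale, so nothing controls the fibres of u
    near x or the shape of Z. Z is therefore not studied but treated as additional boundary: after
    Baire, u separates each point of Z from every other point, so any map restricted to Z factors
    through u, and values taken off Z do not accumulate on fibres meeting Z. No degree is ever
    computed across Z. *)

Definition sgnl (a : I) (S : {set I}) : int := (-1) ^+ #|[set b in S | (rk b < rk a)%N]|.
Definition sgnr (a : I) (S : {set I}) : int := (-1) ^+ #|[set b in S | (rk a < rk b)%N]|.

Definition dmul (s : T -> int) (eta : T -> {set I} -> int) (x : T) (S : {set I}) : int :=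
  \sum_(a in S) sgnl a S * (s (sh a x) - s x) * eta (sh a x) (S :\ a).
Definition lmul (eta : T -> {set I} -> int) (x : T) (S : {set I}) : int :=
  \sum_(a in S) sgnl a S * eta (sh a x) (S :\ a).
Definition rmul (eta : T -> {set I} -> int) (x : T) (S : {set I}) : int :=
  \sum_(a in S) sgnr a S * eta x (S :\ a).
Definition fmul (s : T -> int) (eta : T -> {set I} -> int) (x : T) (S : {set I}) : int :=
  s x * eta x S.
Definition onef (x : T) (S : {set I}) : int := (S == set0)%:R.
Definition dforms (eta : T -> {set I} -> int) (l : seq (T -> int)) := foldr dmul eta l.

(* The Leibniz rule: up to signs, [lmul] and [rmul] are the two halves of the coboundary, so a product of coboundaries is a total difference. *)
Lemma dmulE s eta x S : dmul s eta x S = lmul (fmul s eta) x S - fmul s (lmul eta) x S.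
Proof.
rewrite /dmul /lmul /fmul mulr_sumr -sumrB; apply: eq_bigr => a _.
by rewrite mulrBr mulrBl mulrA (mulrCA (s x)) mulrA.
Qed.

Lemma eq_dmul s eta eta' : eta =2 eta' -> dmul s eta =2 dmul s eta'.
Proof. by move=> h x S; apply: eq_bigr => a _; rewrite h. Qed.
Lemma eq_lmul eta eta' : eta =2 eta' -> lmul eta =2 lmul eta'.
Proof. by move=> h x S; apply: eq_bigr => a _; rewrite h. Qed.
Lemma eq_rmul eta eta' : eta =2 eta' -> rmul eta =2 rmul eta'.
Proof. by move=> h x S; apply: eq_bigr => a _; rewrite h. Qed.
Lemma eq_dforms l eta eta' : eta =2 eta' -> dforms eta l =2 dforms eta' l.
Proof. by move=> h; elim: l => //= s l; apply: eq_dmul. Qed.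

Hypothesis rk_inj : injective rk.
Hypothesis shC : forall a b x, sh a (sh b x) = sh b (sh a x).

Lemma sgnl_rem a b (S : {set I}) : a \in S -> b \in S -> a != b ->
  sgnl b S = (if (rk a < rk b)%N then -1 else 1) * sgnl b (S :\ a).
Proof.
move=> aS bS ab; rewrite /sgnl; case: ifP => ha; last first.
  rewrite mul1r; congr (_ ^+ _); apply: eq_card => c; rewrite !inE.
  by have [->|//] := eqVneq c a; rewrite ha andbF.
have := cardsD1 a [set b0 in S | (rk b0 < rk b)%N]; rewrite !inE aS ha /= => ->.
rewrite exprS; congr (_ * _); congr (_ ^+ _); apply: eq_card => c; rewrite !inE.
by case: (c == a).
Qed.

Lemma sgnr_rem a b (S : {set I}) : a \in S -> b \in S -> a != b ->
  sgnr b S = (if (rk b < rk a)%N then -1 else 1) * sgnr b (S :\ a).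
Proof.
move=> aS bS ab; rewrite /sgnr; case: ifP => ha; last first.
  rewrite mul1r; congr (_ ^+ _); apply: eq_card => c; rewrite !inE.
  by have [->|//] := eqVneq c a; rewrite ha andbF.
have := cardsD1 a [set b0 in S | (rk b < rk b0)%N]; rewrite !inE aS ha /= => ->.
rewrite exprS; congr (_ * _); congr (_ ^+ _); apply: eq_card => c; rewrite !inE.
by case: (c == a).
Qed.

Lemma setD1C (S : {set I}) a b : (S :\ a) :\ b = (S :\ b) :\ a.
Proof. by apply/setP => c; rewrite !inE; case: (c == a); case: (c == b). Qed.

(** Exchanging the two removed directions keeps the value, as shifts commute, and flips the sign;
    the sum is its own negative. *)
Lemma lmul_lmul eta x S : lmul (lmul eta) x S = 0.
Proof.
pose F a b := sgnl a S * sgnl b (S :\ a) * eta (sh b (sh a x)) (S :\ a :\ b).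
have E : lmul (lmul eta) x S = \sum_a \sum_(b | [&& a \in S, b \in S & b != a]) F a b.
  rewrite /lmul big_mkcond /=; apply: eq_bigr => a _; case: ifP => aS /=; last by rewrite big_pred0.
  rewrite mulr_sumr; apply: eq_big => [b|b _]; first by rewrite !inE andbC.
  by rewrite /F mulrA.
have E2 : lmul (lmul eta) x S = - lmul (lmul eta) x S.
  rewrite {1}E (exchange_big_dep predT) //= E -sumrN; apply: eq_bigr => b _.
  rewrite -sumrN; apply: eq_big => [a|a /and3P[aS bS ba]].
    by rewrite andbCA eq_sym.
  rewrite /F shC setD1C -mulNr; congr (_ * _).
  have ab : a != b by rewrite eq_sym.
  rewrite (sgnl_rem aS bS ab) (sgnl_rem bS aS ba).
  case: ltngtP => [h|h|/rk_inj e]; [by ring|by ring|].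
  by move: ba; rewrite e eqxx.
by move: E2; lra.
Qed.

(** Here the exchange costs no sign: removing [a] flips [sgnr b] and removing [b] flips [sgnl a]
    under the same condition, [b] ranked before [a]. *)
Lemma lmul_rmul eta x S : lmul (rmul eta) x S = rmul (lmul eta) x S.
Proof.
pose F a b := sgnl a S * sgnr b (S :\ a) * eta (sh a x) (S :\ a :\ b).
pose G b a := sgnr b S * sgnl a (S :\ b) * eta (sh a x) (S :\ b :\ a).
transitivity (\sum_a \sum_(b | [&& a \in S, b \in S & b != a]) F a b).
  rewrite /lmul big_mkcond /=; apply: eq_bigr => a _; case: ifP => aS /=; last by rewrite big_pred0.
  rewrite /rmul mulr_sumr; apply: eq_big => [b|b _]; first by rewrite !inE andbC.
  by rewrite /F mulrA.
transitivity (\sum_b \sum_(a | [&& b \in S, a \in S & a != b]) G b a); last first.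
  rewrite /rmul [RHS]big_mkcond /=; apply: eq_bigr => a _; case: ifP => aS /=; last by rewrite big_pred0.
  rewrite /lmul mulr_sumr; apply: eq_big => [b|b _]; first by rewrite !inE andbC.
  by rewrite /G mulrA.
rewrite (exchange_big_dep predT) //=; apply: eq_bigr => b _.
apply: eq_big => [a|a /and3P[aS bS ba]]; first by rewrite andbCA eq_sym.
rewrite /F /G setD1C; congr (_ * _).
have ab : a != b by rewrite eq_sym.
rewrite (sgnr_rem aS bS ab) (sgnl_rem bS aS ba).
by case: ifP => _; ring.
Qed.

Lemma lmulB eta eta' x S : lmul (fun y R => eta y R - eta' y R) x S = lmul eta x S - lmul eta' x S.
Proof. by rewrite /lmul -sumrB; apply: eq_bigr => a _; rewrite mulrBr. Qed.
Lemma rmulB eta eta' x S : rmul (fun y R => eta y R - eta' y R) x S = rmul eta x S - rmul eta' x S.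
Proof. by rewrite /rmul -sumrB; apply: eq_bigr => a _; rewrite mulrBr. Qed.
Lemma rmul_fmul s eta x S : rmul (fmul s eta) x S = fmul s (rmul eta) x S.
Proof. by rewrite /rmul /fmul mulr_sumr; apply: eq_bigr => a _; rewrite mulrCA. Qed.

Lemma lmul_dmul s eta x S : lmul (dmul s eta) x S = - dmul s (lmul eta) x S.
Proof.
rewrite (eq_lmul (dmulE s eta)) lmulB lmul_lmul sub0r dmulE; congr (- _).
by rewrite [X in _ - X]/fmul lmul_lmul mulr0 subr0.
Qed.

Lemma rmul_dmul s eta x S : rmul (dmul s eta) x S = dmul s (rmul eta) x S.
Proof.
rewrite (eq_rmul (dmulE s eta)) rmulB dmulE -lmul_rmul rmul_fmul.
rewrite (eq_lmul (rmul_fmul s eta)); congr (_ - _).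
by rewrite /fmul lmul_rmul.
Qed.

Lemma dmulZ s eta c x S : dmul s (fun y R => c * eta y R) x S = c * dmul s eta x S.
Proof. by rewrite /dmul mulr_sumr; apply: eq_bigr => a _; rewrite mulrCA. Qed.
Lemma dformsZ l eta c x S : dforms (fun y R => c * eta y R) l x S = c * dforms eta l x S.
Proof.
elim: l x S => //= s l IH x S; rewrite -dmulZ; exact: eq_dmul IH _ _.
Qed.

Lemma lmul_dforms l eta x S :
  lmul (dforms eta l) x S = (-1) ^+ size l * dforms (lmul eta) l x S.
Proof.
elim: l x S => [|s l IH] x S /=; first by rewrite mul1r.
rewrite lmul_dmul (eq_dmul _ IH) dmulZ exprS mulN1r mulNr //.
Qed.

Lemma rmul_dforms l eta x S : rmul (dforms eta l) x S = dforms (rmul eta) l x S.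
Proof.
elim: l x S => //= s l IH x S; rewrite rmul_dmul; exact: eq_dmul IH _ _.
Qed.

Lemma lmul_onef x S : lmul onef x S = rmul onef x S.
Proof.
apply: eq_bigr => a aS; rewrite /onef; case: eqP => [e|]; last by rewrite !mulr0.
have -> : S = [set a] by rewrite -[S](setD1K aS) e setU0.
rewrite /sgnl /sgnr; congr ((-1) ^+ _ * _).
by rewrite !eq_card0 // => c; rewrite !inE; have [->|] := eqVneq c a; rewrite // ltnn.
Qed.

(** After [dmulE], one [lmul] is pulled out through [l1]; the other is pushed through [l2] down to
    [onef], where it equals [rmul], and this commutes with all factors and comes back out without
    sign. *)
Lemma dmul_telescope l1 l2 f x S :
  dforms (dforms onef l2) (rcons l1 f) x S =
  (-1) ^+ size l1 * lmul (dforms (fmul f (dforms onef l2)) l1) x S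
  - (-1) ^+ size l2 * rmul (dforms (fmul f (dforms onef l2)) l1) x S.
Proof.
rewrite lmul_dforms mulrA -exprMn_comm; last by apply: mulrC.
rewrite mulrNN mul1r expr1n mul1r rmul_dforms /dforms foldr_rcons -/(dforms _ l1).
have dformsB e1 e2 : dforms (fun y R => e1 y R - e2 y R) l1 x S = dforms e1 l1 x S - dforms e2 l1 x S.
  elim: l1 x S => //= s l IH x S; rewrite (eq_dmul _ IH) /dmul -sumrB.
  by apply: eq_bigr => a _; rewrite mulrBr.
rewrite (eq_dforms _ (dmulE _ _)) dformsB -/(dforms onef l2) -dformsZ; congr (_ - _).
apply: eq_dforms => y R; rewrite rmul_fmul /fmul mulrCA; congr (_ * _).
rewrite lmul_dforms rmul_dforms; congr (_ * _); exact: eq_dforms lmul_onef _ _.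
Qed.

Hypothesis sh_inj : forall a, injective (sh a).

Lemma sgnl_sgnr (a : I) : sgnl a setT = (-1) ^+ #|I|.-1 * sgnr a setT.
Proof.
pose A := [set b in setT | (rk b < rk a)%N]; pose B := [set b in setT | (rk a < rk b)%N].
have AB0 : A :&: B = set0.
  by apply/setP => c; rewrite !inE /=; case: ltngtP.
have AB : A :|: B = setT :\ a.
  apply/setP => c; rewrite !inE /= andbT.
  have [->|] := eqVneq c a; first by rewrite ltnn.
  by case: ltngtP => // /rk_inj ->; rewrite eqxx.
have E : #|I|.-1 = (#|A| + #|B|)%N.
  by rewrite -cardsUI AB0 AB cards0 addn0 -cardsT (cardsD1 a setT) inE.
by rewrite E exprD /sgnl /sgnr -mulrA -exprD addnn -mul2n exprM sqrrN !expr1n mulr1.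
Qed.

(** Stokes by reindexing: each shift permutes the finite set [T], which turns the [lmul] sum into
    the [rmul] sum as long as [chi] agrees across the edges that matter. With as many factors as
    directions the signs cancel. *)
Lemma sum_dmul0 (chi : T -> bool) l1 l2 f :
  (size l1 + size l2).+1 = #|I| ->
  (forall x a, dforms (fmul f (dforms onef l2)) l1 (sh a x) (setT :\ a) != 0 ->
     chi x = chi (sh a x)) ->
  \sum_x (chi x)%:R * dforms (dforms onef l2) (rcons l1 f) x setT = 0.
Proof.
move=> sz hchi; set eta := dforms (fmul f _) l1 in hchi.
have key : \sum_x (chi x)%:R * lmul eta x setT =
     (-1) ^+ (#|I|.-1) * \sum_x (chi x)%:R * rmul eta x setT.
  transitivity (\sum_a \sum_x sgnl a setT * ((chi x)%:R * eta (sh a x) (setT :\ a))).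
    rewrite exchange_big; apply: eq_bigr => x _; rewrite /lmul mulr_sumr.
    by apply: eq_big => [a|a _]; rewrite ?inE // mulrCA.
  rewrite mulr_sumr.
  transitivity (\sum_a \sum_x (-1) ^+ #|I|.-1 * ((chi x)%:R * (sgnr a setT * eta x (setT :\ a)))).
    apply: eq_bigr => a _; rewrite [RHS](reindex_inj (@sh_inj a)) /=; apply: eq_bigr => x _.
    have [->|/hchi <-] := eqVneq (eta (sh a x) (setT :\ a)) 0; first by rewrite !mulr0.
    by rewrite sgnl_sgnr; ring.
  rewrite exchange_big; apply: eq_bigr => x _; rewrite /rmul !mulr_sumr.
  by apply: eq_big => [a|a _]; rewrite ?inE.
transitivity ((-1) ^+ size l1 * (\sum_x (chi x)%:R * lmul eta x setT)
     - (-1) ^+ size l2 * (\sum_x (chi x)%:R * rmul eta x setT)).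
  rewrite !mulr_sumr -sumrB; apply: eq_bigr => x _.
  by rewrite dmul_telescope mulrBr !(mulrCA (chi x)%:R).
rewrite key mulrA -exprD -sz /= addnA exprD addnn -signr_odd odd_double expr0 mul1r subrr //.
Qed.

(** The vertices on which a product of coboundaries at [x] may depend: its factors are evaluated
    after forward shifts only. *)
Definition reach (k : nat) (x y : T) : Prop :=
  exists l : seq I, (size l <= k)%N /\ y = foldl (fun z a => sh a z) x l.

Lemma reach0 k x : reach k x x.
Proof. by exists [::]. Qed.
Lemma reach_step k a x y : reach k (sh a x) y -> reach k.+1 x y.
Proof. by move=> [l [hl ->]]; exists (a :: l). Qed.
Lemma reach_trans k k' x y z : reach k x y -> reach k' y z -> reach (k + k') x z.
Proof.
move=> [l [hl ->]] [l' [hl' ->]]; exists (l ++ l'); rewrite size_cat foldl_cat.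
by split=> //; apply: leq_add.
Qed.
Lemma reach_le k k' x y : (k <= k')%N -> reach k x y -> reach k' x y.
Proof. by move=> h [l [hl ->]]; exists l; split=> //; apply: leq_trans h. Qed.

Lemma dmul_neq0 s eta x (S : {set I}) : dmul s eta x S != 0 ->
  exists a, [/\ a \in S, s (sh a x) != s x & eta (sh a x) (S :\ a) != 0].
Proof.
move=> h; have /existsP[a /andP[aS]] : [exists a, (a \in S) &&
    (sgnl a S * (s (sh a x) - s x) * eta (sh a x) (S :\ a) != 0)].
  apply: contraNT h => /existsPn h; apply/eqP/big1 => a aS.
  by move: (h a); rewrite aS /= negbK => /eqP.
rewrite !mulf_eq0 !negb_or subr_eq0 => /andP[/andP[_ h1] h2].
by exists a.
Qed.

(** A nonzero term of the product is a path along edges of the cube: each factor changes on one of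
    them, and the path ends where [eta] is nonzero. The count of steps lets [deg_change] chain two
    such paths. *)
Lemma dforms_supp (J : eqType) (s : J -> T -> int) js eta x S :
  dforms eta (map s js) x S != 0 ->
  (forall j, j \in js -> exists y y', [/\ reach #|S| x y, reach #|S| x y' & s j y != s j y']) /\
  (exists k y (S' : {set I}), [/\ reach k x y, (k + #|S'| <= #|S|)%N & eta y S' != 0]).
Proof.
elim: js x S => [|j js IH] x S /= h.
  by split=> //; exists 0%N, x, S; split=> //; apply: reach0.
have {h}[a [aS h1 /IH [h2 [k [y [S' [r1 r2 r3]]]]]]] := dmul_neq0 h.
have cS : #|S| = #|S :\ a|.+1 by rewrite (cardsD1 a) aS.
split; last first.
  by exists k.+1, y, S'; split=> //; [apply: reach_step r1|rewrite cS].
move=> i; rewrite inE => /predU1P[->|/h2[z [z' [q1 q2 q3]]]].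
  exists (sh a x), x; split=> //.
    by rewrite cS; apply: reach_step; apply: reach0.
  exact: reach0.
by exists z, z'; rewrite cS; split=> //; apply: reach_step; eassumption.
Qed.

(* The integral over [chi] of the cup product of the coboundaries of [l]. *)
Definition deg (chi : T -> bool) (l : seq (T -> int)) : int :=
  \sum_x (chi x)%:R * dforms onef l x setT.

(* Changing one factor at a time alters the integral by a total difference, which vanishes unless all the factors vary near the boundary of [chi]. *)
Lemma deg_change (J : eqType) (js : seq J) (s s' : J -> T -> int) (chi : T -> bool) :
  size js = #|I| ->
  (forall x a, (forall j, j \in js -> exists y y',
      [/\ reach #|I| (sh a x) y, reach #|I| (sh a x) y' &
        [\/ s j y != s j y', s' j y != s' j y' | s j y != s' j y]]) ->
    chi x = chi (sh a x)) ->
  deg chi (map s js) = deg chi (map s' js).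
Proof.
move=> sz H.
suff K js1 js2 : js = js1 ++ js2 -> deg chi (map s' js1 ++ map s js2) = deg chi (map s js).
  by rewrite -(K js [::]) ?cats0.
elim/last_ind: js1 js2 => [|js1 j IH] js2 E; first by rewrite E.
rewrite -(IH (j :: js2)) ?E ?cat_rcons //; apply/eqP; rewrite -subr_eq0; apply/eqP.
have -> : map s' (rcons js1 j) ++ map s js2 = map s' js1 ++ s' j :: map s js2.
  by rewrite map_rcons cat_rcons.
(* The product is linear in each factor, so replacing [s j] by [s' j] changes it by the product with
   [f] in that place. *)
pose f x := s' j x - s j x.
rewrite -[RHS](@sum_dmul0 chi (map s' js1) (map s js2) f); last 2 first.
- by rewrite !size_map -sz E size_cat size_rcons addSn.
- move=> x a h; apply: H => i; rewrite E mem_cat mem_rcons inE.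
  have [h1 [k [y [S' [r1 r2]]]]] := dforms_supp h.
  rewrite mulf_eq0 negb_or => /andP[fy h2].
  have [h3 _] := dforms_supp h2.
  have cI R : (#|R : {set I}| <= #|I|)%N by exact: max_card.
  have cSI := leq_trans r2 (cI _).
  move=> /orP[/orP[/eqP->|/h1[z [z' [q1 q2 q3]]]]|/h3[z [z' [q1 q2 q3]]]].
  + exists y, y; have r3 : reach #|I| (sh a x) y.
      by apply: reach_le r1; apply: leq_trans cSI; apply: leq_addr.
    split=> //; apply: Or33; move: fy; rewrite /f subr_eq0 eq_sym //.
  + by exists z, z'; split; [exact: reach_le q1|exact: reach_le q2|exact: Or32].
  + exists z, z'; split; [| |exact: Or31].
      exact: reach_le cSI (reach_trans r1 q1).
    exact: reach_le cSI (reach_trans r1 q2).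
rewrite /deg -sumrB; apply: eq_bigr => x _; rewrite -mulrBr; congr (_ * _).
rewrite /dforms !foldr_cat foldr_rcons /= -/(dforms onef _).
have dformsB e e1 e2 l y S : (forall y R, e y R = e1 y R - e2 y R) ->
    foldr dmul e l y S = foldr dmul e1 l y S - foldr dmul e2 l y S.
  move=> he; elim: l y S => //= u l IHl y S; rewrite /dmul -sumrB.
  by apply: eq_bigr => a _; rewrite IHl mulrBr.
symmetry; apply: dformsB => y R; rewrite /dmul -sumrB; apply: eq_bigr => a _.
by rewrite /f; ring.
Qed.

Lemma dforms_card l eta x (S : {set I}) c :
  (forall y (R : {set I}), eta y R != 0 -> #|R| = c) -> dforms eta l x S != 0 -> #|S| = (size l + c)%N.
Proof.
move=> he; elim: l x S => [|s l IH] x S /=; first exact: he.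
move=> /dmul_neq0[a [aS _ ha]].
by rewrite (cardsD1 a) aS (IH _ _ ha).
Qed.

(* Functions invariant under the shifts outside [A] leave all of [A] to the factors preceding them. *)
Lemma dforms_prod (A : {set I}) (c : bool) (l1 l2 : seq (T -> int)) x :
  (forall a b, a \notin A -> b \in A -> (rk b < rk a)%N = c) ->
  size l2 = #|A| -> size l1 = #|~: A| ->
  (forall s, List.In s l2 -> forall a y, a \notin A -> s (sh a y) = s y) ->
  dforms onef (l1 ++ l2) x setT =
  (-1) ^+ (c * #|A| * #|~: A|) * (dforms onef l1 x (~: A) * dforms onef l2 x A).
Proof.
move=> hc sz2 sz1 inv.
have onef_card y (R : {set I}) : onef y R != 0 -> #|R| = 0%N.
  by rewrite /onef; case: (eqVneq R set0) => [->|//]; rewrite cards0.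
have suppA l y (R : {set I}) : (forall s, List.In s l -> forall a z, a \notin A -> s (sh a z) = s z) ->
    dforms onef l y R != 0 -> R \subset A.
  elim: l y R => [|s l IH] y R hl /=.
    by rewrite /onef; case: (eqVneq R set0) => [->|//]; rewrite sub0set.
  move=> /dmul_neq0[a [aS h1 /IH h2]].
  have aA : a \in A by apply: contraNT h1 => /(hl s (or_introl erefl) a y) ->.
  rewrite -(setD1K aS) subUset sub1set aA; apply: h2 => t ht; apply: hl; by right.
have invA l y a R : (forall s, List.In s l -> forall a z, a \notin A -> s (sh a z) = s z) ->
    a \notin A -> dforms onef l (sh a y) R = dforms onef l y R.
  elim: l y R => [|s l IH] y R hl aA //=; apply: eq_bigr => b _.
  rewrite shC (IH (sh b y)) //; last by move=> t ht; apply: hl; right.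
  by rewrite !(hl s (or_introl erefl) a _ aA).
(* There are as many factors as directions in [A], so by degree the block [l2] lives on [A]
   alone. *)
have e2 y R : dforms onef l2 y R = (R == A)%:R * dforms onef l2 y A.
  case: eqP => [->|h]; first by rewrite mul1r.
  rewrite mul0r; apply/eqP/negPn/negP => h1; apply: h; apply/eqP.
  rewrite eqEcard (suppA _ _ _ inv h1) -sz2.
  by rewrite (dforms_card onef_card h1) addn0 leqnn.
(* [l2] already consumes every direction of [A], so none may be missing from the cube. *)
have gen a l y (R : {set I}) : a \in A -> a \notin R -> dforms (dforms onef l2) l y R = 0.
  move=> aA; elim: l y R => [|u l IH] y R aR /=.
    rewrite e2; case: eqP => [e|_]; last by rewrite mul0r.
    by rewrite e aA in aR.
  by apply: big1 => b _; rewrite IH ?mulr0 // !inE negb_and aR orbT.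
have main l y (S : {set I}) : S \subset ~: A -> size l = #|S| ->
   dforms (dforms onef l2) l y (S :|: A) =
   (-1) ^+ (c * #|A| * #|S|) * (dforms onef l y S * dforms onef l2 y A).
  elim: l y S => [|s l IH] y S SA szS /=.
    have -> : S = set0 by apply/eqP; rewrite -cards_eq0 -szS.
    by rewrite set0U cards0 muln0 mul1r /onef eqxx mul1r.
  rewrite {1}/dmul (bigID (fun a => a \in A)) /= big1 ?add0r; last first.
    move=> a /andP[_ aA]; rewrite (gen a) ?mulr0 //.
      by rewrite !inE eqxx.
  rewrite mulr_suml mulr_sumr; apply: eq_big => [a|a /andP[aSA aA]].
    rewrite !inE; have := subsetP SA a; rewrite !inE.
    by case: (a \in S); case: (a \in A) => // ->.
  have aS : a \in S by move: aSA; rewrite inE (negPf aA) orbF.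
  have -> : (S :|: A) :\ a = (S :\ a) :|: A.
    apply/setP => b; rewrite !inE; have [->|] := eqVneq b a; last by [].
    by rewrite (negPf aA).
  have cS : #|S| = #|S :\ a|.+1 by rewrite (cardsD1 a S) aS.
  rewrite IH; last 2 first.
  - by apply: subset_trans SA; apply: subD1set.
  - by move: szS => /=; rewrite cS => -[].
  rewrite (invA l2 y a A inv aA).
  (* Each factor of [l1] passes all of [A] when [c] holds and none of it otherwise. *)
  have -> : sgnl a (S :|: A) = (-1) ^+ (c * #|A|) * sgnl a S.
    rewrite /sgnl -exprD; congr (_ ^+ _).
    have -> : (c * #|A| = #|[set b in A | (rk b < rk a)%N]|)%N.
      case hcc : c; rewrite ?mul1n ?mul0n.
        by apply: eq_card => b; rewrite !inE; case bA : (b \in A); rewrite // hc.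
      by rewrite eq_card0 // => b; rewrite !inE; case bA : (b \in A); rewrite // hc // hcc.
    rewrite -cardsUI [X in (_ = _ + X)%N]eq_card0 ?addn0; last first.
      move=> b; rewrite !inE; have := subsetP SA b; rewrite !inE.
      by case: (b \in A); case: (b \in S) => //=; [move=> /(_ isT)|rewrite ?andbF].
    apply: eq_card => b; rewrite !inE; case: (b \in A); case: (b \in S) => //=; by case: (_ < _)%N.
  rewrite cS mulnS exprD. ring.
have := main l1 x (~: A) (subxx _) sz1.
by rewrite setUC setUCr /dforms foldr_cat.
Qed.

(** A function that changes in its own direction only must use it, so a single term survives;
    increasing ranks make its sign 1. *)
Lemma dforms_diag (s : I -> T -> int) js x :
  sorted (fun a b => rk a < rk b)%N js ->
  (forall a b y, a != b -> s b (sh a y) = s b y) ->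
  dforms onef (map s js) x [set j in js] = \prod_(j <- js) (s j (sh j x) - s j x).
Proof.
move=> + inv; elim: js x => [|j js IH] x /=.
  by rewrite big_nil /onef; have -> : [set j in [::]] = set0 :> {set I}; [apply/setP => j; rewrite !inE|rewrite eqxx].
move=> hp; have hlt i : i \in js -> (rk j < rk i)%N.
  by move=> ijs; apply: (allP (order_path_min _ hp)) => // a b c; exact: ltn_trans.
have jjs : j \notin js by apply/negP => /hlt; rewrite ltnn.
rewrite big_cons /dmul (bigD1 j) ?inE ?eqxx //= [X in _ + X]big1 ?addr0; last first.
  by move=> i /andP[_ ij]; rewrite inv // subrr mulr0 mul0r.
have -> : sgnl j [set j0 in j :: js] = 1.
  rewrite /sgnl eq_card0 // => i; rewrite !inE; case: eqVneq => [->|_] /=; first by rewrite ltnn.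
  by apply/negP => /andP[/hlt] /ltn_trans h /h; rewrite ltnn.
have -> : [set j0 in j :: js] :\ j = [set j0 in js].
  apply/setP => i; rewrite !inE; case: eqVneq => [->|] //=; exact/esym/negbTE.
rewrite mul1r IH; last exact: path_sorted hp.
congr (_ * _); rewrite !big_seq; apply: eq_bigr => i ijs.
have ji : j != i by apply: contraNneq jjs => ->.
by rewrite shC !(inv j i _ ji).
Qed.

End Forms.

(** * Restriction of cochains to a slice *)

Section Restr.
Variables (I I' : finType) (rk : I -> nat) (rk' : I' -> nat) (T T' : finType).
Variables (sh : I -> T -> T) (sh' : I' -> T' -> T') (f : I' -> I) (g : T' -> T).
Hypothesis f_inj : injective f.
Hypothesis rkf : forall a b, (rk (f a) < rk (f b))%N = (rk' a < rk' b)%N.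
Hypothesis gsh : forall a z, g (sh' a z) = sh (f a) (g z).

(** Meant for [g] the inclusion of a slice of the product grid; since [f] preserves the order of the
    directions, the signs restrict as well. *)
Lemma dforms_restr (l : seq (T -> int)) z (S : {set I'}) :
  dforms rk sh (@onef I T) l (g z) (f @: S) =
  dforms rk' sh' (@onef I' T') (map (fun s => s \o g) l) z S.
Proof.
elim: l z S => [|s l IH] z S /=.
  by rewrite /onef -!cards_eq0 card_imset.
rewrite /dmul big_imset /=; last by move=> a b _ _ /f_inj.
apply: eq_bigr => a aS; rewrite -gsh.
have -> : f @: S :\ f a = f @: (S :\ a).
  apply/setP => b; rewrite !inE; apply/andP/imsetP => [[ba /imsetP[c cS e]]|[c]].
    by exists c => //; rewrite !inE cS andbT; apply: contraNneq ba => <-; rewrite e.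
  rewrite !inE => /andP[ca cS] ->; split; last exact: imset_f.
  by rewrite ?inE; apply: contraNneq ca => /f_inj ->.
rewrite IH; congr (_ * _ * _).
rewrite /sgnl; congr (_ ^+ _); rewrite -(card_imset _ f_inj); apply: eq_card => b.
rewrite !inE; apply/andP/imsetP => [[/imsetP[c cS ->]]|[c]].
  by rewrite rkf => h; exists c; rewrite ?inE ?cS.
by rewrite inE => /andP[cS h] ->; rewrite rkf imset_f.
Qed.
End Restr.

(* Imported only here because it shadows the [set0], [setT] of finite sets. *)
From mathcomp Require Import finmap all_classical all_reals all_analysis.
Import numFieldNormedType.Exports.
Local Open Scope classical_set_scope.
Local Open Scope ring_scope.

(** * The sup norm and grids *)

Section Sup.
Variables (R : realType) (N : nat).
Implicit Types (v w x y : 'rV[R]_N) (A W : set 'rV[R]_N).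

Lemma coord_le v j : `|v ord0 j| <= `|v|.
Proof.
rewrite [leRHS]/Num.norm /= mx_normrE.
by apply: le_trans (le_bigmax _ _ (ord0, j)) => /=.
Qed.

Lemma rV_norm_le v (e : R) : 0 <= e -> (forall j, `|v ord0 j| <= e) -> `|v| <= e.
Proof.
move=> e0 h; rewrite [leLHS]/Num.norm /= mx_normrE; apply/bigmax_leP; split=> // -[i j] _ /=.
by rewrite ord1.
Qed.

Lemma rV_norm_coord v : v != 0 -> exists j, `|v ord0 j| = `|v|.
Proof.
rewrite -normr_eq0 => /mx_norm_neq0[[i j] E].
by exists j; rewrite [RHS]E /= (ord1 i).
Qed.

Lemma nbhs_rVP x A : nbhs x A <-> exists2 d : R, 0 < d & forall y, `|y - x| < d -> A y.
Proof.
split=> [/nbhs_ballP[d /= d0 h]|[d d0 h]].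
  by exists d => // y yx; apply: h; rewrite -ball_normE /ball_ /= distrC.
apply/nbhs_ballP; exists d => // y; rewrite -ball_normE /ball_ /= distrC; exact: h.
Qed.

(** Formulated for a property inherited by subsets instead of a cover; half of the radius at [w]
    serves all nearby centres. *)
Lemma lebesgue_number (K : set 'rV[R]_N) (P : set 'rV[R]_N -> Prop) :
  (forall A B, A `<=` B -> P B -> P A) -> compact K ->
  (forall w, K w -> exists2 d : R, 0 < d & P [set y | `|y - w| < d]) ->
  exists2 d : R, 0 < d & forall w, K w -> P [set y | `|y - w| < d].
Proof.
move=> mono /compact_near_coveringP /(_ R 0^'+ (fun d w => P [set y | `|y - w| < d]) _) cK H.
have : \forall d \near 0^'+, K `<=` (fun w => P [set y | `|y - w| < d]).
  apply: cK => w /H[d d0 Pd]; near=> x e.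
  apply: mono Pd => y /= yx.
  rewrite -[y - w](subrKA x) (le_lt_trans (ler_normD _ _)) // [ltRHS](splitr d) ltrD //.
    apply: lt_trans yx _; near: e; apply: nbhs_right_lt; lra.
  near: x; apply/nbhs_rVP; exists (d / 2) => //; lra.
move=> h; near (0 : R)^'+ => d; exists d => //; near: d; exact: h.
Unshelve. all: by end_near. Qed.

Lemma compact_pos_min (T : topologicalType) (K : set T) (phi : T -> R) : compact K ->
  {within K, continuous phi} -> (forall w : T, K w -> 0 < phi w) ->
  exists2 e : R, 0 < e & forall w : T, K w -> e <= phi w.
Proof.
move=> cK cphi h; have [->|/set0P K0] := eqVneq K set0; first by exists 1.
have [c cin hc] := compact_EVT_min K0 cK cphi.
exists (phi c); first by apply: h; rewrite inE in cin.
by move=> w Kw; apply: hc; rewrite inE.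
Qed.

Lemma unit_interval_ind (P : R -> Prop) :
  (forall s : R, 0 <= s <= 1 -> exists2 d : R, 0 < d &
     forall s' : R, 0 <= s' <= 1 -> `|s' - s| < d -> (P s <-> P s')) ->
  P 0 <-> P 1.
Proof.
move=> H.
pose B := [set s : R | 0 <= s <= 1 /\ (P s <-> P 0)].
have B0 : B 0 by split=> //; rewrite lexx ler01.
have seg (s : R) : `[0, 1]%classic s <-> 0 <= s <= 1 by rewrite /= in_itv.
suff E : B = `[0, 1]%classic.
  have : B 1 by rewrite E; apply/seg; rewrite lexx ler01.
  by case=> _ [].
have loc (s : R) : 0 <= s <= 1 -> \forall s' \near s, 0 <= s' <= 1 -> (P s <-> P s').
  move=> /H[d d0 h]; apply/nbhs_ballP; exists d => //= s'.
  by rewrite -ball_normE /ball_ /= distrC => hs hs'; apply: h.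
apply: (@segment_connected R 0 1) => //; first by exists 0.
- exists [set s | \forall s' \near s, 0 <= s' <= 1 -> (P s' <-> P 0)]°.
    exact: open_interior.
  apply/seteqP; split=> s.
    move=> [hs hP]; split; first exact/seg.
    rewrite /interior; apply: nbhs_interior.
    have := loc _ hs; apply: filterS => s' h /h; tauto.
  by move=> [/seg hs /interior_subset /nbhs_singleton /(_ hs)].
- exists (~` [set s | \forall s' \near s, 0 <= s' <= 1 -> ~ (P s' <-> P 0)]°).
    by apply: open_closedC; exact: open_interior.
  apply/seteqP; split=> s.
    move=> [hs hP]; split; first exact/seg.
    by move=> /interior_subset /nbhs_singleton /(_ hs).
  move=> [/seg hs h]; split=> //; apply: contrapT => hP; apply: h.
  rewrite /interior; apply: nbhs_interior.
  have := loc _ hs; apply: filterS => s' h /h; tauto.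
Qed.

Lemma segment_boundary W p q : open W -> W p -> ~ W q ->
  exists w, [/\ closure W w, ~ W w, `|w - p| <= `|q - p| & `|w - q| <= `|q - p|].
Proof.
move=> oW Wp Wq; apply: contrapT => H.
pose g (s : R) := p + s *: (q - p).
have gE s s' : g s' - g s = (s' - s) *: (q - p) by rewrite /g scalerBl; apply/rowP => i; rewrite !mxE; ring.
have g0 : g 0 = p by rewrite /g scale0r addr0.
have g1 : g 1 = q by rewrite /g scale1r addrC subrK.
suff : W (g 0) <-> W (g 1) by rewrite g0 g1; tauto.
have cl s s' (d : R) : 0 < d -> `|s' - s| < d / (`|q - p| + 1) -> `|g s' - g s| < d.
  move=> d0; rewrite gE normrZ ltr_pdivlMr; last by have := normr_ge0 (q - p); lra.
  by apply: le_lt_trans; rewrite ler_wpM2l // lerDl.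
have pos : 0 < `|q - p| + 1 by have := normr_ge0 (q - p); lra.
apply: (@unit_interval_ind (fun s => W (g s))) => s /andP[s0 s1].
have [Ws|nWs] := pselect (W (g s)).
  have /nbhs_rVP[d d0 h] : nbhs (g s) W by apply: open_nbhs_nbhs.
  exists (d / (`|q - p| + 1)); first exact: divr_gt0.
  by move=> s' _ /(cl _ _ _ d0) /h.
have nc : ~ closure W (g s).
  move=> cW; apply: H; exists (g s); split=> //.
    have -> : g s - p = s *: (q - p) by rewrite /g addrAC subrr add0r.
    by rewrite normrZ ger0_norm // ler_piMl.
  have -> : g s - q = (1 - s) *: (p - q) by rewrite /g; apply/rowP => i; rewrite !mxE; ring.
  by rewrite normrZ (distrC p) ger0_norm; [rewrite ler_piMl //; lra|lra].
have /nbhs_rVP[d d0 h] : nbhs (g s) (~` closure W).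
  by apply: open_nbhs_nbhs; split=> //; apply: closed_openC; exact: closed_closure.
exists (d / (`|q - p| + 1)); first exact: divr_gt0.
move=> s' _ /(cl _ _ _ d0) /h h'; split=> // Ws'; exfalso; apply: h'; exact: subset_closure.
Qed.

End Sup.

Section Grid.
Variables (R : realType) (N B n : nat).
(* The cube [-B, B)^N at mesh 1/n, as a torus; nothing happens near the seam for sets that are [boxed] below. *)
Definition grid := {ffun 'I_N -> 'I_(2 * B * n).-1.+1}.
Definition gshift (a : 'I_N) (x : grid) : grid := [ffun i => if i == a then ordS (x i) else x i].
Definition gpt (x : grid) : 'rV[R]_N := \row_i ((x i)%:R / n%:R - B%:R).

Lemma gshiftC a b x : gshift a (gshift b x) = gshift b (gshift a x).
Proof.
apply/ffunP => i; rewrite !ffunE; case: eqP => [->|]; case: eqP => [->|] //.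
Qed.
Lemma gshift_inj a : injective (gshift a).
Proof.
move=> x y /ffunP h; apply/ffunP => i; move: (h i); rewrite !ffunE.
by case: eqP => // _ /ordS_inj.
Qed.

(** A coordinate below [B - 1] lies more than [n] steps before the seam. *)
Lemma grid_lt k (x : grid) i : (0 < n)%N -> (k <= n)%N -> `|gpt x| + 1 < B%:R ->
  (x i + k < 2 * B * n)%N.
Proof.
move=> n0 kn xB; have n0' : (0 : R) < n%:R by rewrite ltr0n.
rewrite -(ltr_nat R) natrD !natrM.
have h1 : (k%:R : R) <= n%:R by rewrite ler_nat.
have := coord_le (gpt x) i; rewrite mxE => h2.
have h3 : (x i)%:R / n%:R - B%:R < B%:R - 1 :> R by move: (ler_norm ((x i)%:R / n%:R - B%:R : R)); lra.
have h4 : (x i)%:R / n%:R < 2 * B%:R - 1 :> R by lra.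
by move: h4; rewrite ltr_pdivrMr //; nra.
Qed.

Lemma gshift_val a (x : grid) j : (x a + 1 < 2 * B * n)%N -> (gshift a x j = x j + (j == a) :> nat)%N.
Proof.
rewrite addn1 => h; rewrite ffunE; case: eqP => [->|_] /=; last by rewrite addn0.
rewrite modn_small ?addn1 //.
by apply: (@leq_trans (2 * B * n)) => //; rewrite prednK //; apply: leq_ltn_trans h.
Qed.

Lemma reach_gpt k x y : (0 < n)%N -> (k <= n)%N -> `|gpt x| + 1 < B%:R ->
  reach gshift k x y -> `|gpt y - gpt x| <= k%:R / n%:R.
Proof.
move=> n0 kn xB [l [lk ->]].
have n0' : (0 : R) < n%:R by rewrite ltr0n.
have key (l' : seq 'I_N) (z : grid) : (forall i, (z i + size l' < 2 * B * n)%N) ->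
    forall i, (foldl (fun z a => gshift a z) z l' i = z i + count (pred1 i) l' :> nat)%N.
  elim: l' z => [|a l' IH] z hz i /=; first by rewrite addn0.
  have hs j : (gshift a z j = z j + (j == a) :> nat)%N.
    by apply: gshift_val; apply: leq_ltn_trans (hz a); rewrite leq_add2l.
  rewrite IH; last by move=> j; rewrite hs; have := hz j; rewrite /= addnS; case: (j == a); rewrite ?addn1 ?addn0 // => /ltnW.
  by rewrite hs eq_sym addnA.
apply: rV_norm_le => [|j]; first by rewrite divr_ge0 // ler0n.
rewrite !mxE key; last by move=> i; apply: leq_ltn_trans (grid_lt i n0 kn xB); rewrite leq_add2l.
rewrite natrD mulrDl opprB addrACA addrC.
rewrite (_ : _ + _ = (count (pred1 j) l)%:R / n%:R :> R); last ring.
rewrite ger0_norm ?divr_ge0 ?ler0n // ler_pM2r ?invr_gt0 // ler_nat.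
exact: leq_trans (count_size _ _) lk.
Qed.

Lemma gshift_gpt a x : (0 < n)%N -> `|gpt x| + 1 < B%:R -> `|gpt (gshift a x) - gpt x| <= n%:R^-1.
Proof.
move=> n0 xB; have := @reach_gpt 1 x (gshift a x) n0 n0 xB; rewrite div1r; apply.
by exists [:: a].
Qed.

(* The shifts wrap around the box, but a shift landing well inside it did not. *)
Lemma gshift_gpt_inv a x : (0 < n)%N -> `|gpt (gshift a x)| + 1 < B%:R ->
  `|gpt x - gpt (gshift a x)| <= n%:R^-1.
Proof.
move=> n0 xB; have n0' : (0 : R) < n%:R by rewrite ltr0n.
apply: rV_norm_le => [|j]; first by rewrite invr_ge0 ler0n.
rewrite !mxE ffunE; case: eqP => [->|_]; last by rewrite subrr normr0 invr_ge0 ler0n.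
have := coord_le (gpt (gshift a x)) a; rewrite mxE ffunE eqxx => h2.
have h3 : (- B%:R + 1 : R) < (ordS (x a))%:R / n%:R - B%:R.
  by have := ler_norm (- ((ordS (x a))%:R / n%:R - B%:R : R)); rewrite normrN; lra.
have h4 : (0 : R) < (ordS (x a))%:R / n%:R by lra.
have h5 : (0 < ordS (x a))%N.
  by rewrite lt0n; apply: contraTneq h4 => ->; rewrite mul0r ltxx.
have E : (ordS (x a) = (x a).+1 :> nat)%N.
  move: h5 => /=; have := ltn_ord (x a); rewrite leq_eqVlt => /predU1P[->|/modn_small -> //].
  by rewrite modnn.
rewrite E -natr1 (_ : _ - _ = - n%:R^-1 :> R); last ring.
by rewrite normrN ger0_norm // invr_ge0 ler0n.
Qed.

End Grid.

(** * Lattice degree *)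

Section Degree.
Variables (R : realType) (N B : nat).
Notation V := 'rV[R]_N.
Implicit Types (f g v : V -> V) (W C K : set V).

(** The margin 2 is spent in [chi_boundary]: one unit on the shift that leaves [W], one on the at
    most [n] shifts that follow. *)
Definition boxed W := forall w, W w -> `|w| + 2 < B%:R :> R.
(* The boundary of [W] when [W] is open. *)
Definition bdry W := closure W `\` W.

(* [degn n f W] is the degree of [f] on [W] at 0 for all large [n], the cochains being the sign indicators of the coordinates of [f]; it is only used through statements eventual in [n]. *)
Definition lab n f (j : 'I_N) (x : grid N B n) : int := ((0 < f (gpt R x) ord0 j)%R : nat)%:R.
Definition lform n f (x : grid N B n) : int :=
  dforms val (@gshift N B n) (@onef _ _) [seq lab f j | j <- enum 'I_N] x [set: 'I_N].
Definition degn n f W : int :=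
  deg val (@gshift N B n) (fun x => `[< W (gpt R x) >]) [seq lab f j | j <- enum 'I_N].

Lemma boxed_compact W : boxed W -> compact (closure W).
Proof.
move=> bW; apply: bounded_closed_compact; last exact: closed_closure.
have h : closure W `<=` [set w | `|w| <= B%:R].
  have cl : closed [set w : V | `|w| <= B%:R]; last first.
    by rewrite ((closure_id _).1 cl); apply: closureS => w /bW /=; lra.
  apply: (@preimage_closed _ _ _ [set r : R | r <= B%:R]); last exact: closed_le.
  by move=> w _; exact: norm_continuous.
exists B%:R; split; first by rewrite num_real.
by move=> M hM w /h /= hw; apply: le_trans hw (ltW hM).
Qed.

Lemma bdry_compact W : open W -> boxed W -> compact (bdry W).
Proof.
move=> oW bW; apply: subclosed_compact (boxed_compact bW) _; last by move=> w [].
by apply: closedI; [exact: closed_closure|exact: open_closedC].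
Qed.

(** An edge along which the indicator of [W] jumps has a boundary point close to its ends, by
    [segment_boundary], and [k] further shifts stay close to that point. *)
Lemma chi_boundary W n (x : grid N B n) a k : open W -> boxed W -> (0 < k <= n)%N ->
  `[< W (gpt R x) >] <> `[< W (gpt R (gshift a x)) >] ->
  exists2 w, bdry W w & forall y, reach (@gshift N B n) k (gshift a x) y ->
     `|gpt R y - w| <= k.+1%:R / n%:R.
Proof.
move=> oW bW /andP[k0 kn] h.
have n0 : (0 < n)%N by apply: leq_trans kn.
have ni : (n%:R^-1 : R) <= 1 by rewrite invf_le1 ?ltr0n // ler1n.
have ni0 : (0 : R) < n%:R^-1 by rewrite invr_gt0 ltr0n.
have [sx [w [cw nw w1]]] : `|gpt R (gshift a x)| + 1 < B%:R /\
    exists w, [/\ closure W w, ~ W w & `|w - gpt R (gshift a x)| <= n%:R^-1].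
  have [Wx|Wx] := pselect (W (gpt R x)); have [Wsx|Wsx] := pselect (W (gpt R (gshift a x))).
  - by exfalso; apply: h; rewrite !asboolT.
  - have bx := bW _ Wx; have bx1 : `|gpt R x| + 1 < B%:R by lra.
    have d := gshift_gpt a n0 bx1; split.
      have : `|gpt R (gshift a x)| <= `|gpt R (gshift a x) - gpt R x| + `|gpt R x|.
        by rewrite -[X in `|X| <= _](subrK (gpt R x)) ler_normD.
      lra.
    have [w [c1 c2 _ c3]] := segment_boundary oW Wx Wsx.
    by exists w; split=> //; apply: le_trans d.
  - have bx := bW _ Wsx; have bx1 : `|gpt R (gshift a x)| + 1 < B%:R by lra.
    have d := gshift_gpt_inv n0 bx1; split=> //.
    have [w [c1 c2 c3 _]] := segment_boundary oW Wsx Wx.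
    by exists w; split=> //; apply: le_trans d.
  - by exfalso; apply: h; rewrite !asboolF.
exists w => // y ry; have h1 := reach_gpt n0 kn sx ry.
rewrite -(subrKA (gpt R (gshift a x))).
rewrite -natr1 mulrDl mul1r; apply: le_trans (ler_normD _ _) _.
by rewrite lerD // distrC.
Qed.

Lemma near_invn (k : nat) (d : R) : 0 < d ->
  \forall n \near \oo, [/\ (0 < n)%N, (k <= n)%N & k.+1%:R / n%:R < d].
Proof.
move=> d0.
exists (maxn k (Num.truncn (k.+1%:R / d)).+1).+1 => // n /=.
rewrite gtn_max => /andP[h1 h2].
have n0 : (0 < n)%N by apply: leq_ltn_trans h1.
split=> //; first exact: ltnW.
rewrite ltr_pdivrMr ?ltr0n // mulrC -ltr_pdivrMr //.
by apply: lt_le_trans (truncnS_gt _) _; rewrite ler_nat ltnW.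
Qed.

Lemma lform_var n f (x : grid N B n) : lform f x != 0 ->
  forall j, exists y y', [/\ reach (@gshift N B n) N x y, reach (@gshift N B n) N x y' & lab f j y != lab f j y'].
Proof.
move=> h j; have [] := dforms_supp h; rewrite cardsT card_ord => h1 _.
by have [//|y [y' ?]] := h1 j; [rewrite mem_enum|exists y, y'].
Qed.

Lemma continuous_coord f j : continuous f -> continuous (fun y => f y ord0 j).
Proof.
move=> cf w; apply: (@continuous_comp _ _ _ f (fun M : V => M ord0 j)); first exact: cf.
exact: coord_continuous.
Qed.

(* Uniform in the perturbation: one threshold for [n] serves the whole family. *)
Lemma degn_family f W : open W -> boxed W -> continuous f -> (forall w, bdry W w -> f w != 0) ->
  exists2 c : R, 0 < c & forall (I : Type) (D : set I) (G : I -> V -> V),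
    (forall w, bdry W w -> \forall y \near w, forall i, D i -> `|f y - G i y| <= c) ->
    \forall n \near \oo, forall i, D i -> degn n f W = degn n (G i) W.
Proof.
move=> oW bW cf h.
have [||c c0 hc] := compact_pos_min (bdry_compact oW bW) (phi := fun w => `|f w|).
- apply: continuous_subspaceT => w.
  by apply: (@continuous_comp _ _ _ f (fun y => `|y|)); [exact: cf|exact: norm_continuous].
- by move=> w /h; rewrite normr_gt0.
(* [c] bounds [|f|] from below on the boundary: half of it is left for the variation of [f] near
   [w], half for the perturbation. *)
exists (c / 2) => [|I D G hG]; first lra.
(* One coordinate with a constant sign common to [f] and all [G i] keeps its label constant near
   [w], which is what [deg_change] asks for. *)
pose P (A : set V) := exists j b, forall y, A y ->
   (0 < f y ord0 j) = b /\ forall i, D i -> (0 < G i y ord0 j) = b.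
have [d d0 hd] : exists2 d : R, 0 < d & forall w, bdry W w -> P [set y | `|y - w| < d].
  apply: (@lebesgue_number R N _ P); last 1 first.
  - move=> w bw; have [j hj] := rV_norm_coord (h _ bw); have := hc _ bw; rewrite -hj => cj.
    have cfj : {for w, continuous (fun y => f y ord0 j)} by exact: (continuous_coord cf).
    have c2 : 0 < c / 2 by lra.
    move/cvgrPdist_lt : cfj => /(_ _ c2) cfj.
    have /nbhs_rVP[d d0 hd] : \forall y \near w, `|f w ord0 j - f y ord0 j| < c / 2 /\
        forall i, D i -> `|f y - G i y| <= c / 2.
      by near=> y; split; near: y; [exact: cfj|exact: hG].
    exists d => //; exists j, (0 < f w ord0 j) => y /hd [h1 h2].
    have main t : `|f w ord0 j - t| < c -> (0 < t) = (0 < f w ord0 j).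
      move: cj; rewrite ltr_norml ler_normr => /orP[] cj /andP[t1 t2].
        by apply/idP/idP => _; lra.
      by apply/idP/idP; lra.
    split=> [|i /h2 h3]; apply: main; first lra.
    rewrite -(subrKA (f y ord0 j)); apply: le_lt_trans (ler_normD _ _) _.
    by have := coord_le (f y - G i y) j; rewrite !mxE; lra.
  - by move=> A A' AA' [j [b hb]]; exists j, b => y /AA'; exact: hb.
  - exact: bdry_compact.
near=> n.
have [n0 Nn nd] : [/\ (0 < n)%N, (N < n)%N & N.+2%:R / n%:R < d] by near: n; apply: near_invn.
move=> i Di; apply: (deg_change val_inj (@gshiftC N B n) (@gshift_inj N B n)).
  by rewrite size_enum_ord card_ord.
move=> x a; rewrite card_ord => H; apply: contrapT => /(chi_boundary oW bW (k := N.+1)).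
rewrite Nn => /(_ isT)[w bw hw]; have [j [b hb]] := hd w bw.
have near_ok y : reach (@gshift N B n) N (gshift a x) y ->
    (0 < f (gpt R y) ord0 j) = b /\ (0 < G i (gpt R y) ord0 j) = b.
  move=> ry; have [|-> hh] := hb (gpt R y); last by split=> //; exact: hh.
    by apply: le_lt_trans nd; apply: hw; exact: reach_le ry.
have [|y [y' [/near_ok[h1 h2] /near_ok[h3 h4]]]] := H j; first by rewrite mem_enum.
by rewrite /lab h1 h2 h3 h4 eqxx; case.
Unshelve. all: by end_near. Qed.

Lemma sign_const f K : compact K -> continuous f -> (forall w, K w -> f w != 0) ->
  exists2 d : R, 0 < d & forall w, K w -> exists j b, forall y, `|y - w| < d -> (0 < f y ord0 j) = b.
Proof.
move=> cK cf h.
pose P (A : set V) := exists j b, forall y, A y -> (0 < f y ord0 j) = b.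
apply: (@lebesgue_number R N _ P) => //.
  by move=> A A' AA' [j [b hb]]; exists j, b => y /AA'; exact: hb.
move=> w /h fw; have [j hj] := rV_norm_coord fw.
have cfj : {for w, continuous (fun y => f y ord0 j)} by exact: (continuous_coord cf).
have [fp|fp] := ltP 0 (f w ord0 j).
  have : \forall y \near w, 0 < f y ord0 j by exact: (cvgr_gt _ cfj).
  by move=> /nbhs_rVP[d d0 hd]; exists d => //; exists j, true => y /hd.
have fn : f w ord0 j < 0.
  rewrite lt_neqAle fp andbT; apply: contra_eqN hj => /eqP ->.
  by rewrite normr0 eq_sym normr_eq0.
have : \forall y \near w, f y ord0 j < 0 by exact: (cvgr_lt _ cfj).
by move=> /nbhs_rVP[d d0 hd]; exists d => //; exists j, false => y /hd /ltW; rewrite leNgt => /negbTE.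
Qed.

(** At a nonzero value some coordinate keeps its sign on the whole cube, and its label has zero
    coboundary there. *)
Lemma lform_near0 f K : compact K -> continuous f -> (forall w, K w -> f w != 0) ->
  \forall n \near \oo, forall x : grid N B n, K (gpt R x) -> `|gpt R x| + 1 < B%:R -> lform f x = 0.
Proof.
move=> cK cf h; have [d d0 hd] := sign_const cK cf h.
near=> n.
have [n0 Nn nd] : [/\ (0 < n)%N, (N <= n)%N & N.+1%:R / n%:R < d] by near: n; apply: near_invn.
move=> x Kx bx; apply/eqP; apply: contrapT => /negP /lform_var H.
have [j [b hb]] := hd _ Kx.
have near_ok y : reach (@gshift N B n) N x y -> (0 < f (gpt R y) ord0 j) = b.
  move=> ry; apply: hb; apply: le_lt_trans nd; apply: le_trans (reach_gpt n0 Nn bx ry) _.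
  by rewrite ler_pM2r ?invr_gt0 ?ltr0n // ler_nat.
have [y [y' [/near_ok h1 /near_ok h3]]] := H j.
by rewrite /lab h1 h3 eqxx.
Unshelve. all: by end_near. Qed.

Lemma degnE n f W : degn n f W = \sum_(x : grid N B n) `[< W (gpt R x) >]%:R * lform f x.
Proof. by []. Qed.

(** Additivity and excision in one: away from the [U i] there are no zeros, so for large [n] the
    form vanishes there and the sums agree term by term. *)
Lemma degn_additive (J : eqType) (r : seq J) (U : J -> set V) f W :
  open W -> boxed W -> continuous f -> uniq r ->
  (forall i, i \in r -> open (U i) /\ U i `<=` W) ->
  (forall i j x, i \in r -> j \in r -> U i x -> U j x -> i = j) ->
  (forall x, closure W x -> f x = 0 -> exists2 i, i \in r & U i x) ->
  \forall n \near \oo, degn n f W = \sum_(i <- r) degn n f (U i).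
Proof.
move=> oW bW cf ur hU dU zU.
pose K := closure W `&` ~` \bigcup_(i in [set i | i \in r]) U i.
have cK : compact K.
  apply: subclosed_compact (boxed_compact bW) _; last by move=> x [].
  apply: closedI; first exact: closed_closure.
  by apply: open_closedC; apply: bigcup_open => i /hU[].
have := lform_near0 cK cf; case.
  by move=> w [cw nw]; apply/eqP => /(zU w cw)[i ir Ui]; apply: nw; exists i.
move=> n0 _ H; exists n0 => // n /H {}H.
rewrite degnE (eq_bigr (fun i => \sum_(x : grid N B n) `[< U i (gpt R x) >]%:R * lform f x)) //.
rewrite exchange_big; apply: eq_bigr => x _ /=.
have [[i ir Ui]|no] := pselect (exists2 i, i \in r & U i (gpt R x)).
  rewrite (bigD1_seq i) //= asboolT //; last exact: (hU i ir).2.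
  rewrite asboolT // big_seq_cond big1 ?addr0 // => j /andP[jr ji].
  by rewrite asboolF ?mul0r // => Uj; move: ji; rewrite (dU j i _ jr ir Uj Ui) eqxx.
rewrite big_seq_cond big1 ?addr0; last first.
  by move=> i /andP[ir _]; rewrite asboolF ?mul0r // => Ui; apply: no; exists i.
have [Wx|Wx] := pselect (W (gpt R x)); last by rewrite asboolF // mul0r.
rewrite H ?mulr0 //; last by have := bW _ Wx; lra.
by split; [exact: subset_closure|move=> [i ir Ui]; apply: no; exists i].
Qed.

(** The form is a product over the coordinates and lives on the single cube at the integer part of
    [c] in grid units. The last hypothesis stands in for a threshold on [n], because [degn_comp]
    uses centres that move with [n]. *)
Lemma degn_id_exact n c W : (0 < n)%N -> boxed W -> `|c| + 2 < B%:R ->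
  (forall y, `|y - c| <= n%:R^-1 -> W y) -> degn n (fun x => x - c) W = 1.
Proof.
move=> n0 bW bc hW.
have n0' : (0 : R) < n%:R by rewrite ltr0n.
have diag (x : grid N B n) : lform (fun x => x - c) x =
    \prod_(j < N) (lab (fun x => x - c) j (gshift j x) - lab (fun x => x - c) j x).
  rewrite /lform; have -> : [set: 'I_N]%SET = [set j in enum 'I_N]%SET.
    by apply/setP => j; rewrite !inE mem_enum.
  rewrite (dforms_diag (@gshiftC N B n)); first by rewrite big_enum.
  - by have := iota_ltn_sorted 0 N; rewrite -val_enum_ord sorted_map.
  - by move=> a b y ab; rewrite /lab !mxE ffunE eq_sym (negPf ab).
pose t j := (c ord0 j + B%:R) * n%:R.
have tb j : 0 <= t j /\ t j + n%:R < (2 * B * n)%:R.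
  have cj := coord_le c j; have h1 := ler_norm (c ord0 j); have h2 := ler_norm (- c ord0 j).
  rewrite normrN in h2; split; first by rewrite mulr_ge0 //; lra.
  rewrite !natrM /t; nra.
have labE (x : grid N B n) j : (0 < (gpt R x - c) ord0 j) = (t j < (x j)%:R).
  by rewrite !mxE /t -ltr_pdivlMr // -[RHS]subr_gt0; congr (0 < _); ring.
pose k j := Num.truncn (t j).
have kt j : (k j)%:R <= t j < (k j).+1%:R by apply: truncn_itv; case: (tb j).
pose xs : grid N B n := [ffun j => inord (k j)].
have xsE j : xs j = k j :> nat.
  rewrite ffunE inordK // prednK; last first.
    by have [+ _] := tb j; rewrite -(ltr_nat R); have := tb j; lra.
  by rewrite -(ltr_nat R); have := tb j; have /andP[+ _] := kt j; lra.
have xsc : `|gpt R xs - c| <= n%:R^-1.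
  apply: rV_norm_le => [|j]; first by rewrite invr_ge0 (ltW n0').
  rewrite !mxE xsE; have /andP[h1 h2] := kt j.
  have -> : (k j)%:R / n%:R - B%:R - c ord0 j = ((k j)%:R - t j) * n%:R^-1.
    by rewrite /t; field; rewrite gt_eqF.
  rewrite normrM (ger0_norm (x := n%:R^-1)) ?invr_ge0 ?(ltW n0') //.
  rewrite ler_piMl ?invr_ge0 ?(ltW n0') // ler0_norm; last lra.
  by move: h2; rewrite -natr1; lra.
have Wxs := hW _ xsc.
have shE (x : grid N B n) j : W (gpt R x) -> (gshift j x j = (x j).+1 :> nat)%N.
  move=> /bW bx; rewrite gshift_val; first by rewrite eqxx addn1.
  by apply: (@grid_lt R) => //; lra.
rewrite degnE (bigD1 xs) //= asboolT // mul1r diag big1 => [|j _].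
  rewrite big1 ?addr0 // => x xxs.
  have [Wx|Wx] := pselect (W (gpt R x)); last by rewrite asboolF // mul0r.
  rewrite asboolT // mul1r diag; apply/eqP; apply: contraNT xxs => /prodf_neq0 H.
  apply/eqP/ffunP => j; apply/val_inj; rewrite /= xsE.
  have := H j isT; rewrite /lab !labE shE // => {}H.
  apply/esym/truncn_def; rewrite leNgt.
  case h1 : (t j < (x j).+1%:R) in H *; case h2 : (t j < (x j)%:R) in H *; rewrite ?subrr // in H.
  have h3 : (x j)%:R <= (x j).+1%:R :> R by rewrite ler_nat.
  by rewrite (lt_le_trans h2 h3) in h1.
rewrite /lab !labE shE // xsE; have /andP[h1 h2] := kt j.
by rewrite h2 ltNge h1.
Qed.

Lemma degn_id c W : open W -> boxed W -> ~ bdry W c ->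
  \forall n \near \oo, degn n (fun x => x - c) W = (`[< W c >] : nat)%:R.
Proof.
move=> oW bW nc; have [Wc|Wc] := pselect (W c).
  rewrite asboolT //.
  have /nbhs_rVP[d d0 hd] : nbhs c W by apply: open_nbhs_nbhs.
  near=> n.
  have [n0 _ nd] : [/\ (0 < n)%N, (0 <= n)%N & 1%:R / n%:R < d] by near: n; apply: near_invn.
  apply: degn_id_exact => //; first exact: bW.
  by move=> y yc; apply: hd; apply: le_lt_trans nd; rewrite div1r.
rewrite asboolF //.
have := @lform_near0 (fun x => x - c) (closure W) (boxed_compact bW); case.
- by move=> x; apply: continuousB => //; exact: cst_continuous.
- by move=> w cw; rewrite subr_eq0; apply: contra_notN nc => /eqP e; rewrite -e in Wc *; split.
move=> n0 _ H; exists n0 => // n /H {}H; rewrite degnE big1 // => x _.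
have [Wx|Wx] := pselect (W (gpt R x)); last by rewrite asboolF // mul0r.
by rewrite H ?mulr0 //; [exact: subset_closure|have := bW _ Wx; lra].
Unshelve. all: by end_near. Qed.

End Degree.

(** * Composition formula *)

Section Composition.
Variables (R : realType) (N B : nat).
Notation V := 'rV[R]_N.
Notation I2 := ('I_N + 'I_N)%type.

(** The directions of the first factor precede those of the second; this order decides the signs in
    [deg2_snd] and [deg2_fst]. *)
Definition rk2 (s : I2) : nat := match s with inl i => i | inr j => (N + j)%N end.
Definition gshift2 n (s : I2) (z : grid N B n * grid N B n) : grid N B n * grid N B n :=
  match s with inl i => (gshift i z.1, z.2) | inr j => (z.1, gshift j z.2) end.

Lemma rk2_inj : injective rk2.
Proof.
move=> [i|i] [j|j] /= e.
- by rewrite (val_inj e).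
- by have := ltn_ord i; rewrite e ltnNge leq_addr.
- by have := ltn_ord j; rewrite -e ltnNge leq_addr.
- by move/addnI: e => /val_inj ->.
Qed.
Lemma gshift2C n a b (z : grid N B n * grid N B n) :
  gshift2 a (gshift2 b z) = gshift2 b (gshift2 a z).
Proof. by case: a => a; case: b => b //=; rewrite gshiftC. Qed.
Lemma gshift2_inj n a : injective (@gshift2 n a).
Proof. by case: a => a [x y] [x' y'] /= [h1 h2]; rewrite ?h1 ?h2 ?(gshift_inj h1) ?(gshift_inj h2). Qed.

Lemma reach_fst n k z z' : reach (@gshift2 n) k z z' -> reach (@gshift N B n) k z.1 z'.1.
Proof.
move=> [l [lk ->]]; elim: l k z lk => [|[i|i] l IH] k z /=; first by exists [::].
  by case: k => // k lk; apply: (reach_step (a := i)); exact: IH lk.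
by move=> lk; apply: reach_le (leqnn k) _; exact: (IH _ (z.1, _) (ltnW lk)).
Qed.
Lemma reach_snd n k z z' : reach (@gshift2 n) k z z' -> reach (@gshift N B n) k z.2 z'.2.
Proof.
move=> [l [lk ->]]; elim: l k z lk => [|[i|i] l IH] k z /=; first by exists [::].
  by move=> lk; apply: reach_le (leqnn k) _; exact: (IH _ (_, z.2) (ltnW lk)).
by case: k => // k lk; apply: (reach_step (a := i)); exact: IH lk.
Qed.

Variables (v Gam : V -> V) (a0 : V).

Definition labD n (i : 'I_N) (z : grid N B n * grid N B n) : int :=
  ((0 < (gpt R z.2 - v (gpt R z.1)) ord0 i)%R : nat)%:R.
(* The degree on [W x C] of [(y - v x, F)], with [l] the indicators of [F]. *)
Definition deg2 n (W C : set V) (l : seq (grid N B n * grid N B n -> int)) : int :=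
  deg rk2 (@gshift2 n) (fun z => `[< W (gpt R z.1) >] && `[< C (gpt R z.2) >])
    ([seq labD i | i <- enum 'I_N] ++ l).

Lemma setC_inr : (~: [set inr j | j : 'I_N])%SET = [set (inl i : I2) | i in [set: 'I_N]%SET]%SET.
Proof.
apply/setP => -[i|i]; rewrite !inE.
  rewrite [RHS]imset_f ?inE //; apply/negP => /imsetP[]//.
have -> : (inr i : I2) \in [set inr j | j : 'I_N]%SET by apply: imset_f.
by symmetry; apply/negP => /imsetP[].
Qed.
Lemma setC_inl : (~: [set inl j | j : 'I_N])%SET = [set (inr i : I2) | i in [set: 'I_N]%SET]%SET.
Proof.
apply/setP => -[i|i]; rewrite !inE; last first.
  rewrite [RHS]imset_f ?inE //; apply/negP => /imsetP[]//.
have -> : (inl i : I2) \in [set inl j | j : 'I_N]%SET by apply: imset_f.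
by symmetry; apply/negP => /imsetP[].
Qed.

Lemma In_map (S T : Type) (f : S -> T) (r : seq S) t : List.In t (map f r) -> exists s, t = f s.
Proof. by elim: r => //= s r IH [<-|/IH //]; exists s. Qed.

(** Fubini: the last [N] labels see only the second variable, use up its directions and leave the
    first ones to [labD]. The blocks are already in order, so there is no sign. *)
Lemma deg2_snd n W C :
  deg2 W C [seq (fun z : grid N B n * grid N B n => lab (fun y => Gam y - a0) i z.2) | i <- enum 'I_N] =
  \sum_(y : grid N B n) `[< C (gpt R y) >]%:R * lform (fun y => Gam y - a0) y
      * degn B n (fun x => gpt R y - v x) W.
Proof.
rewrite /deg2 /deg.
transitivity (\sum_(x : grid N B n) \sum_(y : grid N B n)
   `[< C (gpt R y) >]%:R * lform (fun y => Gam y - a0) y *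
   (`[< W (gpt R x) >]%:R * lform (fun x => gpt R y - v x) x)).
  rewrite pair_bigA; apply: eq_bigr => -[x y] _ /=.
  rewrite (@dforms_prod _ rk2 _ _ (@gshift2C n) [set inr j | j : 'I_N]%SET false); last first.
  - move=> s hs; have [i ->] := In_map hs; move=> [a|a] z // /negP[]; exact: imset_f.
  - by rewrite size_map size_enum_ord setC_inr card_imset ?cardsT ?card_ord // => i j [].
  - by rewrite size_map size_enum_ord card_imset ?card_ord // => i j [].
  - move=> [a|a] b; last by move=> /negP[]; apply: imset_f.
    move=> _ /imsetP[j _ ->] /=; apply/negbTE; rewrite -leqNgt.
    by apply: leq_trans (ltnW (ltn_ord a)) _; rewrite leq_addr.
  rewrite !mul0n mul1r setC_inr.
  rewrite (@dforms_restr _ _ rk2 val _ _ (@gshift2 n) (@gshift N B n) inl (fun x => (x, y))) //; last first.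
    by move=> i j [].
  have -> : [set inr j | j : 'I_N]%SET = [set (inr i : I2) | i in [set: 'I_N]%SET]%SET.
    by apply/setP => s; apply/imsetP/imsetP => -[i _ ->]; exists i.
  rewrite (@dforms_restr _ _ rk2 val _ _ (@gshift2 n) (@gshift N B n) inr (fun y => (x, y))) //; last 2 first.
  - by move=> i j [].
  - by move=> i j /=; rewrite ltn_add2l.
  transitivity ((`[< W (gpt R x) >] && `[< C (gpt R y) >])%:R *
     (lform (fun x => gpt R y - v x) x * lform (fun y => Gam y - a0) y)).
    by rewrite -!(map_comp _ _ (enum 'I_N)).
  by rewrite -mulnb natrM; ring.
rewrite exchange_big; apply: eq_bigr => y _ /=.
by rewrite degnE mulr_sumr.
Qed.

(** Fubini in the other order: [labD] now gets the second directions, and moving a block of [N] past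
    a block of [N] gives the sign. *)
Lemma deg2_fst n W C :
  deg2 W C [seq (fun z : grid N B n * grid N B n => lab (fun x => Gam (v x) - a0) i z.1) | i <- enum 'I_N] =
  (-1) ^+ (N * N) *
  \sum_(x : grid N B n) `[< W (gpt R x) >]%:R * lform (fun x => Gam (v x) - a0) x
      * degn B n (fun y => y - v (gpt R x)) C.
Proof.
rewrite /deg2 /deg.
transitivity (\sum_(x : grid N B n) \sum_(y : grid N B n)
   (-1) ^+ (N * N) * (`[< W (gpt R x) >]%:R * lform (fun x => Gam (v x) - a0) x *
   (`[< C (gpt R y) >]%:R * lform (fun y => y - v (gpt R x)) y))).
  rewrite pair_bigA; apply: eq_bigr => -[x y] _ /=.
  rewrite (@dforms_prod _ rk2 _ _ (@gshift2C n) [set inl j | j : 'I_N]%SET true); last first.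
  - move=> s hs; have [i ->] := In_map hs; move=> [a|a] z // /negP[]; exact: imset_f.
  - by rewrite size_map size_enum_ord setC_inl card_imset ?cardsT ?card_ord // => i j [].
  - by rewrite size_map size_enum_ord card_imset ?card_ord // => i j [].
  - move=> [a|a] b; first by move=> /negP[]; apply: imset_f.
    move=> _ /imsetP[j _ ->] /=.
    by apply: leq_trans (ltn_ord j) _; rewrite leq_addr.
  have cA (f : 'I_N -> I2) : injective f -> #|[set f j | j : 'I_N]%SET| = N.
    by move=> fi; rewrite card_imset ?card_ord.
  have cB (f : 'I_N -> I2) : injective f -> #|[set f j | j in [set: 'I_N]%SET]%SET| = N.
    by move=> fi; rewrite card_imset ?cardsT ?card_ord.
  rewrite mul1n setC_inl cA ?cB; [|by move=> i j []|by move=> i j []].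
  rewrite (@dforms_restr _ _ rk2 val _ _ (@gshift2 n) (@gshift N B n) inr (fun y => (x, y))) //; last 2 first.
  - by move=> i j [].
  - by move=> i j /=; rewrite ltn_add2l.
  have -> : [set inl j | j : 'I_N]%SET = [set (inl i : I2) | i in [set: 'I_N]%SET]%SET.
    by apply/setP => s; apply/imsetP/imsetP => -[i _ ->]; exists i.
  rewrite (@dforms_restr _ _ rk2 val _ _ (@gshift2 n) (@gshift N B n) inl (fun x => (x, y))) //; last first.
    by move=> i j [].
  transitivity ((`[< W (gpt R x) >] && `[< C (gpt R y) >])%:R * ((-1) ^+ (N * N) *
     (lform (fun y => y - v (gpt R x)) y * lform (fun x => Gam (v x) - a0) x))).
    by rewrite -!(map_comp _ _ (enum 'I_N)).
  by rewrite -mulnb natrM; ring.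
rewrite mulr_sumr; apply: eq_bigr => x _ /=.
by rewrite degnE -!mulr_sumr.
Qed.

End Composition.

Section Composition2.
Variables (R : realType) (N B : nat).
Notation V := 'rV[R]_N.
Notation I2 := ('I_N + 'I_N)%type.

Lemma uniform_cts (v : V -> V) K (e : R) : compact K -> continuous v -> 0 < e ->
  exists2 d : R, 0 < d & forall w x x', K w -> `|x - w| < d -> `|x' - w| < d -> `|v x - v x'| < e.
Proof.
move=> cK cv e0.
pose P (A : set V) := forall x x', A x -> A x' -> `|v x - v x'| < e.
have [|//|w _|d d0 hd] := @lebesgue_number R N K P.
- by move=> A A' AA' hA x x' /AA' h1 /AA' h2; exact: hA.
- have e2 : 0 < e / 2 by lra.
  have /cvgrPdist_lt /(_ _ e2) /nbhs_rVP[d d0 hd] := cv w.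
  exists d => // x x' /hd h1 /hd h2.
  rewrite -(subrKA (v w)) (le_lt_trans (ler_normD _ _)) // (splitr e) ltrD //.
  by rewrite distrC.
- by exists d => // w x x' Kw; exact: hd.
Qed.

Lemma sign_change_le (a b c e : R) : (0 < a) != (0 < b) -> `|a - c| <= e -> `|b - c| <= e -> `|c| <= e.
Proof.
rewrite !ler_norml; case: (ltP 0 a) => ha; case: (ltP 0 b) => hb // _ /andP[? ?] /andP[? ?]; lra.
Qed.

Variables (v Gam : V -> V) (a0 : V) (W C : set V) (nW : nat -> int).
Hypotheses (oW : open W) (bW : boxed B W) (oC : open C) (bC : boxed B C).
Hypotheses (cv : continuous v) (cG : continuous Gam).
Hypothesis a0_bdry : forall w, bdry W w -> Gam (v w) != a0.
Hypothesis bdryC : forall y, bdry C y -> exists2 w, bdry W w & v w = y.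
Hypothesis vWC : forall w, W w -> C (v w).
(* [nW n] plays the degree of [v] on [W] over every point of [C]. *)
Hypothesis nWE : forall y, C y ->
  \forall y' \near y & n \near \oo, degn B n (fun x => y' - v x) W = nW n.

(* Where the first N cochains vary, [y] is close to [v x], so [Gam y] may be replaced by [Gam (v x)]. *)
Lemma deg2_homotopy : \forall n \near \oo,
  deg2 v W C [seq (fun z : grid N B n * grid N B n => lab (fun y => Gam y - a0) i z.2) | i <- enum 'I_N] =
  deg2 v W C [seq (fun z : grid N B n * grid N B n => lab (fun x => Gam (v x) - a0) i z.1) | i <- enum 'I_N].
Proof.
pose K1 := v @` bdry W.
have cK1 : compact K1.
  by apply: continuous_compact (bdry_compact oW bW); exact: continuous_subspaceT.
have cGa : continuous (fun y => Gam y - a0).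
  by move=> y; apply: continuousB; [exact: cG|exact: cst_continuous].
have [|d1 d10 hd1] := sign_const cK1 cGa.
  by move=> _ [w bw <-]; rewrite subr_eq0; exact: a0_bdry.
have d4 : 0 < d1 / 4 by lra.
have [d2 d20 hd2] := uniform_cts (boxed_compact bW) cv d4.
near=> n.
(* A cube has [N + N] directions; the extra step keeps [k] positive when [N] is 0. *)
pose k := (N + N).+1.
have [n0 kn nd] : [/\ (0 < n)%N, (k <= n)%N & k.+1%:R / n%:R < Num.min (d1 / 8) d2].
  by near: n; apply: near_invn; rewrite lt_min d20 andbT; lra.
have {nd}[nd1 nd2] : k.+1%:R / n%:R < d1 / 8 /\ k.+1%:R / n%:R < d2.
  by move: nd; rewrite lt_min => /andP.
have kk : k%:R / n%:R <= k.+1%:R / n%:R :> R by rewrite ler_pM2r ?invr_gt0 ?ltr0n // ler_nat.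
pose G n := (grid N B n * grid N B n)%type.
pose js : seq I2 := [seq inl i | i <- enum 'I_N] ++ [seq inr i | i <- enum 'I_N].
pose mk F (j : I2) : G n -> int := match j with inl i => labD v i | inr i => F i end.
have mkE F : [seq labD v i | i <- enum 'I_N] ++ [seq F i | i <- enum 'I_N] = [seq mk F j | j <- js].
  by rewrite map_cat -!(map_comp _ _ (enum 'I_N)).
rewrite /deg2 !mkE; apply: (deg_change (@rk2_inj N) (@gshift2C N B n) (@gshift2_inj N B n)).
  by rewrite /js size_cat !(size_map _ (enum 'I_N)) size_enum_ord card_sum card_ord.
move=> z a; have -> : #|{: I2}| = (N + N)%N by rewrite card_sum card_ord.
move=> H; apply: contrapT => neq.
have memjs j : j \in js.
  by rewrite mem_cat; case: j => i; rewrite map_f ?mem_enum ?orbT.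
have Hl i : exists z1 z2, [/\ reach (@gshift2 _ B n) k (gshift2 a z) z1, reach (@gshift2 _ B n) k (gshift2 a z) z2 &
    (0 < (gpt R z1.2 - v (gpt R z1.1)) ord0 i) != (0 < (gpt R z2.2 - v (gpt R z2.1)) ord0 i)].
  have [z1 [z2 [r1 r2 hh]]] := H _ (memjs (inl i)).
  exists z1, z2; split; [exact: reach_le r1|exact: reach_le r2|].
  by case: hh => /=; rewrite /labD ?eqxx // => hh; apply: contraNneq hh => ->.
(* Both [y] and [v x] are near one point of the image of [bdry W]: the value of [v] at the crossing
   point if the edge crosses the boundary of [W], and the crossing point itself, by [bdryC], if it
   crosses that of [C]. *)
have [q Kq hq] : exists2 q, K1 q & forall z', reach (@gshift2 _ B n) k (gshift2 a z) z' ->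
    `|gpt R z'.2 - q| < d1 /\ `|v (gpt R z'.1) - q| < d1.
  move: z a neq Hl {H} => [x y] [i|i] /= neq Hl.
  - have Cy : C (gpt R y) by apply: contrapT => nC; apply: neq; rewrite [(`[< C _ >])]asboolF // !andbF.
    have neqW : `[< W (gpt R x) >] <> `[< W (gpt R (gshift i x)) >] by move=> e; apply: neq; rewrite e.
    have [|w bw hw] := chi_boundary oW bW (k := k) _ neqW; first by rewrite /= kn.
    have hx z' : reach (@gshift2 _ B n) k (gshift i x, y) z' -> `|v (gpt R z'.1) - v w| < d1 / 4.
      move=> /reach_fst /hw /= h; apply: (hd2 w) => //; [by case: bw|exact: le_lt_trans nd2|].
      by rewrite subrr normr0.
    have hy z' : reach (@gshift2 _ B n) k (gshift i x, y) z' -> `|gpt R z'.2 - gpt R y| < d1 / 8.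
      move=> /reach_snd /= h; apply: le_lt_trans nd1; apply: le_trans kk.
      by apply: reach_gpt h => //; have := bC Cy; lra.
    (* Every coordinate of [y - v x] changes sign on the cube, hence is small. *)
    have yw : `|gpt R y - v w| <= d1 / 8 + d1 / 4.
      apply: rV_norm_le => [|j]; first lra.
      have [z1 [z2 [r1 r2 s12]]] := Hl j.
      have est z' : reach (@gshift2 _ B n) k (gshift i x, y) z' ->
          `|(gpt R z'.2 - v (gpt R z'.1)) ord0 j - (gpt R y - v w) ord0 j| <= d1 / 8 + d1 / 4.
        move=> r; have -> : (gpt R z'.2 - v (gpt R z'.1)) ord0 j - (gpt R y - v w) ord0 j =
          (gpt R z'.2 - gpt R y) ord0 j - (v (gpt R z'.1) - v w) ord0 j by rewrite !mxE; ring.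
        apply: le_trans (ler_normB _ _) _; apply: lerD.
          by apply: le_trans (coord_le _ _) _; apply/ltW/hy.
        by apply: le_trans (coord_le _ _) _; apply/ltW/hx.
      exact: sign_change_le s12 (est _ r1) (est _ r2).
    exists (v w); first by exists w.
    move=> z' r; split; last by have := hx _ r; lra.
    rewrite -(subrKA (gpt R y)); apply: le_lt_trans (ler_normD _ _) _.
    by have := hy _ r; lra.
  - have Wx : W (gpt R x) by apply: contrapT => nC; apply: neq; rewrite [(`[< W _ >])]asboolF.
    have neqC : `[< C (gpt R y) >] <> `[< C (gpt R (gshift i y)) >] by move=> e; apply: neq; rewrite e.
    have [|q bq hq] := chi_boundary oC bC (k := k) _ neqC; first by rewrite /= kn.
    have hy z' : reach (@gshift2 _ B n) k (x, gshift i y) z' -> `|gpt R z'.2 - q| < d1 / 8.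
      by move=> /reach_snd /hq /= h; apply: le_lt_trans nd1.
    have hx z' : reach (@gshift2 _ B n) k (x, gshift i y) z' -> `|v (gpt R z'.1) - v (gpt R x)| < d1 / 4.
      move=> /reach_fst /= h; apply: (hd2 (gpt R x)) => //; first exact: subset_closure.
        apply: le_lt_trans nd2; apply: le_trans kk.
        by apply: reach_gpt h => //; have := bW Wx; lra.
      by rewrite subrr normr0.
    have yw : `|q - v (gpt R x)| <= d1 / 8 + d1 / 4.
      apply: rV_norm_le => [|j]; first lra.
      have [z1 [z2 [r1 r2 s12]]] := Hl j.
      have est z' : reach (@gshift2 _ B n) k (x, gshift i y) z' ->
          `|(gpt R z'.2 - v (gpt R z'.1)) ord0 j - (q - v (gpt R x)) ord0 j| <= d1 / 8 + d1 / 4.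
        move=> r; have -> : (gpt R z'.2 - v (gpt R z'.1)) ord0 j - (q - v (gpt R x)) ord0 j =
          (gpt R z'.2 - q) ord0 j - (v (gpt R z'.1) - v (gpt R x)) ord0 j by rewrite !mxE; ring.
        apply: le_trans (ler_normB _ _) _; apply: lerD.
          by apply: le_trans (coord_le _ _) _; apply/ltW/hy.
        by apply: le_trans (coord_le _ _) _; apply/ltW/hx.
      exact: sign_change_le s12 (est _ r1) (est _ r2).
    exists q; first by have [w bw <-] := bdryC bq; exists w.
    move=> z' r; split; first by have := hy _ r; lra.
    rewrite -(subrKA (v (gpt R x))); apply: le_lt_trans (ler_normD _ _) _.
    by have := hx _ r; rewrite distrC in yw; lra.
have [j [b hb]] := hd1 q Kq.
have [z1 [z2 [r1 r2]]] := H _ (memjs (inr j)).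
have [y1 x1] := hq _ (reach_le (leqnSn _) r1); have [y2 x2] := hq _ (reach_le (leqnSn _) r2).
by rewrite /= /lab !hb // eqxx; case.
Unshelve. all: by end_near. Qed.

(** The two sides are the iterated sums for the two ends of [deg2_homotopy]. The inner degrees,
    [nW n] and 1, are known only in the interior. Where [Gam y - a0], or [Gam (v x) - a0], has norm
    at least [e / 2] the outer form vanishes; what remains is a compact set in the interior, on
    which one threshold for [n] suffices. *)
Lemma degn_comp : \forall n \near \oo,
  nW n * degn B n (fun y => Gam y - a0) C = (-1) ^+ (N * N) * degn B n (fun x => Gam (v x) - a0) W.
Proof.
have cGa : continuous (fun y => Gam y - a0).
  by move=> y; apply: continuousB; [exact: cG|exact: cst_continuous].
have cGv : continuous (fun y => Gam (v y) - a0).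
  by move=> y; apply: (@continuous_comp _ _ _ v (fun y => Gam y - a0)); [exact: cv|exact: cGa].
have cnG : continuous (fun y => `|Gam y - a0|).
  by move=> y; apply: (@continuous_comp _ _ _ (fun y => Gam y - a0) (fun y => `|y|)); [exact: cGa|exact: norm_continuous].
have cnGv : continuous (fun y => `|Gam (v y) - a0|).
  by move=> y; apply: (@continuous_comp _ _ _ v (fun y => `|Gam y - a0|)); [exact: cv|exact: cnG].
have [||e e0 he] := compact_pos_min (bdry_compact oW bW) (phi := fun w => `|Gam (v w) - a0|).
- exact: continuous_subspaceT.
- by move=> w /a0_bdry h; rewrite normr_gt0 subr_eq0.
have eC y : bdry C y -> e <= `|Gam y - a0| by move=> /bdryC[w /he h <-].
pose KC := closure C `&` [set y | `|Gam y - a0| <= e / 2].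
pose KW := closure W `&` [set y | `|Gam (v y) - a0| <= e / 2].
have cKC : compact KC.
  apply: subclosed_compact (boxed_compact bC) _; last by move=> ? [].
  apply: closedI; first exact: closed_closure.
  by apply: (@preimage_closed _ _ _ [set r : R | r <= e / 2]); [move=> y _; exact: cnG|exact: closed_le].
have cKW : compact KW.
  apply: subclosed_compact (boxed_compact bW) _; last by move=> ? [].
  apply: closedI; first exact: closed_closure.
  by apply: (@preimage_closed _ _ _ [set r : R | r <= e / 2]); [move=> y _; exact: cnGv|exact: closed_le].
have KCC y : KC y -> C y.
  by move=> [cy /= hy]; apply: contrapT => nC; have /eC := conj cy nC; lra.
have KWW y : KW y -> W y.
  by move=> [cy /= hy]; apply: contrapT => nC; have /he := conj cy nC; lra.
pose KC' := closure C `&` [set y | e / 2 <= `|Gam y - a0|].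
pose KW' := closure W `&` [set y | e / 2 <= `|Gam (v y) - a0|].
have cKC' : compact KC'.
  apply: subclosed_compact (boxed_compact bC) _; last by move=> ? [].
  apply: closedI; first exact: closed_closure.
  by apply: (@preimage_closed _ _ _ [set r : R | e / 2 <= r]); [move=> y _; exact: cnG|exact: closed_ge].
have cKW' : compact KW'.
  apply: subclosed_compact (boxed_compact bW) _; last by move=> ? [].
  apply: closedI; first exact: closed_closure.
  by apply: (@preimage_closed _ _ _ [set r : R | e / 2 <= r]); [move=> y _; exact: cnGv|exact: closed_ge].
have [||d d0 hd] := @lebesgue_number R N (v @` KW) (fun A => A `<=` C) (fun A A' h h' => subset_trans h h').
- by apply: continuous_compact cKW; exact: continuous_subspaceT.
- move=> _ [w Kw <-]; have /nbhs_rVP[d d0 hd] : nbhs (v w) C.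
    by apply: open_nbhs_nbhs; split=> //; apply/vWC/KWW.
  by exists d.
have nC0 : \forall n \near \oo, forall x : grid N B n, KC' (gpt R x) -> `|gpt R x| + 1 < B%:R ->
    lform (fun y => Gam y - a0) x = 0.
  apply: (@lform_near0 R N B (fun y => Gam y - a0) KC' cKC' cGa) => w [_ /= hw]; rewrite -normr_gt0; lra.
have nW0 : \forall n \near \oo, forall x : grid N B n, KW' (gpt R x) -> `|gpt R x| + 1 < B%:R ->
    lform (fun y => Gam (v y) - a0) x = 0.
  apply: lform_near0 => // w [_ /= hw]; rewrite -normr_gt0; lra.
have nWn : \forall n \near \oo, KC `<=` (fun y => degn B n (fun x => y - v x) W = nW n).
  have := compact_near_coveringP KC; move=> [/(_ cKC) + _]; apply => y /KCC; exact: nWE.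
near=> n.
have n0 : (0 < n)%N by near: n; exists 1%N.
have hC0 : forall x : grid N B n, KC' (gpt R x) -> `|gpt R x| + 1 < B%:R ->
    lform (fun y => Gam y - a0) x = 0 by near: n.
have hW0 : forall x : grid N B n, KW' (gpt R x) -> `|gpt R x| + 1 < B%:R ->
    lform (fun y => Gam (v y) - a0) x = 0 by near: n.
have hWn : KC `<=` (fun y => degn B n (fun x => y - v x) W = nW n) by near: n.
have nd : n%:R^-1 < d.
  have [] : [/\ (0 < n)%N, (0 <= n)%N & 1%:R / n%:R < d] by near: n; apply: near_invn.
  by rewrite div1r.
transitivity (\sum_(y : grid N B n) `[< C (gpt R y) >]%:R * lform (fun y => Gam y - a0) y
      * degn B n (fun x => gpt R y - v x) W).
  rewrite [in LHS]degnE mulr_sumr; apply: eq_bigr => y _; rewrite mulrC.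
  have [Cy|nC] := pselect (C (gpt R y)); last by rewrite asboolF // !mul0r.
  have cy := subset_closure Cy; have by_ := bC Cy.
  have [le|gt] := leP `|Gam (gpt R y) - a0| (e / 2); first by rewrite hWn.
  by rewrite hC0 ?mulr0 ?mul0r //; [split=> //; exact: ltW|lra].
rewrite -deg2_snd (_ : deg2 _ _ _ _ = deg2 v W C [seq (fun z : grid N B n * grid N B n => lab (fun x => Gam (v x) - a0) i z.1) | i <- enum 'I_N]); last first.
  by near: n; exact: deg2_homotopy.
rewrite deg2_fst [in RHS]degnE; congr (_ * _); apply: eq_bigr => x _.
have [Wx|nW'] := pselect (W (gpt R x)); last by rewrite asboolF // !mul0r.
have cx := subset_closure Wx; have bx := bW Wx.
have [le|gt] := leP `|Gam (v (gpt R x)) - a0| (e / 2); last first.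
  by rewrite hW0 ?mulr0 ?mul0r //; [split=> //; exact: ltW|lra].
rewrite degn_id_exact ?mulr1 //; first by apply: bC; exact: vWC.
move=> y yv; apply: (hd (v (gpt R x))); first by exists (gpt R x).
exact: le_lt_trans nd.
Unshelve. all: by end_near. Qed.

End Composition2.

(** * Homotopy invariance and quasi-components *)

Section DegreeCor.
Variables (R : realType) (N B : nat).
Notation V := 'rV[R]_N.
Implicit Types (f g v : V -> V) (W C K : set V).

Lemma continuous_pair (T U U' : topologicalType) (f : T -> U) (g : T -> U') x :
  {for x, continuous f} -> {for x, continuous g} -> {for x, continuous (fun y => (f y, g y))}.
Proof.
by move=> cf cg; exact: (@cvg_pair _ _ _ (nbhs x) (nbhs (f x)) (nbhs (g x)) _ _ _ f g cf cg).
Qed.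

Lemma continuous_subl (c : V) v : continuous v -> continuous (fun x => c - v x).
Proof. by move=> cv x; apply: continuousB; [exact: cst_continuous|exact: cv]. Qed.
Lemma continuous_subr (c : V) v : continuous v -> continuous (fun x => v x - c).
Proof. by move=> cv x; apply: continuousB; [exact: cv|exact: cst_continuous]. Qed.

Lemma degn_translate v W y0 : open W -> boxed B W -> continuous v -> (forall w, bdry W w -> v w != y0) ->
  \forall y \near y0 & n \near \oo, degn B n (fun x => y - v x) W = degn B n (fun x => y0 - v x) W.
Proof.
move=> oW bW cv h.
have [|c c0 hc] := degn_family oW bW (continuous_subl (c := y0) cv).
  by move=> w /h; rewrite subr_eq0 eq_sym.
have [|n0 _ hn] := hc V [set y | `|y - y0| < c] (fun y x => y - v x).
  move=> w _; near=> y => y' /= /ltW h'.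
  by rewrite opprB subrKA distrC.
exists ([set y | `|y - y0| < c], [set n | (n0 <= n)%N]) => /=.
  by split; [apply/nbhs_rVP; exists c|exists n0].
by move=> [y n] /= [yc /hn /(_ y yc) ->].
Unshelve. all: by end_near. Qed.

Lemma degn_eq_bdry f g W : open W -> boxed B W -> continuous f -> continuous g ->
  (forall w, bdry W w -> f w != 0) -> (forall w, bdry W w -> f w = g w) ->
  \forall n \near \oo, degn B n f W = degn B n g W.
Proof.
move=> oW bW cf cg h fg; have [c c0 hc] := degn_family oW bW cf h.
have [|n0 _ hn] := hc unit setT (fun=> g); last by exists n0 => // n /hn /(_ tt I).
move=> w /fg e; have cfg : {for w, continuous (fun x => f x - g x)} by apply: continuousB; [exact: cf|exact: cg].
move/cvgrPdist_lt : cfg =>  /(_ _ c0); apply: filterS => y.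
by rewrite e subrr sub0r normrN => /ltW h' _ _.
Qed.

(** The threshold for [n] may depend on the parameter; only eventual equality is carried along
    [0, 1]. *)
Lemma degn_homotopy (h : R -> V -> V) W : open W -> boxed B W ->
  continuous (fun p : R * V => h p.1 p.2) ->
  (forall s w, 0 <= s <= 1 -> bdry W w -> h s w != 0) ->
  \forall n \near \oo, degn B n (h 0) W = degn B n (h 1) W.
Proof.
move=> oW bW ch h0.
have chs s : continuous (h s).
  move=> w; apply: (@continuous_comp _ _ _ (fun w => (s, w)) (fun p : R * V => h p.1 p.2)).
    by apply: continuous_pair; [exact: cst_continuous|move=> A; exact: cvg_id].
  exact: ch.
pose P s := \forall n \near \oo, degn B n (h 0) W = degn B n (h s) W.
suff : P 0 <-> P 1 by move=> [H _]; apply: H; exists 0%N.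
apply: unit_interval_ind => s s01.
have [c c0 hc] := degn_family oW bW (chs s) (fun w => h0 s w s01).
have c2 : 0 < c / 2 by lra.
have /compact_near_coveringP cK := bdry_compact oW bW.
have := cK R (nbhs s) (fun s' w => \forall y \near w, `|h s y - h s' y| <= c) _.
case.
  move=> w bw; have /cvgrPdist_lt /(_ _ c2) [[A1 A2] /= [nA1 nA2] hA] := ch (s, w).
  exists (A2°, A1); first by split=> //=; exact: nbhs_interior.
  move=> [w' s'] /= [w'A s'A]; apply: filterS w'A => y yA.
  have h1 : `|h s w - h s y| < c / 2 by apply: (hA (s, y)); split => //=; exact: nbhs_singleton.
  have h2 : `|h s w - h s' y| < c / 2 by apply: (hA (s', y)); split.
  rewrite -(subrKA (h s w)); apply: le_trans (ler_normD _ _) _.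
  by rewrite distrC; lra.
move=> d /= d0 hd; exists d => // s' _ ss'.
have := hc unit setT (fun=> h s') _; case.
  move=> w bw; have := hd s' _ w bw; rewrite /ball_ /= distrC => /(_ ss').
  by apply: filterS.
move=> n0 _ hn.
have E n : (n0 <= n)%N -> degn B n (h s) W = degn B n (h s') W by move=> /hn /(_ tt I).
split=> -[n1 _ h1]; exists (maxn n0 n1) => // n; rewrite /= geq_max => /andP[l1 l2].
  by rewrite -E // h1.
by rewrite E // h1.
Unshelve. all: by end_near. Qed.

End DegreeCor.

Section Quasi.
Variables (R : realType) (N : nat).
Notation V := 'rV[R]_N.
Variable O : set V.
Hypothesis oO : open O.

(* Quasi-components: unlike components, these are elementary to manipulate without local connectedness. *)
Definition qcomp (a : V) : set V :=
  [set x | O x /\ forall P : set V, P `<=` O -> open P -> open (O `\` P) -> P a -> P x].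

Lemma qcomp_sub a : qcomp a `<=` O. Proof. by move=> x []. Qed.
Lemma qcomp_refl a : O a -> qcomp a a. Proof. by split. Qed.

Lemma open_rV (A : set V) :
  (forall x, A x -> exists2 d : R, 0 < d & forall y, `|y - x| < d -> A y) -> open A.
Proof. by move=> h; rewrite openE => x /h /nbhs_rVP. Qed.
Lemma openP_rV (A : set V) x : open A -> A x -> exists2 d : R, 0 < d & forall y, `|y - x| < d -> A y.
Proof. by move=> oA Ax; apply/nbhs_rVP; apply: open_nbhs_nbhs. Qed.

(** A ball inside [O] cannot be split by a relatively clopen set, by [segment_boundary]. *)
Lemma qcomp_open a : open (qcomp a).
Proof.
apply: open_rV => x [Ox hx]; have [d d0 hd] := openP_rV oO Ox.
exists d => // y yx; split=> [|P PO oP oP' Pa]; first exact: hd.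
have Px := hx P PO oP oP' Pa.
apply: contrapT => nPy; have [w [cw nw w1 _]] := segment_boundary oP Px nPy.
have Ow : O w by apply: hd; apply: le_lt_trans yx.
have := cw (O `\` P); case; first by apply: open_nbhs_nbhs.
by move=> z [Pz [_ nPz]].
Qed.

Lemma qcomp_compl_open a : open (O `\` qcomp a).
Proof.
apply: open_rV => x [Ox nx].
have [P [PO oP oP' Pa nPx]] : exists P : set V, [/\ P `<=` O, open P, open (O `\` P), P a & ~ P x].
  apply: contrapT => nP; apply: nx; split=> // P PO oP oP' Pa; apply: contrapT => nPx.
  by apply: nP; exists P.
have [d d0 hd] := openP_rV oP' (conj Ox nPx); exists d => // y /hd [Oy nPy].
by split=> // -[_ /(_ P PO oP oP' Pa)].
Qed.

Lemma qcomp_bdry a : bdry (qcomp a) `<=` closure O `\` O.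
Proof.
move=> w [cw nw]; split; first by apply: closureS cw; exact: qcomp_sub.
move=> Ow; have := cw (O `\` qcomp a); case.
  by apply: open_nbhs_nbhs; split=> //; exact: qcomp_compl_open.
by move=> z [Pz [_ nPz]].
Qed.

Lemma qcomp_sym a b : O a -> qcomp a b -> qcomp b a.
Proof.
move=> Oa [Ob h]; apply: contrapT => nba.
have [] := h (O `\` qcomp b) _ _ _ (conj Oa nba).
- by move=> x [].
- exact: qcomp_compl_open.
- by rewrite setDD setIidr; [exact: qcomp_open|exact: qcomp_sub].
- by move=> _; apply; exact: qcomp_refl.
Qed.

End Quasi.

(** * Local homeomorphisms off a closed set *)

Section Cover.
Variables (R : realType) (N B : nat).
Notation V := 'rV[R]_N.
Implicit Types (a b x y w z : V).

Lemma near_seq (T : eqType) (r : seq T) (Q : T -> nat -> Prop) :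
  (forall x : T, x \in r -> \forall n \near \oo, Q x n) ->
  \forall n \near \oo, forall x : T, x \in r -> Q x n.
Proof.
elim: r => [|y r IH] h; first by exists 0%N.
have hy := h y (mem_head _ _).
have hr : \forall n \near \oo, forall x : T, x \in r -> Q x n.
  by apply: IH => x xr; apply: h; rewrite inE xr orbT.
near=> n => x; rewrite inE => /predU1P[->|]; first by near: n.
by move: x; near: n.
Unshelve. all: by end_near. Qed.

Lemma qcomp_ind (O : set V) a (P : V -> Prop) : open O -> O a -> P a ->
  (forall x, O x -> \forall x' \near x, O x' -> (P x <-> P x')) -> forall x, qcomp O a x -> P x.
Proof.
move=> oO Oa Pa h x [Ox /(_ (O `&` P))] H.
suff [] : (O `&` P) x by [].
apply: H; last by split.
- by move=> y [].
- apply: open_rV => y [Oy Py].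
  have [d d0 hd] := openP_rV oO Oy; have /nbhs_rVP[e e0 he] := h y Oy.
  exists (Num.min d e) => [|z]; rewrite ?lt_min ?d0 // => /andP[/hd Oz /he /(_ Oz) E].
  by split=> //; apply/E.
- apply: open_rV => y [Oy nPy].
  have [d d0 hd] := openP_rV oO Oy; have /nbhs_rVP[e e0 he] := h y Oy.
  exists (Num.min d e) => [|z]; rewrite ?lt_min ?d0 // => /andP[/hd Oz /he /(_ Oz) E].
  by split=> // -[_ Pz]; apply: nPy; split=> //; apply/E.
Qed.

Variables (v : V -> V) (U Z : set V).
Let O := U `\` Z.
Hypotheses (oU : open U) (bU : boxed B U) (oO : open O) (cv : continuous v).
Hypothesis v_open : forall P : set V, open P -> P `<=` U -> open (v @` P).
Hypothesis v_inj : forall x, O x ->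
  exists2 r : R, 0 < r & forall y y', `|y - x| <= r -> `|y' - x| <= r -> v y = v y' -> y = y'.
Hypothesis v_Z : forall z w, Z z -> closure U z -> closure U w -> v z = v w -> z = w.
Hypothesis v_bdry : forall w x, bdry U w -> U x -> v w <> v x.

Definition sball a (r : R) : set V := [set x | `|x - a| < r].
(** The ball is closed so that injectivity reaches the boundary of [sball a r], where [v] then
    avoids every value it takes inside. *)
Definition good a (r : R) :=
  [/\ 0 < r, forall x, `|x - a| <= r -> O x &
      forall y y', `|y - a| <= r -> `|y' - a| <= r -> v y = v y' -> y = y'].

Lemma sball_open a r : open (sball a r).
Proof.
apply: open_rV => x /= xa; exists (r - `|x - a|) => [|y yx]; first by rewrite subr_gt0.
rewrite /sball /= -(subrKA x); apply: le_lt_trans (ler_normD _ _) _; lra.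
Qed.

Lemma closure_sball a r w : closure (sball a r) w -> `|w - a| <= r.
Proof.
have cl : closed [set x : V | `|x - a| <= r].
  apply: (@preimage_closed _ _ (fun x => `|x - a|) [set s : R | s <= r]); last exact: closed_le.
  move=> x _; apply: (@continuous_comp _ _ _ (fun x => x - a) (fun y => `|y|)); last exact: norm_continuous.
  by apply: continuous_subr => y; exact: cvg_id.
suff : closure (sball a r) `<=` [set x : V | `|x - a| <= r] by apply.
by rewrite ((closure_id _).1 cl); apply: closureS => x /= /ltW.
Qed.

Lemma good_sub a r r' : good a r -> 0 < r' -> r' <= r -> good a r'.
Proof.
move=> [r0 h1 h2] r'0 rr; split=> // [x xa|y y' ya y'a]; first by apply: h1; apply: le_trans rr.
by apply: h2; apply: le_trans rr.
Qed.

Lemma good_ex a : O a -> exists r, good a r.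
Proof.
move=> Oa; have [r r0 hr] := v_inj Oa; have [d d0 hd] := openP_rV oO Oa.
exists (Num.min r (d / 2)); split; first by rewrite lt_min r0; lra.
  by move=> x; rewrite le_min => /andP[_ xd]; apply: hd; lra.
by move=> y y'; rewrite !le_min => /andP[h1 _] /andP[h2 _]; exact: hr.
Qed.

Lemma sball_center a r : 0 < r -> sball a r a.
Proof. by move=> r0; rewrite /sball /= subrr normr0. Qed.

Lemma good_boxed a r : good a r -> boxed B (sball a r).
Proof. by move=> [_ h _] x /= /ltW /h [] /bU. Qed.

Lemma good_bdry a r a' w : good a r -> sball a r a' -> bdry (sball a r) w -> v w != v a'.
Proof.
move=> [r0 h1 h2] a'a [/closure_sball cw nw]; apply/eqP => e; apply: nw.
by rewrite (h2 _ _ cw (ltW a'a) e).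
Qed.

Lemma excise1 a r a' r' : good a r -> sball a r a' -> 0 < r' -> sball a' r' `<=` sball a r ->
  \forall n \near \oo, degn B n (fun x => v a' - v x) (sball a r) = degn B n (fun x => v a' - v x) (sball a' r').
Proof.
move=> g a'a r'0 sub.
have := @degn_additive R N B unit [:: tt] (fun=> sball a' r') (fun x => v a' - v x) (sball a r).
case.
- exact: sball_open.
- exact: good_boxed.
- exact: continuous_subl.
- by [].
- by move=> i _; split=> //; exact: sball_open.
- by move=> [] [].
- move=> x /closure_sball cx /eqP; rewrite subr_eq0 => /eqP e; exists tt => //.
  have [_ _ hi] := g; rewrite -(hi _ _ (ltW a'a) cx e); exact: sball_center.
by move=> n0 _ h; exists n0 => // n /h ->; rewrite big_seq1.
Qed.

Lemma excise a r a' r' : good a r -> sball a r a' -> good a' r' ->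
  \forall n \near \oo, degn B n (fun x => v a' - v x) (sball a r) = degn B n (fun x => v a' - v x) (sball a' r').
Proof.
move=> g a'a g'; have [d d0 hd] := openP_rV (@sball_open a r) a'a.
have [r'0 _ _] := g'.
have m0 : 0 < Num.min d r' by rewrite lt_min d0.
have e1 := excise1 g a'a m0 _; have e2 := excise1 g' (sball_center a' r'0) m0 _.
near=> n; transitivity (degn B n (fun x => v a' - v x) (sball a' (Num.min d r'))).
  by near: n; apply: e1 => x; rewrite /sball /= lt_min => /andP[/hd].
by symmetry; near: n; apply: e2 => x; rewrite /sball /= lt_min => /andP[].
Unshelve. all: by end_near. Qed.

(** This is what makes [v] proper from [O] to its image: the limit points missing from [O], in [Z]
    or on the boundary of [U], have values not taken on [O]. *)
Lemma bdry_off w x : closure U w -> ~ O w -> O x -> v w <> v x.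
Proof.
move=> cw nw [Ux nZx] e; have [Zw|nZ] := pselect (Z w).
  by apply: nZx; rewrite -(v_Z Zw cw _ e) //; exact: subset_closure.
by apply: (@v_bdry w x) => //; split=> // Uw; apply: nw.
Qed.

Lemma qbdry a w : bdry (qcomp O a) w -> closure U w /\ ~ O w.
Proof. by move=> /qcomp_bdry[cw nw]; split=> //; apply: closureS cw => x []. Qed.

Lemma qboxed a : boxed B (qcomp O a).
Proof. by move=> x /qcomp_sub[] /bU. Qed.

Lemma qbdry_off a w x : bdry (qcomp O a) w -> O x -> v w <> v x.
Proof. by move=> /qbdry[]; exact: bdry_off. Qed.

Lemma vclosure_closed a : closed (v @` closure (qcomp O a)).
Proof.
apply: compact_closed; first exact: norm_hausdorff.
by apply: continuous_compact (boxed_compact (@qboxed a)); exact: continuous_subspaceT.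
Qed.

(** For [x] in [O], having [v x] in the image of [qcomp O a] is an open condition because [v] is
    open. It is also closed, because the closure has compact image and its boundary values are not
    taken on [O]. So it spreads over [qcomp O b]. *)
Lemma vqcomp_sub a b : O a -> O b -> v a = v b -> v @` qcomp O b `<=` v @` qcomp O a.
Proof.
move=> Oa Ob ab _ [x /(qcomp_ind (P := fun x => (v @` qcomp O a) (v x)) oO Ob) H <-].
apply: H; first by exists a => //; exact: qcomp_refl.
move=> {}x Ox; have [[w Ww wx]|nx] := pselect ((v @` qcomp O a) (v x)).
  have : \forall x' \near x, (v @` qcomp O a) (v x').
    apply: (cv (x := x) (t := v @` qcomp O a)); apply: open_nbhs_nbhs; split; last by exists w.
    by apply: v_open; [exact: qcomp_open|move=> ? /qcomp_sub[]].
  by apply: filterS => x' h _; split=> // _; exists w.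
have nc : ~ (v @` closure (qcomp O a)) (v x).
  move=> [w cw e]; have [Ww|nW] := pselect (qcomp O a w); first by apply: nx; exists w.
  exact: (@qbdry_off a w x).
have : \forall x' \near x, ~ (v @` closure (qcomp O a)) (v x').
  apply: (cv (x := x) (t := ~` (v @` closure (qcomp O a)))).
  by apply: open_nbhs_nbhs; split=> //; apply: closed_openC; exact: vclosure_closed.
apply: filterS => x' h _; split=> // -[w Ww e]; exfalso; apply: h.
by exists w => //; exact: subset_closure.
Qed.

Lemma vqcomp_bdry a y : bdry (v @` qcomp O a) y -> exists2 w, bdry (qcomp O a) w & v w = y.
Proof.
move=> [cy ny].
have [w cw e] : (v @` closure (qcomp O a)) y.
  rewrite ((closure_id _).1 (@vclosure_closed a)); apply: closureS cy.
  by move=> _ [x Wx <-]; exists x => //; exact: subset_closure.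
exists w => //; split=> // Ww; apply: ny; by exists w.
Qed.

Lemma ev_trans (s t u : nat -> int) : (\forall n \near \oo, s n = t n) ->
  (\forall n \near \oo, t n = u n) -> \forall n \near \oo, s n = u n.
Proof. by move=> h1 h2; near=> n; transitivity (t n); near: n. Unshelve. all: by end_near. Qed.
Lemma ev_sym (s t : nat -> int) : (\forall n \near \oo, s n = t n) -> \forall n \near \oo, t n = s n.
Proof. by apply: filterS. Qed.

Lemma degn_qcomp a y : O a -> (v @` qcomp O a) y ->
  \forall y' \near y & n \near \oo,
    degn B n (fun x => y' - v x) (qcomp O a) = degn B n (fun x => v a - v x) (qcomp O a).
Proof.
move=> Oa [x Wx <-].
have tr z : O z -> \forall y' \near v z & n \near \oo,
    degn B n (fun x => y' - v x) (qcomp O a) = degn B n (fun x => v z - v x) (qcomp O a).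
  move=> Oz; apply: degn_translate => //; [exact: qcomp_open|exact: qboxed|].
  by move=> w bw; apply/eqP; exact: qbdry_off bw Oz.
have E : \forall n \near \oo, degn B n (fun x' => v x - v x') (qcomp O a) = degn B n (fun x => v a - v x) (qcomp O a).
  pose P x := \forall n \near \oo, degn B n (fun x' => v x - v x') (qcomp O a) = degn B n (fun x => v a - v x) (qcomp O a).
  apply: (qcomp_ind (P := P) oO Oa _ _ Wx); first by exists 0%N.
  move=> z Oz; have [[A M] /= [nA nM] hA] := tr z Oz.
  have vA : \forall z' \near z, A (v z') := @cv z A nA.
  apply: filterS vA => z' /= Az' _.
  have e : \forall n \near \oo, degn B n (fun x => v z' - v x) (qcomp O a) = degn B n (fun x => v z - v x) (qcomp O a).
    by apply: filterS nM => n Mn; exact: (hA (v z', n)).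
  by split=> H; [exact: ev_trans e H|exact: ev_trans (ev_sym e) H].
have [[A M] /= [nA nM] hA] := tr x (qcomp_sub Wx).
exists (A, M `&` [set n | degn B n (fun x' => v x - v x') (qcomp O a) = degn B n (fun x => v a - v x) (qcomp O a)]).
  by split=> //=; apply: filterI.
by move=> [y' n] /= [Ay [Mn <-]]; exact: (hA (y', n)).
Qed.

(** Move the value inside one good ball, then excise. The induction quantifies over all good radii
    because no single radius is good at every point. *)
Lemma index_const a r x r' : good a r -> qcomp O a x -> good x r' ->
  \forall n \near \oo, degn B n (fun y => v x - v y) (sball x r') = degn B n (fun y => v a - v y) (sball a r).
Proof.
move=> ga Wx; move: r'.
have [r0 hO _] := ga.
have Oa : O a by apply: hO; rewrite subrr normr0 ltW.
pose P x := forall r', good x r' -> \forall n \near \oo,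
  degn B n (fun y => v x - v y) (sball x r') = degn B n (fun y => v a - v y) (sball a r).
apply: (qcomp_ind (P := P) oO Oa _ _ Wx).
  by move=> r' gr'; apply: ev_sym; apply: excise => //; exact: sball_center.
move=> z Oz; have [s gs] := good_ex Oz.
have [s0 _ _] := gs.
have tr : \forall y' \near v z & n \near \oo,
    degn B n (fun x => y' - v x) (sball z s) = degn B n (fun x => v z - v x) (sball z s).
  apply: degn_translate => //; [exact: sball_open|exact: good_boxed gs|].
  by move=> w; apply: good_bdry gs _; exact: sball_center.
have [[A M] /= [nA nM] hA] := tr.
have nz : nbhs z (sball z s).
  by apply: open_nbhs_nbhs; split; [exact: sball_open|exact: sball_center].
have vA : \forall z' \near z, A (v z') := @cv z A nA.
apply: filterS (filterI nz vA) => z' /= [zz' Az'] _.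
have e s' : good z' s' -> \forall n \near \oo,
    degn B n (fun x => v z' - v x) (sball z' s') = degn B n (fun x => v z - v x) (sball z s).
  move=> gs'; apply: ev_trans (ev_sym (excise gs zz' gs')) _.
  by apply: filterS nM => n Mn; exact: (hA (v z', n)).
have e2 s' : good z s' -> \forall n \near \oo,
    degn B n (fun x => v z - v x) (sball z s') = degn B n (fun x => v z - v x) (sball z s).
  by move=> gs'; apply: ev_sym; apply: excise => //; exact: sball_center.
split=> h s' gs'.
  by apply: ev_trans (e _ gs') _; exact: h.
have [s'' gs''] : exists r, good z' r.
  by apply: good_ex; have [_ hO' _] := gs; apply: hO'; exact: ltW.
by apply: ev_trans (e2 _ gs') _; apply: ev_trans (ev_sym (e _ gs'')) _; exact: h.
Qed.

(** The fibre in [qcomp O a] is compact and, [v] being locally injective, discrete; each of its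
    points contributes the same local index, and [a], [b] are two of them. *)
Lemma fibre_count a b r : good a r -> qcomp O a b -> a != b -> v a = v b ->
  exists2 k : nat, (1 < k)%N & \forall n \near \oo,
    degn B n (fun x => v a - v x) (qcomp O a) = k%:R * degn B n (fun y => v a - v y) (sball a r).
Proof.
move=> ga Wb ab vab; have [r0 hO _] := ga.
have Oa : O a by apply: hO; rewrite subrr normr0 ltW.
pose F : set V := [set x | qcomp O a x /\ v x = v a].
have cF : compact F.
  have -> : F = closure (qcomp O a) `&` [set x | v x = v a].
    apply/seteqP; split=> x [cx e]; split=> //; first exact: subset_closure.
    by apply: contrapT => nx; apply: (@qbdry_off a x a).
  apply: subclosed_compact (boxed_compact (@qboxed a)) _; last by move=> ? [].
  apply: closedI; first exact: closed_closure.
  apply: (@preimage_closed _ _ v [set y | y = v a]); first by move=> x _; exact: cv.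
  exact: (@accessible_closed_set1 V (hausdorff_accessible (@norm_hausdorff _ V))).
have /choice[rho hrho] : forall x, exists s, F x -> good x s /\ sball x s `<=` qcomp O a.
  move=> x; have [[Wx _]|] := pselect (F x); last by exists 0.
  have [s gs] := good_ex (qcomp_sub Wx); have [d d0 hd] := openP_rV (qcomp_open oO (a := a)) Wx.
  exists (Num.min s d) => _; have [s0 _ _] := gs; split.
    by apply: good_sub gs _ _; rewrite ?lt_min ?s0 // ge_min lexx.
  by move=> y; rewrite /sball /= lt_min => /andP[_ /hd].
(* Each ball of the finite subcover contains one fibre point, its centre, so [D] is the whole fibre;
   half radii make the balls disjoint. *)
move: cF; rewrite compact_cover => /(_ V F (fun x => sball x (rho x / 2))) [|x Fx|D DF FD].
- by move=> x _; exact: sball_open.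
- by exists x => //; apply: sball_center; have [[? _ _] _] := hrho _ Fx; lra.
have inD x : (x \in D) = (x \in F).
  apply/idP/idP; first exact: DF.
  rewrite inE => Fx; have [y /= yD xy] := FD _ Fx.
  have Fy : F y by have := DF _ yD; rewrite inE.
  have [[r1 _ hi] _] := hrho _ Fy.
  suff -> : x = y by [].
  apply: hi; [by rewrite /sball /= in xy; lra|by rewrite subrr normr0 ltW|].
  by case: Fx => _ ->; case: Fy.
pose rs := enum_fset D.
have memF x : x \in rs -> F x by move=> xr; have : x \in D by []; rewrite inD inE.
exists (size rs).
  apply: (@uniq_leq_size _ [:: a; b]); first by rewrite /= inE ab.
  move=> x; rewrite !inE => /orP[]/eqP ->.
    by have : a \in D; rewrite ?inD ?inE //; split=> //; exact: qcomp_refl.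
  by have : b \in D; rewrite ?inD ?inE.
have ghalf x : F x -> good x (rho x / 2).
  by move=> /hrho[gx _]; have [? _ _] := gx; apply: good_sub gx _ _; lra.
have add := @degn_additive R N B V rs (fun x => sball x (rho x / 2)) (fun x => v a - v x) (qcomp O a).
have idx : \forall n \near \oo, forall x, x \in rs ->
    degn B n (fun y => v x - v y) (sball x (rho x / 2)) = degn B n (fun y => v a - v y) (sball a r).
  by apply: near_seq => x /memF Fx; apply: index_const ga _ (ghalf _ Fx); case: Fx.
have {}add : \forall n \near \oo, degn B n (fun x => v a - v x) (qcomp O a) =
    \sum_(i <- rs) degn B n (fun x => v a - v x) (sball i (rho i / 2)).
  apply: add.
  - exact: qcomp_open.
  - exact: qboxed.
  - exact: continuous_subl.
  - exact: fset_uniq.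
  - move=> x /memF Fx; split; first exact: sball_open.
    have [[? _ _] sx] := hrho _ Fx; move=> y; rewrite /sball /= => yx; apply: sx; rewrite /sball /=; lra.
  - move=> x y z /memF Fx /memF Fy; rewrite /sball /= => zx zy.
    have [[x0 _ hx] _] := hrho _ Fx; have [[y0 _ hy] _] := hrho _ Fy.
    have xy : `|x - y| < rho x / 2 + rho y / 2.
      by rewrite -(subrKA z); apply: le_lt_trans (ler_normD _ _) _; rewrite distrC; lra.
    have vxy : v x = v y by case: Fx => _ ->; case: Fy.
    have [le|le] := leP (rho x) (rho y).
      by apply: hy => //; [lra|rewrite subrr normr0 ltW].
    by symmetry; apply: hx => //; [rewrite distrC; lra|rewrite subrr normr0 ltW].
  - move=> x cx /eqP; rewrite subr_eq0 => /eqP e.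
    have Fx : F x.
      split=> //; apply: contrapT => nx; apply: (@qbdry_off a x a) => //.
    exists x; first by have : x \in D by rewrite inD inE.
    by apply: sball_center; have [[? _ _] _] := hrho _ Fx; lra.
near=> n.
have -> : degn B n (fun x => v a - v x) (qcomp O a) =
    \sum_(i <- rs) degn B n (fun x => v a - v x) (sball i (rho i / 2)) by near: n.
have idxn : forall x, x \in rs ->
    degn B n (fun y => v x - v y) (sball x (rho x / 2)) = degn B n (fun y => v a - v y) (sball a r) by near: n.
rewrite big_seq (eq_bigr (fun=> degn B n (fun y => v a - v y) (sball a r))).
  by rewrite -big_seq big_const_seq count_predT iter_addr_0 mulr_natl.
by move=> x xr; rewrite -(idxn x xr); case: (memF x xr) => _ ->.
Unshelve. all: by end_near. Qed.

Variables (Gam : V -> V) (h : R -> V -> V) (a1 a2 : V).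
Hypothesis bvU : forall x, U x -> `|v x| + 2 < B%:R.
Hypotheses (cG : continuous Gam) (ch : continuous (fun p : R * V => h p.1 p.2)).
Hypothesis h0 : forall x, h 0 x = x.
Hypothesis h1 : forall w, closure U w -> ~ O w -> h 1 w = Gam (v w).
Hypothesis hn : forall s w, 0 <= s <= 1 -> closure U w -> ~ O w -> h s w != a1 /\ h s w != a2.
Hypotheses (Oa1 : O a1) (Oa2 : O a2) (va : v a1 = v a2).

Lemma degn_Gam a b : a = a1 \/ a = a2 -> O b ->
  \forall n \near \oo, degn B n (fun x => Gam (v x) - a) (qcomp O b) = (`[< qcomp O b a >] : nat)%:R.
Proof.
move=> ha Ob.
have Oa : O a by case: ha => ->.
have hne s w : 0 <= s <= 1 -> bdry (qcomp O b) w -> h s w != a.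
  by move=> s01 /qbdry[cw nw]; have [? ?] := hn s01 cw nw; case: ha => ->.
have oW := @qcomp_open _ _ _ oO b; have bW := @qboxed b.
have chs s : continuous (h s).
  move=> w; apply: (@continuous_comp _ _ _ (fun w => (s, w)) (fun p : R * V => h p.1 p.2)).
    by apply: continuous_pair; [exact: cst_continuous|move=> A; exact: cvg_id].
  exact: ch.
have cGv : continuous (fun x => Gam (v x)).
  by move=> x; apply: (@continuous_comp _ _ _ v Gam); [exact: cv|exact: cG].
have i01 : 0 <= (1 : R) <= 1 by rewrite ler01 lexx.
apply: ev_trans (ev_sym _) _.
  apply: (degn_eq_bdry (f := fun x => h 1 x - a) oW bW).
  - exact: continuous_subr.
  - exact: continuous_subr.
  - by move=> w /(hne 1 _ i01); rewrite subr_eq0.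
  - by move=> w /qbdry[cw nw]; rewrite h1.
apply: ev_trans (ev_sym _) _.
  apply: (degn_homotopy (h := fun s x => h s x - a) oW bW).
  - move=> p; apply: continuousB; [exact: ch|exact: cst_continuous].
  - by move=> s w s01 /(hne s _ s01); rewrite subr_eq0.
have E : (fun x => h 0 x - a) = (fun x => x - a) by apply/funext => x; rewrite h0.
have nb : ~ bdry (qcomp O b) a by move=> /qbdry[_]; exact.
by apply: filterS (degn_id oW bW nb) => n /=; rewrite E.
Qed.

Lemma same_point : a1 = a2.
Proof.
apply: contrapT => ne.
pose C := v @` qcomp O a1.
have EC : v @` qcomp O a2 = C by apply/seteqP; split; exact: vqcomp_sub.
have oC : open C by apply: v_open; [exact: qcomp_open|move=> x /qcomp_sub[]].
have bC : boxed B C by move=> _ [x /qcomp_sub[Ux _] <-]; exact: bvU.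
(* Both quasi-components have the image [C], so the four relations share the degrees of [Gam - a1]
   and [Gam - a2] on [C]. *)
have comp a b : a = a1 \/ a = a2 -> b = a1 \/ b = a2 -> \forall n \near \oo,
    degn B n (fun x => v b - v x) (qcomp O b) * degn B n (fun y => Gam y - a) C =
    (-1) ^+ (N * N) * (`[< qcomp O b a >] : nat)%:R.
  move=> ha hb; have Oa : O a by case: ha => ->.
  have Ob : O b by case: hb => ->.
  have Cb : v @` qcomp O b = C by case: hb => ->.
  have i01 : 0 <= (1 : R) <= 1 by rewrite ler01 lexx.
  have := @degn_comp R N B v Gam a (qcomp O b) C (fun n => degn B n (fun x => v b - v x) (qcomp O b))
    (qcomp_open oO (a := b)) (@qboxed b) oC bC cv cG.
  rewrite -Cb => H.
  have {}H := H _ (@vqcomp_bdry b) _ (fun y hy => degn_qcomp Ob hy).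
  near=> n; rewrite (_ : (`[< _ >] : nat)%:R = degn B n (fun x => Gam (v x) - a) (qcomp O b)); last first.
    by symmetry; near: n; exact: degn_Gam.
  near: n; apply: H; last by move=> w Ww; exists w.
  by move=> w /qbdry[cw nw]; rewrite -h1 //; have [? ?] := hn i01 cw nw; case: ha => ->.
have l1 : a1 = a1 \/ a1 = a2 by left.
have l2 : a2 = a1 \/ a2 = a2 by right.
have [W12|W12] := pselect (qcomp O a1 a2).
  have [r gr] := good_ex Oa1.
  have [|k k1 hk] := fibre_count gr W12 _ va; first exact/eqP.
  have := comp _ _ l1 l1; rewrite asboolT ?mulr1; last exact: qcomp_refl.
  move=> hc; near \oo => n.
  have e1 : degn B n (fun x => v a1 - v x) (qcomp O a1) = k%:R * degn B n (fun y => v a1 - v y) (sball a1 r).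
    by near: n.
  have e2 : degn B n (fun x => v a1 - v x) (qcomp O a1) * degn B n (fun y => Gam y - a1) C = (-1) ^+ (N * N).
    by near: n.
  move: e2; rewrite e1 => /(congr1 absz); rewrite !abszM absz_sign natz absz_nat => e3.
  by have : (k %| 1)%N; [rewrite -e3 -mulnA dvdn_mulr|rewrite dvdn1 => /eqP k1'; rewrite k1' in k1].
have W21 : ~ qcomp O a2 a1 by move=> h21; apply: W12; exact: qcomp_sym h21.
have := comp _ _ l1 l1; rewrite asboolT ?mulr1; last exact: qcomp_refl.
move=> c11.
have c12 := comp _ _ l1 l2; rewrite asboolF // mulr0 in c12.
have c22 := comp _ _ l2 l2; rewrite asboolT ?mulr1 in c22; last exact: qcomp_refl.
near \oo => n.
have e11 : degn B n (fun x => v a1 - v x) (qcomp O a1) * degn B n (fun y => Gam y - a1) C = (-1) ^+ (N * N) by near: n.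
have e12 : degn B n (fun x => v a2 - v x) (qcomp O a2) * degn B n (fun y => Gam y - a1) C = 0 by near: n.
have e22 : degn B n (fun x => v a2 - v x) (qcomp O a2) * degn B n (fun y => Gam y - a2) C = (-1) ^+ (N * N) by near: n.
have s0 : (-1) ^+ (N * N) != 0 :> int by rewrite signr_eq0.
(* [e22] forbids a zero degree of [v] on the second quasi-component, [e11] a zero degree of
   [Gam - a1] on [C]. *)
move/eqP: e12; rewrite mulf_eq0 => /orP[]/eqP z.
  by move: s0; rewrite -e22 z mul0r eqxx.
by move: s0; rewrite -e11 z mulr0 eqxx.
Unshelve. all: by end_near. Qed.

End Cover.

(** * The Euclidean norm *)

Section Euclid.
Variables (R : realType) (N : nat).
Notation V := 'rV[R]_N.
Implicit Types (a b p q x y w : V) (c : R).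

Definition dot a b : R := \sum_(i < N) a ord0 i * b ord0 i.

Lemma dotC a b : dot a b = dot b a.
Proof. by apply: eq_bigr => i _; rewrite mulrC. Qed.
Lemma dotDl a b x : dot (a + b) x = dot a x + dot b x.
Proof. by rewrite /dot -big_split; apply: eq_bigr => i _; rewrite mxE mulrDl. Qed.
Lemma dotZl c a x : dot (c *: a) x = c * dot a x.
Proof. by rewrite /dot mulr_sumr; apply: eq_bigr => i _; rewrite mxE mulrA. Qed.
Lemma dotNl a x : dot (- a) x = - dot a x.
Proof. by rewrite -scaleN1r dotZl mulN1r. Qed.
Lemma dotBl a b x : dot (a - b) x = dot a x - dot b x.
Proof. by rewrite dotDl dotNl. Qed.
Lemma dotDr a b x : dot x (a + b) = dot x a + dot x b.
Proof. by rewrite dotC dotDl !(dotC x). Qed.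
Lemma dotZr c a x : dot x (c *: a) = c * dot x a.
Proof. by rewrite dotC dotZl dotC. Qed.
Lemma dotNr a x : dot x (- a) = - dot x a.
Proof. by rewrite dotC dotNl dotC. Qed.
Lemma dotBr a b x : dot x (a - b) = dot x a - dot x b.
Proof. by rewrite dotDr dotNr. Qed.
Lemma dot0l x : dot 0 x = 0.
Proof. by rewrite /dot big1 // => i _; rewrite mxE mul0r. Qed.
Lemma dot_ge0 a : 0 <= dot a a.
Proof. by apply: sumr_ge0 => i _; rewrite -expr2 sqr_ge0. Qed.
Lemma dot_suml (T : Type) (r : seq T) (F : T -> V) x : dot (\sum_(i <- r) F i) x = \sum_(i <- r) dot (F i) x.
Proof. by elim/big_rec2: _ => [|i y z _ <-]; rewrite ?dot0l ?dotDl. Qed.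

Lemma enormE a : enorm a = Num.sqrt (dot a a).
Proof. by congr Num.sqrt; apply: eq_bigr => i _; rewrite expr2. Qed.
Lemma enorm_ge0 a : 0 <= enorm a.
Proof. exact: sqrtr_ge0. Qed.
Lemma enorm_sqr a : enorm a ^+ 2 = dot a a.
Proof. by rewrite enormE sqr_sqrtr // dot_ge0. Qed.
Lemma enorm0 : enorm (0 : V) = 0.
Proof. by rewrite enormE dot0l sqrtr0. Qed.
Lemma enormZ c a : enorm (c *: a) = `|c| * enorm a.
Proof. by rewrite !enormE dotZl dotZr mulrA -expr2 sqrtrM ?sqr_ge0 // sqrtr_sqr. Qed.
Lemma enormN a : enorm (- a) = enorm a.
Proof. by rewrite -scaleN1r enormZ normrN1 mul1r. Qed.
Lemma enormB a b : enorm (a - b) = enorm (b - a).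
Proof. by rewrite -opprB enormN. Qed.

Lemma norm_le_enorm a : `|a| <= enorm a.
Proof.
apply: rV_norm_le => [|j]; first exact: enorm_ge0.
rewrite -(ler_pXn2r (n := 2)) ?nnegrE ?normr_ge0 ?enorm_ge0 // enorm_sqr real_normK ?num_real //.
rewrite /dot (bigD1 j) //= -expr2 lerDl.
by apply: sumr_ge0 => i _; rewrite -expr2 sqr_ge0.
Qed.

Lemma enorm_eq0 a : enorm a = 0 -> a = 0.
Proof. by move=> h; apply/eqP; rewrite -normr_le0 -h norm_le_enorm. Qed.
Lemma enorm_gt0 a : (0 < enorm a) = (a != 0).
Proof.
apply/idP/idP => [|a0]; first by apply: contraTneq => ->; rewrite enorm0 ltxx.
by rewrite lt_neqAle enorm_ge0 andbT eq_sym; apply: contra_neq a0 => /enorm_eq0.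
Qed.

(** A crude constant; unlike the square root of [N] it is positive for [N] equal to 0, and
    [near_enorm] divides by it. *)
Lemma enorm_le_norm a : enorm a <= N.+1%:R * `|a|.
Proof.
rewrite -(ler_pXn2r (n := 2)) ?nnegrE ?enorm_ge0 ?mulr_ge0 ?ler0n // enorm_sqr.
apply: (@le_trans _ _ (\sum_(i < N) `|a| ^+ 2)).
  apply: ler_sum => i _; rewrite -expr2 -real_normK ?num_real //.
  by rewrite ler_pXn2r ?nnegrE ?normr_ge0 // coord_le.
rewrite sumr_const card_ord -[_ *+ N]mulr_natl exprMn ler_wpM2r ?sqr_ge0 //.
by rewrite -natrX ler_nat -mulnn (leq_trans (leqnSn N)) // leq_pmulr.
Qed.

Lemma cauchy_schwarz a b : dot a b <= enorm a * enorm b.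
Proof.
have [->|b0] := eqVneq b 0; first by rewrite enorm0 mulr0 dotC dot0l.
have bp : 0 < enorm b by rewrite enorm_gt0.
have := dot_ge0 (enorm b ^+ 2 *: a - dot a b *: b).
rewrite !(dotBl, dotBr, dotZl, dotZr) -!enorm_sqr (dotC b a) => h.
have {h} : dot a b ^+ 2 <= (enorm a * enorm b) ^+ 2.
  have e2 : 0 < enorm b ^+ 2 by rewrite exprn_gt0.
  by rewrite -(ler_pM2l e2); move: h; lra.
move=> h; apply: le_trans (ler_norm _) _.
by rewrite -(ler_pXn2r (n := 2)) ?nnegrE ?normr_ge0 ?mulr_ge0 ?enorm_ge0 // real_normK ?num_real.
Qed.

Lemma enormD a b : enorm (a + b) <= enorm a + enorm b.
Proof.
rewrite -(ler_pXn2r (n := 2)) ?nnegrE ?addr_ge0 ?enorm_ge0 // enorm_sqr.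
rewrite !(dotDl, dotDr) -!enorm_sqr (dotC b a); have := cauchy_schwarz a b; lra.
Qed.
Lemma enorm_dist x a b : enorm (a - b) <= enorm (a - x) + enorm (x - b).
Proof. by apply: le_trans (enormD _ _); rewrite subrKA. Qed.

Lemma continuous_bigsum (W : normedModType R) (T : topologicalType) (I : Type) (r : seq I) (F : I -> T -> W) (x : T) :
  (forall i, {for x, continuous (F i)}) -> {for x, continuous (fun y : T => \sum_(i <- r) F i y)}.
Proof.
move=> cF; elim: r => [|i r IH].
  have -> : (fun y : T => \sum_(i <- [::]) F i y) = cst 0 by apply/funext => y; rewrite big_nil.
  exact: cst_continuous.
have -> : (fun y : T => \sum_(j <- i :: r) F j y) = (fun y : T => F i y + \sum_(j <- r) F j y).
  by apply/funext => y; rewrite big_cons.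
exact: (continuousD (cF i) IH).
Qed.

Lemma dot_continuous (T : topologicalType) (f g : T -> V) (x : T) :
  {for x, continuous f} -> {for x, continuous g} -> {for x, continuous (fun y : T => dot (f y) (g y))}.
Proof.
move=> cf cg; apply: continuous_bigsum => i.
apply: (@continuousM _ _ (fun y : T => f y ord0 i) (fun y : T => g y ord0 i)).
  by apply: (@continuous_comp _ _ _ f (fun M : V => M ord0 i)); [exact: cf|exact: coord_continuous].
by apply: (@continuous_comp _ _ _ g (fun M : V => M ord0 i)); [exact: cg|exact: coord_continuous].
Qed.

Lemma enorm_continuous (T : topologicalType) (f : T -> V) (x : T) :
  {for x, continuous f} -> {for x, continuous (fun y : T => enorm (f y))}.
Proof.
move=> cf; have -> : (fun y : T => enorm (f y)) = (fun y : T => Num.sqrt (dot (f y) (f y))).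
  by apply/funext => y; rewrite enormE.
apply: (@continuous_comp _ _ _ (fun y : T => dot (f y) (f y)) Num.sqrt).
  exact: dot_continuous.
exact: sqrt_continuous.
Qed.

(* Radial projection to the sphere does not increase distances outside the ball of radius [r]. *)
Lemma chord_le p q r : 0 < r -> r <= enorm p -> r <= enorm q ->
  2 * r ^+ 2 * (1 - dot ((enorm p)^-1 *: p) ((enorm q)^-1 *: q)) <= enorm (p - q) ^+ 2.
Proof.
move=> r0 rp rq; have p0 : 0 < enorm p by lra. have q0 : 0 < enorm q by lra.
have cs := cauchy_schwarz p q.
rewrite enorm_sqr !(dotBl, dotBr, dotZl, dotZr) -!enorm_sqr (dotC q p).
set c := dot p q in cs *.
have -> : (enorm p)^-1 * ((enorm q)^-1 * c) = c / (enorm p * enorm q) by field; rewrite !gt_eqF.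
have pq : 0 < enorm p * enorm q by rewrite mulr_gt0.
set k := c / _; have ck : c = k * (enorm p * enorm q) by rewrite /k mulfVK // gt_eqF.
have k1 : k <= 1 by rewrite /k ler_pdivrMr // mul1r.
have rr : r ^+ 2 <= enorm p * enorm q by rewrite expr2 ler_pM // ltW.
rewrite ck; have := sqr_ge0 (enorm p - enorm q).
have : (enorm p * enorm q - r ^+ 2) * (1 - k) >= 0 by rewrite mulr_ge0 // subr_ge0.
lra.
Qed.

Lemma unit_dot p : p != 0 -> dot ((enorm p)^-1 *: p) ((enorm p)^-1 *: p) = 1.
Proof.
rewrite -enorm_gt0 => p0; rewrite dotZl dotZr -enorm_sqr; field; by rewrite gt_eqF.
Qed.

(* With [|p + q| >= <p + q, m> >= 2c] this is the double-angle formula for [c = cos al]. *)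
Lemma dot_double p q m c : dot p p = 1 -> dot q q = 1 -> dot m m = 1 -> 0 <= c ->
  c <= dot p m -> c <= dot m q -> 2 * c ^+ 2 - 1 <= dot p q.
Proof.
move=> p1 q1 m1 c0 h1 h2.
have em : enorm m = 1 by rewrite enormE m1 sqrtr1.
have h3 : 2 * c <= enorm (p + q).
  have := cauchy_schwarz (p + q) m; rewrite em mulr1 dotDl (dotC q m); lra.
have h4 : (2 * c) ^+ 2 <= enorm (p + q) ^+ 2.
  by rewrite ler_pXn2r ?nnegrE ?enorm_ge0 //; lra.
move: h4; rewrite enorm_sqr !(dotDl, dotDr) p1 q1 (dotC q p); lra.
Qed.

End Euclid.

(** * Sines of small angles *)

Section Sine.
Variable R : realType.

(** The difference has derivative [L' - L > 0] at 0. In [Q_small] this turns a bound on chords with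
    factor [HK] into one on angles with the larger factor [L']. *)
Lemma sin_small (L L' : R) : 0 <= L < L' -> exists2 d : R, 0 < d &
  forall x, 0 < x < d -> 0 <= sin x /\ L * sin x <= sin (L' * x).
Proof.
move=> /andP[L0 LL].
have dM (x : R) : is_derive x 1 (fun y => L' * y) L'.
  have h : is_derive x 1 (fun y => L' * y) (L' * 1).
    exact: (@is_deriveZ R R R id L' x 1 1 (is_derive_id x 1)).
  by rewrite mulr1 in h.
have ds (x : R) : is_derive x 1 (fun y => sin (L' * y)) (cos (L' * x) * L').
  exact: (is_derive1_comp (is_derive_sin (L' * x)) (dM x)).
have dl (x : R) : is_derive x 1 (fun y => L * sin y) (L * cos x).
  exact: (@is_deriveZ R R R sin L x 1 _ (is_derive_sin x)).
pose g (x : R) := sin (L' * x) - L * sin x.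
have dg (x : R) : is_derive x 1 g (cos (L' * x) * L' - L * cos x).
  exact: is_deriveB (ds x) (dl x).
have cg' : {for 0 : R, continuous (fun x : R => cos (L' * x) * L' - L * cos x)}.
  apply: continuousB.
    apply: continuousM; last exact: cst_continuous.
    apply: (@continuous_comp _ _ _ (fun y => L' * y) cos); last exact: continuous_cos.
    by apply: continuousM; [exact: cst_continuous|move=> A; exact: cvg_id].
  by apply: continuousM; [exact: cst_continuous|exact: continuous_cos].
have g'0 : 0 < cos (L' * 0) * L' - L * cos (0 : R) by rewrite mulr0 cos0; lra.
have : \forall x \near (0 : R), 0 < cos (L' * x) * L' - L * cos x by exact: (cvgr_gt _ cg').
move=> /nbhs_ballP[d d0 hd].
exists (Num.min d pi) => [|x]; first by rewrite lt_min d0 pi_gt0.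
rewrite lt_min => /and3P[x0 xd xpi]; split; first by apply/ltW/sin_gt0_pi; rewrite x0.
have [|c cin] := MVT x0 (fun y _ => dg y).
  apply: continuous_subspaceT => y; rewrite /g.
  apply: (@continuousB _ _ _ (fun x : R => sin (L' * x)) (fun x : R => L * sin x)).
    apply: (@continuous_comp _ _ _ (fun y => L' * y) sin); last exact: continuous_sin.
    by apply: continuousM; [exact: cst_continuous|move=> A; exact: cvg_id].
  by apply: continuousM; [exact: cst_continuous|exact: continuous_sin].
rewrite {1 2}/g !mulr0 sin0 mulr0 subr0 => e.
rewrite -subr_ge0 -[X in _ <= X](subr0 _) e subr0 mulr_ge0 ?(ltW x0) // ltW //.
apply: hd; rewrite -ball_normE /ball_ /= sub0r normrN.
by move: cin; rewrite in_itv /= => /andP[c0 cx]; rewrite gtr0_norm //; lra.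
Qed.

End Sine.

(** * Images of opposite points *)

Section Sphere.
Variables (R : realType) (N : nat).
Notation V := 'rV[R]_N.
Implicit Types (a b p q x y w : V).
Variables (v : V -> V) (t H K : R).
Hypotheses (H0 : 0 < H) (K0 : 0 < K) (HK : H * K < 2).
Hypothesis vL : forall a b, enorm a <= t -> enorm b <= t -> enorm (v a - v b) <= K * enorm (a - b).
Hypothesis vH : forall w, enorm w <= t -> enorm w <= H * enorm (v w).

Let nu a := (enorm (v a))^-1 *: v a.
(** Strictly above [HK], as [Q_small] needs for small angles, and strictly below 2, so that a right
    angle is stretched to less than [pi]. *)
Let L' := (H * K + 2) / 2.
(** A modulus of continuity for angles on a sphere: [al] between the points, [L' * al] between their
    images. *)
Let Q tau al := forall a b, enorm a = tau -> enorm b = tau -> tau ^+ 2 * cos al <= dot a b ->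
  cos (L' * al) <= dot (nu a) (nu b).

Lemma v_neq0 a : 0 < enorm a -> enorm a <= t -> v a != 0.
Proof.
move=> a0 /vH h; apply: contraTneq h => ->.
by rewrite enorm0 mulr0 -ltNge.
Qed.

(** The midpoint [m] of the arc from [a] to [b] is within angle [al] of both; apply the bound twice
    and add by [dot_double]. The range of [al] keeps [L' * al] at most [pi / 2], so that its cosine
    is nonnegative as [dot_double] requires. *)
Lemma Q_double tau al : 0 < tau <= t -> 0 <= al <= pi / 4 -> Q tau al -> Q tau (2 * al).
Proof.
move=> /andP[tau0 taut] /andP[al0 alpi] q a b ea eb ab.
have Lb1 : 0 < L' by rewrite /L'; have := mulr_gt0 H0 K0; lra.
have Lb2 : L' < 2 by rewrite /L'; move: HK; lra.
have pi0 := pi_gt0 R.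
have ca : 0 < cos al by apply: cos_gt0_pihalf; apply/andP; split; lra.
have c2 : cos (2 * al) = 2 * cos al ^+ 2 - 1 by rewrite mulr_natl cos_mulr2n; ring.
have c2' : cos (L' * (2 * al)) = 2 * cos (L' * al) ^+ 2 - 1.
  have -> : L' * (2 * al) = (L' * al) *+ 2 by rewrite -mulr_natl; ring.
  by rewrite cos_mulr2n; ring.
have cL : 0 <= cos (L' * al).
  have h1 : 0 <= L' * al by rewrite mulr_ge0 //; lra.
  have h2 : L' * al <= 2 * al by rewrite ler_wpM2r //; lra.
  have [h|h] := ltP (L' * al) (pi / 2); first by apply/ltW/cos_gt0_pihalf; apply/andP; split; lra.
  have e : L' * al = pi / 2 by apply/eqP; rewrite eq_le; apply/andP; split; lra.
  by rewrite e cos_pihalf lexx.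
have eab : enorm (a + b) ^+ 2 = 2 * (tau ^+ 2 + dot a b).
  rewrite enorm_sqr !(dotDl, dotDr) -!enorm_sqr ea eb (dotC b a); ring.
have tc : 0 < tau * cos al by rewrite mulr_gt0.
have h4 : 2 * (tau * cos al) <= enorm (a + b).
  rewrite -(ler_pXn2r (n := 2)) ?nnegrE ?enorm_ge0 //; last lra.
  by rewrite eab; move: ab; rewrite c2; lra.
have e0 : 0 < enorm (a + b) by lra.
pose m := (tau / enorm (a + b)) *: (a + b).
have em : enorm m = tau.
  by rewrite /m enormZ ger0_norm ?divr_ge0 ?enorm_ge0 // ?(ltW tau0) // mulfVK // gt_eqF.
have hm x : dot x (a + b) = enorm (a + b) ^+ 2 / 2 -> tau ^+ 2 * cos al <= dot x m.
  move=> hx; rewrite /m dotZr hx.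
  have -> : tau / enorm (a + b) * (enorm (a + b) ^+ 2 / 2) = tau * (enorm (a + b) / 2).
    by field; rewrite gt_eqF.
  by rewrite expr2 -mulrA ler_wpM2l ?(ltW tau0) //; lra.
have am : tau ^+ 2 * cos al <= dot a m.
  by apply: hm; rewrite eab dotDr -enorm_sqr ea; field.
have mb : tau ^+ 2 * cos al <= dot m b.
  by rewrite dotC; apply: hm; rewrite eab dotDr -enorm_sqr eb (dotC b a); field.
have nu1 x : enorm x = tau -> dot (nu x) (nu x) = 1.
  by move=> ex; apply: unit_dot; apply: v_neq0; rewrite ex.
rewrite c2'; apply: (@dot_double _ _ _ _ (nu m)); rewrite ?nu1 //; exact: q.
Qed.

(** The images lie outside the ball of radius [tau / H], so by [chord_le] the chord between their
    directions is at most [HK] times that between the directions of [a] and [b]; half-angle sines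
    convert chords into angles. *)
Lemma Q_small tau : 0 < tau <= t -> exists2 d : R, 0 < d & forall al, 0 < al < d -> Q tau al.
Proof.
move=> /andP[tau0 taut].
have L0 := mulr_gt0 H0 K0.
have [|d d0 hd] := @sin_small R (H * K) L'; first by rewrite /L'; apply/andP; split; move: HK L0; lra.
exists (2 * d) => [|al /andP[al0 ald] a b ea eb ab]; first lra.
have [|s0 sL] := hd (al / 2); first by apply/andP; split; lra.
have half (x : R) : 1 - cos x = 2 * sin (x / 2) ^+ 2.
  have {1}-> : x = (x / 2) *+ 2 by rewrite -mulr_natl; field.
  by rewrite cos_mulr2n; have := cos2Dsin2 (x / 2); lra.
have ta : tau / H <= enorm (v a) by rewrite ler_pdivrMr // mulrC -ea vH // ea.
have tb : tau / H <= enorm (v b) by rewrite ler_pdivrMr // mulrC -eb vH // eb.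
have := chord_le (divr_gt0 tau0 H0) ta tb; rewrite -/(nu a) -/(nu b).
set c := dot _ _ => h1.
have h2 : enorm (v a - v b) ^+ 2 <= K ^+ 2 * (2 * tau ^+ 2 * (1 - cos al)).
  apply: (@le_trans _ _ ((K * enorm (a - b)) ^+ 2)).
    rewrite ler_pXn2r ?nnegrE ?enorm_ge0 ?mulr_ge0 ?enorm_ge0 ?(ltW K0) //.
    by apply: vL; rewrite ?ea ?eb.
  rewrite exprMn ler_wpM2l ?sqr_ge0 // enorm_sqr !(dotBl, dotBr) -!enorm_sqr ea eb (dotC b a).
  by move: ab; lra.
have h3 : 1 - c <= (H * K) ^+ 2 * (1 - cos al).
  have t2 : 0 < 2 * (tau / H) ^+ 2 by rewrite mulr_gt0 // exprn_gt0 // divr_gt0.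
  rewrite -(ler_pM2l t2); apply: le_trans h1 _; apply: le_trans h2 _.
  by rewrite le_eqVlt; apply/orP; left; apply/eqP; field; rewrite gt_eqF.
have h4 : (H * K) ^+ 2 * (1 - cos al) <= 1 - cos (L' * al).
  rewrite !half mulrCA -exprMn ler_wpM2l // ler_pXn2r ?nnegrE //.
  - by rewrite -mulrA.
  - by rewrite mulr_ge0 // ltW.
  - by rewrite -mulrA; apply: le_trans sL; rewrite mulr_ge0 // ltW.
lra.
Qed.

(** Halve [pi / 2] until [Q_small] applies, then double back: right angles go to angles below [pi].
    Oppositeness is written without normalizing, in the form that [opp_gap] perturbs. *)
Lemma sphere_opp a b : 0 < enorm a -> enorm a <= t -> enorm b = enorm a ->
  enorm (v b) *: v a + enorm (v a) *: v b = 0 -> dot a b < 0.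
Proof.
move=> a0 at_ eb opp; rewrite ltNge; apply/negP => ab.
have pi0 := pi_gt0 R.
have taut : 0 < enorm a <= t by rewrite a0.
have [d d0 hd] := Q_small taut.
have Qk k : Q (enorm a) (pi / 2 / 2 ^+ k) -> Q (enorm a) (pi / 2).
  elim: k => [|k IH]; first by rewrite expr0 divr1.
  move=> q; apply: IH.
  have -> : pi / 2 / 2 ^+ k = 2 * (pi / 2 / 2 ^+ k.+1) :> R.
    by rewrite exprS; field; rewrite expf_neq0 // pnatr_eq0.
  apply: Q_double => //; apply/andP; split; first by rewrite !divr_ge0 ?exprn_ge0 // ltW.
  rewrite ler_pdivrMr ?exprn_gt0 // exprS.
  have : 1 <= 2 ^+ k :> R by rewrite exprn_ege1 // ler1n.
  nra.
have q : Q (enorm a) (pi / 2).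
  pose k := (Num.truncn (pi / 2 / d)).+1.
  apply: (Qk k); apply: hd; rewrite !divr_gt0 ?exprn_gt0 //=.
  rewrite ltr_pdivrMr ?exprn_gt0 // -ltr_pdivrMl // [d^-1 * _]mulrC.
  apply: lt_trans (truncnS_gt _) _.
  by have := ltn_expl k (isT : (1 < 2)%N); rewrite -(ltr_nat R) natrX.
have := q a b erefl eb; rewrite cos_pihalf mulr0 => /(_ ab).
have va : 0 < enorm (v a) by rewrite enorm_gt0 v_neq0.
have vb : 0 < enorm (v b) by rewrite enorm_gt0 v_neq0 // eb.
have -> : nu b = - nu a.
  rewrite /nu; move/eqP: opp; rewrite addrC addr_eq0 => /eqP e.
  have -> : v b = (enorm (v a))^-1 *: (enorm (v a) *: v b) by rewrite scalerA mulVf ?gt_eqF // scale1r.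
  have nz : enorm (v b) != 0 by rewrite gt_eqF.
  by rewrite e enormZ enormN enormZ; move: nz va; set x := enorm (v b); set y := enorm (v a) => nz va0;
     rewrite !scalerN !scalerA; congr (- (_ *: _)); rewrite !ger0_norm ?invr_ge0 ?enorm_ge0 //;
     field; rewrite nz gt_eqF.
rewrite dotNr unit_dot ?v_neq0 // leNgt -(cospi R) => /negP[].
have L1 : 0 <= L' * (pi / 2) by rewrite /L'; have := mulr_gt0 H0 K0; nra.
have L2 : L' * (pi / 2) < pi by rewrite /L'; move: HK; nra.
by rewrite ltr_cos // in_itv /= ?L1 ?(ltW L2) // lexx ltW.
Qed.

End Sphere.

(** * A near left inverse *)

Section Extension.
Variables (R : realType) (N : nat).
Notation V := 'rV[R]_N.

Lemma rV_compact_closed (A : set V) : compact A -> closed A.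
Proof. by apply: compact_closed; exact: norm_hausdorff. Qed.

Lemma rV_continuous (T : topologicalType) (f : T -> V) :
  (forall j, continuous (fun x => f x ord0 j)) -> continuous f.
Proof.
move=> h x; apply/cvgrPdist_lt => e e0.
have e2 : 0 < e / 2 by lra.
have H : \forall y \near x, forall j, `|f x ord0 j - f y ord0 j| < e / 2.
  by apply: filter_forall => j; have /cvgrPdist_lt /(_ _ e2) := h j x.
apply: filterS H => y hy; apply: (@le_lt_trans _ _ (e / 2)); last lra.
apply: rV_norm_le => [|j]; first lra.
by rewrite !mxE; apply/ltW.
Qed.

(* Tietze's theorem for the quotient of [Kc] by [f]. *)
Lemma extend_through (Kc : set V) (f kap : V -> V) : compact Kc -> continuous f -> continuous kap ->
  (forall w w', Kc w -> Kc w' -> f w = f w' -> kap w = kap w') ->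
  exists2 Gam : V -> V, continuous Gam & forall w, Kc w -> Gam (f w) = kap w.
Proof.
move=> cK cf ck fac.
pose A := f @` Kc.
have cA : closed A.
  by apply: rV_compact_closed; apply: continuous_compact (cK); exact: continuous_subspaceT.
have /choice[pre hpre] : forall y, exists w, A y -> Kc w /\ f w = y.
  by move=> y; have [[w Kw e]|] := pselect (A y); [exists w|exists 0].
have preE w : Kc w -> kap (pre (f w)) = kap w.
  by move=> Kw; have [|K1 e] := hpre (f w); [exists w|apply: fac].
have cnk : {within Kc, continuous (fun w => `|kap w|)}.
  apply: continuous_subspaceT => w.
  by apply: (@continuous_comp _ _ _ kap (fun y => `|y|)); [exact: ck|exact: norm_continuous].
have [M M0 hM] : exists2 M : R, 0 < M & forall w, Kc w -> `|kap w| <= M.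
  have [K0|/set0P K0] := eqVneq Kc set0; first by exists 1 => // w; rewrite K0.
  have [c cin hc] := compact_EVT_max K0 cK cnk.
  exists (`|kap c| + 1) => [|w Kw]; first by have := normr_ge0 (kap c); lra.
  by have := hc w; rewrite inE => /(_ Kw); lra.
have ext j : exists g : V -> R, continuous g /\ forall w, Kc w -> g (f w) = kap w ord0 j.
  (* Independent of the choice of [pre], as [kap] is constant on the fibres of [f] in [Kc];
     continuous, as closed sets pull back to images of compact sets. *)
  pose phi (y : V) : R^o := kap (pre y) ord0 j.
  have cphi : {within A, continuous phi}.
    apply/continuous_closedP => F cF; apply/closed_subspaceP.
    exists (f @` (Kc `&` [set w | F (kap w ord0 j)])).
      apply: rV_compact_closed; apply: continuous_compact; first exact: continuous_subspaceT.
      apply: subclosed_compact (cK) _; last by move=> ? [].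
      apply: closedI; first exact: (rV_compact_closed cK).
      apply: (@preimage_closed _ _ (fun w => kap w ord0 j) F) => // w _.
      exact: continuous_coord.
    apply/seteqP; split=> y.
      move=> [[w [Kw Fw] e] Ay]; split=> //.
      by rewrite /phi /= /from_subspace -e preE.
    move=> [Fy Ay]; split=> //; have [K1 e] := hpre y Ay.
    by exists (pre y).
  have bphi y : A y -> `|phi y| <= M.
    by move=> Ay; have [K1 _] := hpre y Ay; apply: le_trans (hM _ K1); exact: coord_le.
  have [g [gE cg _]] := continuous_bounded_extension (@pseudometric_normal R V) cA M0 cphi bphi.
  exists g; split=> // w Kw; rewrite -gE; last by rewrite inE; exists w.
  by rewrite /phi preE.
have /choice[g hg] := ext.
exists (fun y => \row_j g j y).
  apply: rV_continuous => j; have -> : (fun x => (\row_j0 g j0 x) ord0 j) = g j.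
    by apply/funext => y; rewrite mxE.
  by case: (hg j).
move=> w Kw; apply/rowP => j; rewrite mxE; case: (hg j) => _ -> //.
Qed.

Lemma eball0_open (r : R) : open [set x : V | enorm x < r].
Proof.
apply: (@open_comp _ _ (@enorm R N) [set s : R | s < r]); last exact: open_lt.
by move=> x _; apply: (enorm_continuous (f := id)) => A; exact: cvg_id.
Qed.

Lemma eball0_compact (r : R) : compact [set x : V | enorm x <= r].
Proof.
apply: bounded_closed_compact.
  exists r; split; first by rewrite num_real.
  by move=> M hM x /= xr; apply: le_trans (norm_le_enorm x) _; lra.
apply: (@preimage_closed _ _ (@enorm R N) [set s : R | s <= r]); last exact: closed_le.
by move=> x _; apply: (enorm_continuous (f := id)) => A; exact: cvg_id.
Qed.

End Extension.

Section ContinuityRules.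
Variables (R : realType) (N : nat) (T : topologicalType) (x : T).
Notation V := 'rV[R]_N.
Lemma cont_id : {for x, continuous (fun y : T => y)}.
Proof. by move=> A; exact: cvg_id. Qed.

Lemma contD (f g : T -> R) : {for x, continuous f} -> {for x, continuous g} ->
  {for x, continuous (fun y => f y + g y)}.
Proof. by move=> cf cg; exact: continuousD. Qed.
Lemma contB (f g : T -> R) : {for x, continuous f} -> {for x, continuous g} ->
  {for x, continuous (fun y => f y - g y)}.
Proof. by move=> cf cg; exact: continuousB. Qed.
Lemma contM (f g : T -> R) : {for x, continuous f} -> {for x, continuous g} ->
  {for x, continuous (fun y => f y * g y)}.
Proof. by move=> cf cg; exact: continuousM. Qed.
Lemma contDV (f g : T -> V) : {for x, continuous f} -> {for x, continuous g} ->
  {for x, continuous (fun y => f y + g y)}.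
Proof. by move=> cf cg; exact: continuousD. Qed.
Lemma contZV (f : T -> R) (g : T -> V) : {for x, continuous f} -> {for x, continuous g} ->
  {for x, continuous (fun y => f y *: g y)}.
Proof. by move=> cf cg; exact: continuousZ. Qed.
Lemma contmax (f g : T -> R) : {for x, continuous f} -> {for x, continuous g} ->
  {for x, continuous (fun y => Num.max (f y) (g y))}.
Proof. by move=> cf cg; exact: (@continuous_max R T f g). Qed.

Lemma cont_norm (f : T -> R) :
  {for x, continuous f} -> {for x, continuous (fun y : T => `|f y|)}.
Proof. by move=> cf; apply: (@continuous_comp _ _ _ f (fun r : R => `|r|)) => //; exact: norm_continuous. Qed.
Lemma cont_comp (T' T'' : topologicalType) (f : T -> T') (g : T' -> T'') :
  {for x, continuous f} -> continuous g -> {for x, continuous (fun y : T => g (f y))}.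
Proof. by move=> cf cg; apply: (@continuous_comp _ _ _ f g) => //; exact: cg. Qed.

End ContinuityRules.

(** * A partition of unity that recovers directions from images *)

Section Selection.
Variables (R : realType) (N : nat).
Notation V := 'rV[R]_N.
Implicit Types (a b p q x y w : V).
Variables (v : V -> V) (t H K : R).
Hypotheses (t0 : 0 < t) (H0 : 0 < H) (K0 : 0 < K) (HK : H * K < 2).
Hypotheses (cv : continuous v) (v0 : v 0 = 0).
Hypothesis vL : forall a b, enorm a <= t -> enorm b <= t -> enorm (v a - v b) <= K * enorm (a - b).
Hypothesis vH : forall w, enorm w <= t -> enorm w <= H * enorm (v w).
Hypothesis v_open : forall P : set V, open P -> P `<=` [set x | enorm x < t] -> open (v @` P).

(** Among the points of the ball whose image lies on the ray of [p], take one with the image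
    farthest out. By openness an interior point could be pushed further, so this one has norm
    [tau]. *)
Lemma dir_surj tau p : 0 < tau <= t -> p != 0 ->
  exists2 a, enorm a = tau & exists2 lam : R, 0 < lam & v a = lam *: p.
Proof.
move=> /andP[tau0 taut] p0.
have pp : 0 < dot p p by rewrite -enorm_sqr exprn_gt0 // enorm_gt0.
have cdv : continuous (fun a => dot (v a) p).
  by move=> x; apply: dot_continuous; [exact: cv|exact: cst_continuous].
pose S := [set a : V | enorm a <= tau] `&`
  ([set a | v a - (dot (v a) p / dot p p) *: p = 0] `&` [set a | 0 <= dot (v a) p]).
have cS : compact S.
  apply: subclosed_compact (@eball0_compact R N tau) _; last by move=> ? [].
  apply: closedI; first by apply: rV_compact_closed; exact: eball0_compact.
  apply: closedI; last first.
    by apply: (@preimage_closed _ _ (fun a => dot (v a) p) [set s : R | 0 <= s]); [move=> x _; exact: cdv|exact: closed_ge].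
  apply: (@preimage_closed _ _ (fun a => v a - (dot (v a) p / dot p p) *: p) [set y | y = 0]).
    move=> x _; apply: (@continuousB _ _ _ v (fun a => (dot (v a) p / dot p p) *: p)); first exact: cv.
    apply: (@continuousZ _ _ _ (fun a => dot (v a) p / dot p p) (fun=> p)); last exact: cst_continuous.
    by apply: continuousM; [exact: cdv|exact: cst_continuous].
  exact: (@accessible_closed_set1 V (hausdorff_accessible (@norm_hausdorff _ V))).
have S0 : S !=set0.
  by exists 0; split=> /=; rewrite ?enorm0 ?v0 ?dot0l ?mul0r ?scale0r ?subr0 //; exact: ltW.
have [a ain ha] := compact_EVT_max S0 cS (continuous_subspaceT cdv).
move: ain; rewrite inE => -[/= at_ [/eqP + d0]]; rewrite subr_eq0 => /eqP e.
set lam := dot (v a) p / dot p p in e.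
have ea : enorm a = tau.
  apply/eqP; rewrite eq_le at_ leNgt; apply/negP => lt.
  have oP : open (v @` [set x | enorm x < tau]).
    by apply: v_open; [exact: eball0_open|move=> x /= h; exact: lt_le_trans taut].
  have [d d0' hd] := openP_rV oP (ex_intro2 _ _ a lt erefl : (v @` [set x | enorm x < tau]) (v a)).
  pose e' := d / 2 / (`|p| + 1).
  have p1 : 0 < `|p| + 1 by have := normr_ge0 p; lra.
  have e'0 : 0 < e' by rewrite /e' !divr_gt0.
  have [|a' /= lt' ea'] := hd (v a + e' *: p).
    rewrite addrC addKr normrZ gtr0_norm // /e' mulrAC ltr_pdivrMr //.
    by have := normr_ge0 p; nra.
  have := ha a'; rewrite inE; have -> : dot (v a') p = dot (v a) p + e' * dot p p.
    by rewrite ea' dotDl dotZl.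
  suff Sa' : S a' by move=> /(_ Sa'); have := mulr_gt0 e'0 pp; lra.
  split; first exact: ltW.
  split=> /=; last first.
    by rewrite ea' dotDl dotZl addr_ge0 // mulr_ge0 // ltW.
  rewrite ea' dotDl dotZl mulrDl mulfK ?gt_eqF // {1}e -/lam scalerDl subrr //.
exists a => //; exists lam => //.
rewrite lt_neqAle divr_ge0 ?(ltW pp) // andbT eq_sym; apply/eqP => l0.
have := v_neq0 vH (a := a); rewrite ea tau0 => /(_ isT taut).
by rewrite e l0 scale0r eqxx.
Qed.

Variable tau0 : R.
Hypothesis tau0_gt0 : 0 < tau0.
Let A := [set a : V | tau0 <= enorm a] `&` [set a | enorm a <= t].

(* [m a b] vanishes when [|a| = |b|] and [v a], [v b] point in opposite directions. *)
Let m a b : R := enorm (enorm (v b) *: v a + enorm (v a) *: v b) + enorm (v a) * `|enorm b - enorm a|.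

Lemma annulus_compact : compact A.
Proof.
apply: subclosed_compact (@eball0_compact R N t) _; last by move=> ? [].
apply: closedI; last by apply: rV_compact_closed; exact: eball0_compact.
apply: (@preimage_closed _ _ (@enorm R N) [set s : R | tau0 <= s]); last exact: closed_ge.
by move=> x _; apply: (enorm_continuous (f := id)); exact: cont_id.
Qed.

(** Compactness makes [sphere_opp] stable. The gap is measured against [enorm (v a)] to match the
    homogeneity of [m] in [v a], on which [selection] relies. *)
Lemma opp_gap : exists2 e : R, 0 < e &
  forall a b, A a -> A b -> m a b < e * enorm (v a) -> dot a b < 0.
Proof.
pose KK := (A `*` A) `&` [set z : V * V | 0 <= dot z.1 z.2].
have cKK : compact KK.
  apply: subclosed_compact (compact_setX annulus_compact annulus_compact) _; last by move=> ? [].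
  apply: closedI.
    by apply: compact_closed; [exact: norm_hausdorff|exact: compact_setX annulus_compact annulus_compact].
  apply: (@preimage_closed _ _ (fun z : V * V => dot z.1 z.2) [set s : R | 0 <= s]); last exact: closed_ge.
  by move=> z _; apply: dot_continuous; [exact: cvg_fst|exact: cvg_snd].
have [||e e0 he] := compact_pos_min cKK (phi := fun z => m z.1 z.2).
- apply: continuous_subspaceT => z.
  have c1 : {for z, continuous (fun z : V * V => z.1)} by exact: cvg_fst.
  have c2 : {for z, continuous (fun z : V * V => z.2)} by exact: cvg_snd.
  have cv1 := cont_comp c1 cv; have cv2 := cont_comp c2 cv.
  have ce1 := enorm_continuous c1; have ce2 := enorm_continuous c2.
  have cev1 := enorm_continuous cv1; have cev2 := enorm_continuous cv2.
  rewrite /m; apply: (@contD R _ z); last apply: (@contM R _ z).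
  + apply: (enorm_continuous (contDV _ _)); first exact: (contZV cev2 cv1).
    exact: (contZV cev1 cv2).
  + exact: cev1.
  + exact: (cont_norm (contB ce2 ce1)).
- move=> [a b] [[/= [ta at_] [tb bt]] ab]; rewrite /= in ta at_ tb bt ab.
  have va : 0 < enorm (v a) by rewrite enorm_gt0 (v_neq0 vH) //; move: tau0_gt0; lra.
  have h1 := enorm_ge0 (enorm (v b) *: v a + enorm (v a) *: v b).
  have h2 : 0 <= enorm (v a) * `|enorm b - enorm a| by rewrite mulr_ge0 ?enorm_ge0.
  rewrite ltNge; apply/negP => m0.
  have e1 : enorm (enorm (v b) *: v a + enorm (v a) *: v b) = 0 by rewrite /m in m0; lra.
  have e2 : enorm (v a) * `|enorm b - enorm a| = 0 by rewrite /m in m0; lra.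
  move/eqP: e2; rewrite mulf_eq0 (gt_eqF va) /= normr_eq0 subr_eq0 => /eqP e2.
  have a0 : 0 < enorm a by move: tau0_gt0; lra.
  by have := sphere_opp H0 K0 HK vL vH a0 at_ e2 (enorm_eq0 e1); rewrite ltNge ab.
exists (e / (K * t + 1)) => [|a b Aa Ab].
  by rewrite divr_gt0 // ltr_wpDl // mulr_ge0 // ltW.
have va : enorm (v a) <= K * t.
  have := vL (a := a) (b := 0); rewrite enorm0 v0 !subr0 => /(_ _ (ltW t0)) h.
  by case: Aa => _ /= at_; apply: le_trans (h at_) _; rewrite ler_wpM2l // ltW.
have Kt : 0 < K * t + 1 by have := mulr_gt0 K0 t0; lra.
move=> h; rewrite ltNge; apply/negP => ab.
have := he (a, b) (conj (conj Aa Ab) ab) => /= h'.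
have : e / (K * t + 1) * enorm (v a) <= e.
  rewrite mulrAC ler_pdivrMr // ler_wpM2l ?(ltW e0) //; lra.
lra.
Qed.

(** [phi b p s] is positive where [v b] is nearly opposite to [p] and [enorm b] is near [s]. For
    [p = v a] and [s = enorm a] all such [b] have [dot a b < 0], so minus their weighted sum has
    positive product with [a]. By [dir_surj] such [b] exist, and every [p] is a positive multiple of
    some [v a] with [enorm a = s]; as [G] is homogeneous in [p], it does not vanish. *)
Lemma selection : exists G : V -> R -> V, [/\
  continuous (fun z : V * R => G z.1 z.2),
  forall a, A a -> 0 < dot (G (v a) (enorm a)) a &
  forall p s, p != 0 -> tau0 <= s -> s <= t -> G p s != 0].
Proof.
have [e e0 he] := opp_gap.
pose phi b p (s : R) : R := Num.max 0 (e * enorm p -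
   (enorm (enorm (v b) *: p + enorm p *: v b) + enorm p * `|enorm b - s|)).
have cphi b : continuous (fun z : V * R => phi b z.1 z.2).
  move=> z; have c1 : {for z, continuous (fun z : V * R => z.1)} by exact: cvg_fst.
  have c2 : {for z, continuous (fun z : V * R => z.2)} by exact: cvg_snd.
  have cst (c : R) : {for z, continuous (fun _ : V * R => c)} by exact: cst_continuous.
  have cstV (c : V) : {for z, continuous (fun _ : V * R => c)} by exact: cst_continuous.
  have ce1 := enorm_continuous c1.
  rewrite /phi; apply: (@contmax R _ z) => //; apply: (@contB R _ z); first by apply: (@contM R _ z).
  apply: (@contD R _ z).
    by apply: enorm_continuous; apply: (@contDV R N _ z); apply: (@contZV R N _ z).
  by apply: (@contM R _ z) => //; apply: cont_norm; apply: (@contB R _ z).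
have phi_pos a b : A a -> (0 < phi b (v a) (enorm a)) = (m a b < e * enorm (v a)).
  by move=> _; rewrite lt_max ltxx /= subr_gt0.
have phi_ge0 b p s : 0 <= phi b p s by rewrite le_max lexx.
have cAphi b : open [set a | 0 < phi b (v a) (enorm a)].
  apply: (@open_comp _ _ (fun a => phi b (v a) (enorm a)) [set r : R | 0 < r]); last exact: open_gt.
  move=> a _; apply: (@continuous_comp _ _ _ (fun a => (v a, enorm a)) (fun z : V * R => phi b z.1 z.2)); last exact: cphi.
  by apply: continuous_pair; [exact: cv|apply: (enorm_continuous (f := id)); exact: cont_id].
have := annulus_compact; rewrite compact_cover => /(_ V A (fun b => [set a | 0 < phi b (v a) (enorm a)])).
move=> [b _|a Aa|D DA cov]; first exact: cAphi.
  have [ta /= at_] := Aa; rewrite /= in ta.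
  have a0 : 0 < enorm a by move: tau0_gt0; lra.
  have [||b eb [lam l0 vb]] := @dir_surj (enorm a) (- v a); first by rewrite a0.
    by rewrite oppr_eq0 (v_neq0 vH).
  exists b; first by split; rewrite /= eb.
  rewrite /= phi_pos // /m eb subrr normr0 mulr0 addr0 vb enormZ enormN gtr0_norm //.
  rewrite !scalerN scalerA (mulrC lam) subrr enorm0.
  by rewrite mulr_gt0 // enorm_gt0 (v_neq0 vH).
pose G p s := - \sum_(b <- enum_fset D) phi b p s *: b.
have G1 a : A a -> 0 < dot (G (v a) (enorm a)) a.
  move=> Aa; rewrite /G dotNl oppr_gt0 dot_suml.
  have [b /= bD hb] := cov a Aa.
  have term b' : b' \in D -> phi b' (v a) (enorm a) * dot b' a <= 0.
    move=> b'D; have Ab' : A b' by have := DA b' b'D; rewrite inE.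
    have [h|h] := ltP 0 (phi b' (v a) (enorm a)).
      rewrite pmulr_rle0 // ltW // dotC; apply: he => //; by rewrite -phi_pos.
    by have -> : phi b' (v a) (enorm a) = 0; [apply/eqP; rewrite eq_le h phi_ge0|rewrite mul0r].
  rewrite (bigD1_seq b) //= ?fset_uniq //.
  have Ab : A b by have := DA b bD; rewrite inE.
  have lt0 : dot (phi b (v a) (enorm a) *: b) a < 0.
    by rewrite dotZl pmulr_rlt0 // dotC; apply: he => //; rewrite -phi_pos.
  have le0 : \sum_(b' <- enum_fset D | b' != b) dot (phi b' (v a) (enorm a) *: b') a <= 0.
    rewrite big_seq_cond; apply: sumr_le0 => b' /andP[b'D _]; rewrite dotZl; exact: term.
  lra.
exists G; split=> //.
  move=> z; apply: continuousN; apply: continuous_bigsum => b.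
  by apply: continuousZ; [exact: cphi|exact: cst_continuous].
move=> p s p0 ts st.
have [|a ea [lam l0 va]] := @dir_surj s p _ p0; first by apply/andP; split => //; move: tau0_gt0; lra.
have Aa : A a by split; rewrite /= ea.
have phiZ b : phi b (lam *: p) s = lam * phi b p s.
  rewrite /phi maxr_pMr ?(ltW l0) // mulr0; congr Num.max.
  rewrite enormZ gtr0_norm // scalerA (mulrC _ lam) -!scalerA -scalerDr enormZ gtr0_norm //; ring.
apply/eqP => G0; have := G1 a Aa; rewrite va ea.
have -> : G (lam *: p) s = lam *: G p s.
  rewrite /G scalerN scaler_sumr; congr (- _); apply: eq_bigr => b _.
  by rewrite phiZ scalerA.
by rewrite G0 scaler0 dot0l ltxx.
Qed.

End Selection.

(** * Local injectivity at a uniformly bad point *)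

Section Core.
Variables (R : realType) (N : nat).
Notation V := 'rV[R]_N.
Variables (v : V -> V) (t H K : R).
Hypotheses (t0 : 0 < t) (H0 : 0 < H) (K0 : 0 < K) (HK : H * K < 2).
Hypotheses (cv : continuous v) (v0 : v 0 = 0).
Hypothesis vL : forall a b : V, enorm a <= t -> enorm b <= t -> enorm (v a - v b) <= K * enorm (a - b).
Hypothesis v_open : forall P : set V, open P -> P `<=` [set x | enorm x < t] -> open (v @` P).

Definition locinj (y : V) := exists2 r : R, 0 < r &
  forall a b : V, enorm (a - y) < r -> enorm (b - y) < r -> v a = v b -> a = b.

Hypothesis vZ : forall z w : V, enorm z < t -> ~ locinj z -> enorm w <= t ->
  enorm (w - z) <= H * enorm (v w - v z).

Lemma enorm_cts : continuous (@enorm R N).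
Proof. by move=> x; apply: (enorm_continuous (f := id)); exact: cont_id. Qed.

Lemma near_enorm (x : V) (r : R) : 0 < r -> exists2 d : R, 0 < d & forall y : V, `|y - x| <= d -> enorm (y - x) < r.
Proof.
move=> r0; exists (r / 2 / N.+1%:R) => [|y yx]; first by rewrite !divr_gt0 // ltr0n.
apply: le_lt_trans (enorm_le_norm _) _; apply: (@le_lt_trans _ _ (r / 2)); last lra.
by rewrite mulrC -ler_pdivlMr // ltr0n.
Qed.

Lemma locinj_near (x : V) : locinj x -> exists2 d : R, 0 < d & forall y : V, `|y - x| < d -> locinj y.
Proof.
move=> [r r0 hr]; have r2 : 0 < r / 2 by lra.
have [d d0 hd] := near_enorm x r2; exists d => // y /ltW /hd yx; exists (r / 2) => // a b ay by_.
have := enorm_dist y a x; have := enorm_dist y b x => h1 h2.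
by apply: hr; lra.
Qed.

Section Contra.
Hypothesis nl : ~ locinj 0.

Let vH w : enorm w <= t -> enorm w <= H * enorm (v w).
Proof. by move=> wt; have := vZ (z := 0) (w := w); rewrite enorm0 v0 !subr0; apply. Qed.

(** Chosen so that [H * s' = t / 2]: by [vH], points with [enorm (v w) <= s'] are well inside the
    ball. [tau0] is the norm that [enorm (v w) >= s] forces through [vL]. *)
Let s : R := t / (4 * H).
Let s' : R := 2 * s.
Let tau0 : R := s / K.

Variable G : V -> R -> V.
Hypothesis cG : continuous (fun z : V * R => G z.1 z.2).
Hypothesis G1 : forall a : V, tau0 <= enorm a -> enorm a <= t -> 0 < dot (G (v a) (enorm a)) a.
Hypothesis G2 : forall (p : V) (r : R), p != 0 -> tau0 <= r -> r <= t -> G p r != 0.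

Let s_gt0 : 0 < s. Proof. by rewrite /s divr_gt0 // mulr_gt0. Qed.
Let tau0_gt0 : 0 < tau0. Proof. by rewrite /tau0 divr_gt0. Qed.

Let U : set V := [set x | enorm x < t] `&` [set x | enorm (v x) < s'].
Let Z : set V := [set y | enorm y < t /\ ~ locinj y].

Let oU : open U.
Proof.
apply: openI; first exact: eball0_open.
apply: (@open_comp _ _ (fun x => enorm (v x)) [set r : R | r < s']); last exact: open_lt.
by move=> x _; apply: enorm_continuous; exact: cv.
Qed.

Let closure_U w : closure U w -> enorm w < t /\ enorm (v w) <= s'.
Proof.
move=> cw.
have h1 : enorm w <= t.
  have cl : closed [set x : V | enorm x <= t] by apply: rV_compact_closed; exact: eball0_compact.
  have : closure U `<=` [set x : V | enorm x <= t].
    by rewrite ((closure_id _).1 cl); apply: closureS => x [/= /ltW].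
  exact.
have h2 : enorm (v w) <= s'.
  have cl : closed [set x : V | enorm (v x) <= s'].
    apply: (@preimage_closed _ _ (fun x => enorm (v x)) [set r : R | r <= s']); last exact: closed_le.
    by move=> x _; apply: enorm_continuous; exact: cv.
  have : closure U `<=` [set x : V | enorm (v x) <= s'].
    by rewrite ((closure_id _).1 cl); apply: closureS => x [_ /= /ltW].
  exact.
split=> //; apply: le_lt_trans (vH h1) _.
apply: (@le_lt_trans _ _ (H * s')); first by rewrite ler_wpM2l // ltW.
have -> : H * s' = t / 2 by rewrite /s' /s; field; rewrite gt_eqF.
by move: t0; lra.
Qed.

Let bdry_U w : bdry U w -> enorm (v w) = s'.
Proof.
move=> [/closure_U[h1 h2] nU]; apply/eqP; rewrite eq_le h2 leNgt; apply/negP => lt.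
by apply: nU.
Qed.

Let annulus w : closure U w -> s <= enorm (v w) -> [/\ tau0 <= enorm w, enorm w <= t & v w != 0].
Proof.
move=> /closure_U[h1 h2] sv; split; [|exact: ltW|].
  rewrite /tau0 ler_pdivrMr // mulrC; apply: le_trans sv _.
  by have := vL (a := w) (b := 0); rewrite enorm0 v0 !subr0; apply; exact: ltW.
by rewrite -enorm_gt0; move: s_gt0; lra.
Qed.

(** A ramp from 0 at [s] to 1 at [s']; the two subtractions from 1 turn a maximum into the minimum
    with 1. *)
Let kap (r : R) : R := 1 - Num.max 0 (1 - Num.max 0 ((r - s) / s)).
(** The clock of [h]: up to 1 it runs the leg from [a] to [G], from 1 to 2 the leg that moves the
    radius to [t]. *)
Let th (sg : R) (a : V) : R := 2 * sg * kap (enorm (v a)).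
Let mu sg a : R := Num.max 0 (1 - th sg a).
Let th2 sg a : R := Num.max 0 (th sg a - 1).
(* The homotopy runs from [a] to [G (v a) |a|] and on to [G (v a) t], which depends on [v a] only; it is constant where [|v a| <= s]. *)
Let h (sg : R) (a : V) : V :=
  mu sg a *: a + (1 - mu sg a) *: G (v a) ((1 - th2 sg a) * enorm a + th2 sg a * t).

Let kap_le r : r <= s -> kap r = 0.
Proof.
move=> rs; have e : Num.max 0 ((r - s) / s) = 0.
  by apply/max_idPl; rewrite pmulr_lle0 ?invr_gt0 // subr_le0.
by rewrite /kap e subr0 (max_r ler01) subrr.
Qed.
Let kap_s' : kap s' = 1.
Proof.
have -> : kap s' = 1 - Num.max 0 (1 - Num.max 0 1).
  by rewrite /kap; have -> : (s' - s) / s = 1 by rewrite /s'; field; rewrite gt_eqF.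
by rewrite (max_r ler01) subrr maxxx subr0.
Qed.
Let kap_01 r : 0 <= kap r <= 1.
Proof.
rewrite /kap; set x := Num.max 0 _; have x0 : 0 <= x by rewrite le_max lexx.
apply/andP; split; last by rewrite gerBl.
by rewrite subr_ge0 /x ge_max ler01 /= gerBl le_max lexx.
Qed.

Let h_cts : continuous (fun z : R * V => h z.1 z.2).
Proof.
move=> z.
have c1 : {for z, continuous (fun z : R * V => z.1)} by exact: cvg_fst.
have c2 : {for z, continuous (fun z : R * V => z.2)} by exact: cvg_snd.
have cst (c : R) : {for z, continuous (fun _ : R * V => c)} by exact: cst_continuous.
have cv2 := cont_comp c2 cv.
have ce := enorm_continuous c2.
have cev := enorm_continuous cv2.
have ckap : {for z, continuous (fun z : R * V => kap (enorm (v z.2)))}.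
  rewrite /kap; apply: (@contB R _ z) => //; apply: (@contmax R _ z) => //; apply: (@contB R _ z) => //.
  apply: (@contmax R _ z) => //; apply: (@contM R _ z) => //; apply: (@contB R _ z) => //.
have cth : {for z, continuous (fun z : R * V => th z.1 z.2)}.
  by rewrite /th; apply: (@contM R _ z) => //; apply: (@contM R _ z).
have cmu : {for z, continuous (fun z : R * V => mu z.1 z.2)}.
  by rewrite /mu; apply: (@contmax R _ z) => //; apply: (@contB R _ z).
have cth2 : {for z, continuous (fun z : R * V => th2 z.1 z.2)}.
  by rewrite /th2; apply: (@contmax R _ z) => //; apply: (@contB R _ z).
rewrite /h; apply: (@contDV R N _ z); apply: (@contZV R N _ z) => //; first by apply: (@contB R _ z).
apply: (@cont_comp _ z _ _ (fun z : R * V => (v z.2, (1 - th2 z.1 z.2) * enorm z.2 + th2 z.1 z.2 * t)) (fun z : V * R => G z.1 z.2)) => //.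
apply: continuous_pair => //; apply: (@contD R _ z); apply: (@contM R _ z) => //; by apply: (@contB R _ z).
Qed.

Let h_id sg a : enorm (v a) <= s -> h sg a = a.
Proof.
move=> le; rewrite /h /mu /th kap_le // mulr0 subr0 (max_r ler01) subrr scale0r addr0 scale1r //.
Qed.
Let h_0 a : h 0 a = a.
Proof.
by rewrite /h /mu /th mulr0 mul0r subr0 (max_r ler01) subrr scale0r addr0 scale1r.
Qed.
Let h_1 a : enorm (v a) = s' -> h 1 a = G (v a) t.
Proof.
move=> e; have th1 : th 1 a = 2 by rewrite /th e kap_s' !mulr1.
have -> : h 1 a = 0 *: a + (1 - 0) *: G (v a) ((1 - 1) * enorm a + 1 * t).
  rewrite /h /mu /th2 th1 (max_idPl _); last lra.
  by rewrite max_r; [have -> : 2 - 1 = 1 :> R by ring|lra].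
by rewrite scale0r add0r subr0 scale1r subrr mul0r add0r mul1r.
Qed.

(** On the first leg [h sg a] is a convex combination of vectors having positive product with [a];
    on the second the radius stays between [enorm a] and [t], where [G] is nonzero. *)
Let h_neq0 sg a : 0 <= sg <= 1 -> closure U a -> s <= enorm (v a) -> h sg a != 0.
Proof.
move=> /andP[sg0 sg1] cU sv; have [ta at_ va] := annulus cU sv.
have /andP[k0 k1] := kap_01 (enorm (v a)).
have th0 : 0 <= th sg a by rewrite /th !mulr_ge0.
have th_2 : th sg a <= 2.
  have h1 : sg * kap (enorm (v a)) <= 1 by rewrite -[leRHS]mulr1 ler_pM.
  by rewrite /th -mulrA; lra.
have a0 : 0 < dot a a by rewrite -enorm_sqr exprn_gt0 //; move: tau0_gt0; lra.
have [le|lt] := leP (th sg a) 1.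
  have e : h sg a = (1 - th sg a) *: a + th sg a *: G (v a) (enorm a).
    rewrite /h /mu /th2 (max_r (x := 0) (y := 1 - th sg a)); last lra.
    rewrite (max_idPl _); last lra.
    by rewrite subr0 mul1r mul0r addr0 subKr.
  apply/eqP => h0'; have : 0 < dot (h sg a) a; last by rewrite h0' dot0l ltxx.
  rewrite e dotDl !dotZl; have g := G1 ta at_.
  have [z|z] := eqVneq (th sg a) 0; first by rewrite z subr0 mul1r mul0r addr0.
  apply: ltr_wpDl; first by rewrite mulr_ge0 ?(ltW a0) //; lra.
  by rewrite mulr_gt0 // lt_neqAle eq_sym z.
have e : h sg a = G (v a) ((1 - (th sg a - 1)) * enorm a + (th sg a - 1) * t).
  rewrite /h /mu /th2 (max_idPl _); last lra.
  by rewrite scale0r add0r subr0 scale1r max_r //; lra.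
rewrite e; apply: G2 => //.
  by have : 0 <= (th sg a - 1) * (t - enorm a); [rewrite mulr_ge0; lra|lra].
by have : 0 <= (1 - (th sg a - 1)) * (t - enorm a); [rewrite mulr_ge0; lra|lra].
Qed.

Lemma locinj_at_0_contra : False.
Proof.
have Ucomp : compact (closure U).
  apply: subclosed_compact (@eball0_compact R N t) _; first exact: closed_closure.
  by move=> w /closure_U[/ltW].
pose KK : set (R * V) := [set sg : R | 0 <= sg <= 1] `*` (closure U `&` [set a | s <= enorm (v a)]).
have cKK : compact KK.
  apply: compact_setX.
    have -> : [set sg : R | 0 <= sg <= 1] = `[0, 1]%classic by apply/seteqP; split=> x /=; rewrite in_itv.
    exact: segment_compact.
  apply: subclosed_compact (Ucomp) _; last by move=> ? [].
  apply: closedI; first exact: closed_closure.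
  apply: (@preimage_closed _ _ (fun x => enorm (v x)) [set r : R | s <= r]); last exact: closed_ge.
  by move=> x _; apply: enorm_continuous; exact: cv.
have [||eta eta0 heta] := compact_pos_min cKK (phi := fun z => enorm (h z.1 z.2)).
- apply: continuous_subspaceT => z.
  exact: (enorm_continuous (f := fun z : R * V => h z.1 z.2) (@h_cts z)).
- by move=> [sg a] [/= s01 [cU sv]]; rewrite enorm_gt0; exact: h_neq0.
have s'0 : 0 < s' by rewrite /s'; move: s_gt0; lra.
(* [eta] keeps the homotopy off [a1] and [a2]; [t] and [s' / K] put both points in [U]. *)
pose r := Num.min eta (Num.min t (s' / K)).
have r0 : 0 < r by rewrite !lt_min eta0 t0 divr_gt0.
have [a1 [a2 [ra1 ra2 va ne]]] : exists a1 a2 : V, [/\ enorm a1 < r, enorm a2 < r, v a1 = v a2 & a1 <> a2].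
  apply: contrapT => no; apply: nl; exists r => // a b; rewrite !subr0 => ra rb vab.
  by apply: contrapT => ne; apply: no; exists a, b.
have small a : enorm a < r -> [/\ enorm a < eta, enorm a < t & U a].
  rewrite !lt_min => /and3P[h1 h2 h3]; split=> //; split=> //=.
  have := vL (a := a) (b := 0); rewrite enorm0 v0 !subr0 => /(_ (ltW h2) (ltW t0)) h4.
  by apply: le_lt_trans h4 _; rewrite mulrC -ltr_pdivlMr.
have [e1 t1 U1] := small _ ra1; have [e2 t2 U2] := small _ ra2.
have nZ a b : enorm a < t -> enorm b < t -> v a = v b -> Z a -> a = b.
  move=> ta tb vab [_ nla]; have := vZ ta nla (ltW tb); rewrite vab subrr enorm0 mulr0 => le.
  have e0 : enorm (b - a) = 0 by apply/eqP; rewrite eq_le le enorm_ge0.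
  by move/enorm_eq0/eqP: e0; rewrite subr_eq0 => /eqP ->.
pose B := (Num.truncn (t + s' + 2)).+1.
have tB : t + s' + 2 < B%:R by exact: truncnS_gt.
have nO w : ~ (U `\` Z) w -> closure U w -> Z w \/ bdry U w.
  by move=> nO cw; have [Zw|nZw] := pselect (Z w); [left|right; split=> // Uw; apply: nO].
have oO : open (U `\` Z).
  apply: open_rV => x [Ux nZx].
  have lx : locinj x by apply: contrapT => nlx; apply: nZx; split=> //; case: Ux.
  have [d1 d10 h1] := openP_rV oU Ux; have [d2 d20 h2] := locinj_near lx.
  exists (Num.min d1 d2) => [|y]; rewrite ?lt_min ?d10 // => /andP[/h1 Uy /h2 ly].
  by split=> // -[].
have cT : compact (closure U `\` (U `\` Z)).
  apply: subclosed_compact (Ucomp) _; last by move=> ? [].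
  by apply: closedI; [exact: closed_closure|exact: open_closedC].
have ch s0 : continuous (h s0).
  move=> w; apply: (@continuous_comp _ _ _ (fun w => (s0, w)) (fun p : R * V => h p.1 p.2)).
    by apply: continuous_pair; [exact: cst_continuous|exact: cont_id].
  exact: h_cts.
(* The end [h 1] factors through [v]: on [Z] because [v] separates its points, on the boundary of
   [U] because there [h_1] involves [v w] only. *)
have [|Gam cGam GamE] := extend_through cT cv (ch 1).
  move=> w w' [cw nw] [cw' nw'] vw; have [tw _] := closure_U cw; have [tw' _] := closure_U cw'.
  have [Zw|bw] := nO _ nw cw; first by rewrite (nZ w w').
  have [Zw'|bw'] := nO _ nw' cw'; first by rewrite (nZ w' w).
  by rewrite !h_1 ?bdry_U // vw.
apply: (ne); apply: (@same_point R N B v U Z _ oO cv _ _ _ _ Gam h a1 a2) => //.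
- by move=> x [/= xt _]; have := norm_le_enorm x; move: s'0; lra.
- by move=> P oP PU; apply: v_open => // x /PU [].
- move=> x [Ux nZx].
  have [q q0 hq] : locinj x by apply: contrapT => nlx; apply: nZx; split=> //; case: Ux.
  have [d d0 hd] := near_enorm x q0; exists d => // y y' /hd h1 /hd h2; exact: hq.
- by move=> z w Zz /closure_U[tz _] /closure_U[tw _] e; exact: nZ.
- by move=> w x /bdry_U e [_ /= lt] e'; rewrite -e' e ltxx in lt.
- by move=> x [_ /= vx]; have := norm_le_enorm (v x); move: t0; lra.
- by move=> w cw nw; rewrite GamE.
- move=> sg w s01 cw nw.
  have hO a : (U `\` Z) a -> enorm a < eta -> h sg w != a.
    (* If [enorm (v w) <= s], then [w] is fixed, and differs from [a] because only [a] lies in U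
       minus Z; otherwise the homotopy stays at norm at least [eta]. *)
    move=> Oa ea; have [le|lt] := leP (enorm (v w)) s.
      by rewrite h_id //; apply: contra_notN nw => /eqP ->.
    have := heta (sg, w) (conj s01 (conj cw (ltW lt))) => /= h1.
    by apply: contraTneq h1 => ->; rewrite -ltNge.
  by split; apply: hO => //; split=> //; [move/(nZ a1 a2)|move/(nZ a2 a1)] => X; apply: ne; rewrite X.
- by split=> // /(nZ a1 a2); auto.
- by split=> // /(nZ a2 a1) X; apply: ne; rewrite X.
Qed.

End Contra.

Lemma locinj_at_0 : locinj 0.
Proof.
apply: contrapT => nl.
have vH w : enorm w <= t -> enorm w <= H * enorm (v w).
  by move=> wt; have := vZ (z := 0) (w := w); rewrite enorm0 v0 !subr0; apply.
have tau0_gt0 : 0 < t / (4 * H) / K by rewrite !divr_gt0 // mulr_gt0.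
have [G [cG G1 G2]] := selection t0 H0 K0 HK cv v0 vL vH v_open tau0_gt0.
apply: (locinj_at_0_contra nl cG) => [a ta at_|p r p0 tr rt]; first exact: G1.
exact: G2.
Qed.

End Core.

(** * Baire category and localization *)

Section Local.
Variables (R : realType) (N : nat).
Notation V := 'rV[R]_N.

Lemma limf_esup_lt (f : V -> \bar R) (F : set_system V) (a : \bar R) :
  (limf_esup f F < a)%E -> exists2 A, F A & forall z, A z -> (f z < a)%E.
Proof.
move=> /ereal_inf_lt[_ [A FA <-] h]; exists A => // z Az.
by apply: le_lt_trans h; apply: ereal_sup_ubound; exists z.
Qed.

Lemma nbhs_eball (y : V) (A : set V) : nbhs y A -> exists2 d : R, 0 < d & forall z : V, enorm (z - y) < d -> A z.
Proof.
move=> /nbhs_rVP[d d0 h]; exists d => // z zy; apply: h; exact: le_lt_trans (norm_le_enorm _) zy.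
Qed.

Lemma e_u_lt (D : set V) (u : V -> V) y (K : R) : (e_u D u y < K%:E)%E -> nbhs y D ->
  exists2 d : R, 0 < d & forall z, enorm (z - y) < d -> enorm (u z - u y) <= K * enorm (z - y).
Proof.
move=> /limf_esup_lt[A nA hA] nD.
have /nbhs_eball[d d0 hd] : \forall z \near y, D z /\ (D z /\ z <> y -> A z) by apply: filterI.
exists d => // z /hd [Dz Az]; have [->|/eqP ne] := eqVneq z y.
  by rewrite !subrr !enorm0 mulr0.
have zy : 0 < enorm (z - y) by rewrite enorm_gt0 subr_eq0; apply/eqP.
by have := hA _ (Az (conj Dz ne)); rewrite lte_fin ltr_pdivrMr // => /ltW.
Qed.

(** The value [+oo] of the quotient at [u z = u y] is excluded by the finite bound, so [y] is
    isolated in its fibre. *)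
Lemma c_u_lt (D : set V) (u : V -> V) y (H : R) : (c_u D u y < H%:E)%E -> nbhs y D ->
  exists2 d : R, 0 < d & forall z, enorm (z - y) < d -> enorm (z - y) <= H * enorm (u z - u y).
Proof.
move=> /limf_esup_lt[A nA hA] nD.
have /nbhs_eball[d d0 hd] : \forall z \near y, D z /\ (D z /\ z <> y -> A z) by apply: filterI.
exists d => // z /hd [Dz Az]; have [->|/eqP ne] := eqVneq z y.
  by rewrite !subrr !enorm0 mulr0.
have := hA _ (Az (conj Dz ne)); case: eqP => [//|uzy].
have uu : 0 < enorm (u z - u y) by rewrite enorm_gt0 subr_eq0; apply/eqP.
by rewrite lte_fin ltr_pdivrMr // => /ltW.
Qed.

Variables (u : V -> V) (x0 : V) (R0 H K : R).
Hypotheses (R0_gt0 : 0 < R0) (H0 : 0 < H) (K0 : 0 < K) (HK : H * K < 2).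
Hypothesis u_e : forall y : V, enorm (y - x0) <= R0 ->
  exists2 d : R, 0 < d & forall z, enorm (z - y) < d -> enorm (u z - u y) <= K * enorm (z - y).
Hypothesis u_c : forall y : V, enorm (y - x0) <= R0 ->
  exists2 d : R, 0 < d & forall z, enorm (z - y) < d -> enorm (z - y) <= H * enorm (u z - u y).
Hypothesis u_open : forall P : set V, open P -> P `<=` [set x | enorm (x - x0) < R0] -> open (u @` P).

(** Continuous induction along the segment: the scale in [u_e] varies with the point, but the
    estimate centred at the supremum [sg] reaches both sides of it. *)
Lemma lipschitz_of_local a b : enorm (a - x0) <= R0 -> enorm (b - x0) <= R0 ->
  enorm (u b - u a) <= K * enorm (b - a).
Proof.
move=> ha hb.
have [->|ne] := eqVneq b a; first by rewrite !subrr enorm0 mulr0.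
pose D := enorm (b - a); have D0 : 0 < D by rewrite /D enorm_gt0 subr_eq0.
pose g (s : R) := a + s *: (b - a).
have gE s s' : enorm (g s' - g s) = `|s' - s| * D.
  by rewrite /D -enormZ /g opprD addrACA subrr add0r scalerBl.
have gin s : 0 <= s <= 1 -> enorm (g s - x0) <= R0.
  move=> /andP[s0 s1]; have -> : g s - x0 = (1 - s) *: (a - x0) + s *: (b - x0).
    by rewrite /g; apply/rowP => i; rewrite !mxE; ring.
  apply: le_trans (enormD _ _) _; rewrite !enormZ !ger0_norm ?subr_ge0 //.
  have : (1 - s) * enorm (a - x0) <= (1 - s) * R0 by rewrite ler_wpM2l // subr_ge0.
  have : s * enorm (b - x0) <= s * R0 by rewrite ler_wpM2l.
  lra.
pose est s := enorm (u (g s) - u a) <= K * (s * D).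
have step s : 0 <= s <= 1 -> exists2 d : R, 0 < d & forall s', `|s' - s| < d ->
    enorm (u (g s') - u (g s)) <= K * (`|s' - s| * D).
  move=> s01; have [d d0 hd] := u_e (gin s s01); exists (d / D); first exact: divr_gt0.
  by move=> s'; rewrite ltr_pdivlMr // -gE => /hd.
pose S := [set s : R | 0 <= s <= 1 /\ forall s', 0 <= s' <= s -> est s'].
have g0 : g 0 = a by rewrite /g scale0r addr0.
have S0 : S 0.
  split; first by rewrite lexx ler01.
  move=> s' h; have -> : s' = 0 by apply/eqP; rewrite eq_le andbC.
  by rewrite /est g0 subrr enorm0 mul0r mulr0.
have hS : has_sup S by split; [exists 0|exists 1 => s [/andP[_ ?] _]].
set sg := sup S.
have sg0 : 0 <= sg by apply: ub_le_sup => //; case: hS.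
have sg1 : sg <= 1 by apply: ge_sup; [exists 0|move=> s [/andP[_ ?] _]].
have below s' : 0 <= s' < sg -> est s'.
  move=> /andP[s'0 lt]; have [s [s01 hs] ss'] := sup_gt (ex_intro _ 0 S0) lt.
  by apply: hs; rewrite s'0 ltW.
have sg01 : 0 <= sg <= 1 by rewrite sg0.
have [d d0 hd] := step sg sg01.
have est_sg : est sg.
  have [z|nz] := eqVneq sg 0; first by rewrite z; case: S0 => _; apply; rewrite lexx.
  have sgp : 0 < sg by rewrite lt_neqAle eq_sym nz.
  pose s1 := Num.max 0 (sg - d / 2).
  have s1lt : s1 < sg by rewrite /s1 gt_max sgp; lra.
  have s10 : 0 <= s1 by rewrite le_max lexx.
  have s1d : `|s1 - sg| < d.
    rewrite distrC gtr0_norm ?subr_gt0 //; have : sg - d / 2 <= s1 by rewrite le_max lexx orbT.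
    by lra.
  have e1 := below s1; rewrite s10 s1lt in e1; have {}e1 := e1 isT.
  have := hd _ s1d; rewrite distrC gtr0_norm ?subr_gt0 // enormB => e2.
  rewrite /est; apply: le_trans (enorm_dist (u (g s1)) _ _) _; rewrite /est in e1; lra.
have S_sg : S sg.
  split=> // s' /andP[s'0 s's]; have [->//|ne'] := eqVneq s' sg.
  by apply: below; rewrite s'0 lt_neqAle ne'.
have [e|ne1] := eqVneq sg 1.
  by move: est_sg; rewrite e /est /g scale1r mul1r subrKC.
have lt1 : sg < 1 by rewrite lt_neqAle ne1.
pose s2 := Num.min 1 (sg + d / 2).
have s2gt : sg < s2 by rewrite /s2 lt_min lt1; lra.
have S2 : S s2.
  split; first by rewrite ge_min lexx andbT; lra.
  move=> s' /andP[s'0 s's2]; have [le|lt] := leP s' sg; first by case: S_sg => _; apply; rewrite s'0.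
  have s'd : `|s' - sg| < d.
    rewrite gtr0_norm ?subr_gt0 //; have : s2 <= sg + d / 2 by rewrite ge_min lexx orbT.
    lra.
  have := hd _ s'd; rewrite gtr0_norm ?subr_gt0 // => e2.
  rewrite /est; apply: le_trans (enorm_dist (u (g sg)) _ _) _; rewrite /est in est_sg; lra.
have : s2 <= sg by apply: ub_le_sup => //; case: hS.
lra.
Qed.

(** The closed sets of the Baire argument; by [u_c] they cover the ball. *)
Let E (n : nat) (y : V) := forall w, enorm (w - x0) <= R0 -> enorm (w - y) < n.+1%:R^-1 ->
  enorm (w - y) <= H * enorm (u w - u y).

(** A strict violation of the lower bound at [z] persists nearby because [u] is Lipschitz. *)
Lemma shrink_avoiding n (z : V) (rho : R) : enorm (z - x0) < R0 -> ~ E n z -> 0 < rho ->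
  exists r : R, [/\ 0 < r, r < rho, enorm (z - x0) + r < R0 &
    forall y, enorm (y - z) <= r -> ~ E n y].
Proof.
move=> zR nE rho0.
have [w [wR wz lt]] : exists w, [/\ enorm (w - x0) <= R0, enorm (w - z) < n.+1%:R^-1 &
    H * enorm (u w - u z) < enorm (w - z)].
  apply: contrapT => no; apply: nE => w wR wz; rewrite leNgt; apply/negP => lt.
  by apply: no; exists w.
(* Moving [z] by [r] changes [enorm (w - z) - H * enorm (u w - u z)] by at most [(1 + H * K) * r],
   whence the last bound. *)
pose r := Num.min (rho / 2) (Num.min ((R0 - enorm (z - x0)) / 2)
   (Num.min ((n.+1%:R^-1 - enorm (w - z)) / 2)
      ((enorm (w - z) - H * enorm (u w - u z)) / (2 * (1 + H * K))))).
have HK1 : 0 < 2 * (1 + H * K) by rewrite mulr_gt0 // addr_gt0 // mulr_gt0.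
have r0 : 0 < r by rewrite !lt_min !divr_gt0 ?subr_gt0.
have : r <= r by []; rewrite {2}/r !le_min => /and4P[r1 r2 r3 r4].
exists r; split=> //; [lra|lra|].
move=> y yz Ey.
have yR : enorm (y - x0) <= R0 by have := enorm_dist z y x0; lra.
have wy : enorm (w - y) < n.+1%:R^-1.
  have := enorm_dist z w y; rewrite (enormB z y); move: (n.+1%:R^-1) wz r3 => c wz r3; lra.
have e1 := Ey w wR wy.
have e2 : enorm (u w - u y) <= enorm (u w - u z) + K * r.
  apply: le_trans (enorm_dist (u z) _ _) _; rewrite lerD2l.
  apply: le_trans (lipschitz_of_local yR (ltW zR)) _.
  by rewrite ler_wpM2l ?(ltW K0) // enormB.
have e3 : H * enorm (u w - u y) <= H * (enorm (u w - u z) + K * r) by rewrite ler_wpM2l // ltW.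
have e4 : enorm (w - z) <= enorm (w - y) + r by have := enorm_dist y w z; lra.
move: r4; rewrite ler_pdivlMr // => r4.
have := mulr_gt0 H0 K0; have := mulr_gt0 (mulr_gt0 H0 K0) r0; lra.
Qed.

(** Otherwise balls centred at points without local injectivity can be nested so that the ball of
    index [n.+1] avoids [E n]; their common point lies in no [E n], against [u_c]. *)
Lemma uniform_bad_point : ~ locinj u x0 -> exists z n (rho : R), [/\ enorm (z - x0) < R0, ~ locinj u z, 0 < rho &
  forall y, enorm (y - z) < rho -> ~ locinj u y -> E n y].
Proof.
move=> nl; apply: contrapT => no.
have dense n z (rho : R) : enorm (z - x0) < R0 -> ~ locinj u z -> 0 < rho ->
    exists z', [/\ enorm (z' - z) < rho, ~ locinj u z' & ~ E n z'].
  move=> zR nz rho0; apply: contrapT => no'; apply: no; exists z, n, rho; split=> // y yz ny.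
  by apply: contrapT => nE; apply: no'; exists y.
pose ok (st : V * R) := [/\ enorm (st.1 - x0) + st.2 < R0, ~ locinj u st.1 & 0 < st.2].
pose next n (st st' : V * R) := ok st -> [/\ ok st', enorm (st'.1 - st.1) + st'.2 < st.2 &
    forall y, enorm (y - st'.1) <= st'.2 -> ~ E n y].
have /choice[f hf] : forall nst : nat * (V * R), exists st', next nst.1 nst.2 st'.
  move=> [n [z rho]]; have [[/= zR nz rho0]|nok] := pselect (ok (z, rho)); last by exists (z, rho).
  have zR' : enorm (z - x0) < R0 by lra.
  have [z' [z'z nz' nE]] := dense n z rho zR' nz rho0.
  have z'R : enorm (z' - x0) < R0 by have := enorm_dist z z' x0; lra.
  have gap : 0 < rho - enorm (z' - z) by rewrite subr_gt0.
  have [r [r0 r1 r2 r3]] := shrink_avoiding z'R nE gap.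
  by exists (z', r) => _; split=> //=; lra.
pose st := fix st n := if n is m.+1 then f (m, st m) else (x0, R0 / 2).
have okst n : ok (st n).
  elim: n => [|n IH]; last by have [] := hf (n, st n) IH.
  by split => //=; rewrite ?subrr ?enorm0; move: R0_gt0; lra.
have nest n : enorm ((st n.+1).1 - (st n).1) + (st n.+1).2 < (st n).2 by have [] := hf (n, st n) (okst n).
have avoid n y : enorm (y - (st n.+1).1) <= (st n.+1).2 -> ~ E n y.
  by have [_ _] := hf (n, st n) (okst n); apply.
have nested n k : enorm ((st (n + k)%N).1 - (st n).1) + (st (n + k)%N).2 <= (st n).2.
  elim: k => [|k IH]; first by rewrite addn0 subrr enorm0 add0r.
  rewrite addnS; have := nest (n + k)%N.
  have := enorm_dist (st (n + k)%N).1 (st (n + k).+1).1 (st n).1; lra.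
pose ball_ n := [set y : V | enorm (y - (st n).1) <= (st n).2].
have cb n : closed (ball_ n).
  rewrite /ball_; apply: (@preimage_closed _ _ (fun y : V => enorm (y - (st n).1)) [set s : R | s <= (st n).2]); last exact: closed_le.
  move=> y _; apply: (enorm_continuous (f := fun y : V => y - (st n).1)).
  by apply: continuous_subr => A; exact: cvg_id.
have tail n k : (n <= k)%N -> ball_ n (st k).1.
  move=> /subnKC <-; rewrite /ball_ /=; have := nested n (k - n)%N.
  by have [_ _] := okst (n + (k - n))%N; lra.
have cb0 : compact (ball_ 0%N).
  apply: bounded_closed_compact (cb 0%N).
  exists (enorm x0 + R0); split; first by rewrite num_real.
  move=> M hM y; rewrite /ball_ /= => hy; apply: le_trans (norm_le_enorm _) _.
  by have := enormD (y - x0) x0; rewrite subrK; move: R0_gt0; lra.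
have [y [_ cy]] : ball_ 0%N `&` cluster ((fun k => (st k).1) @ \oo) !=set0.
  by apply: cb0; exists 0%N => // k _; exact: tail.
have yball n : ball_ n y.
  rewrite ((closure_id _).1 (cb n)) => A nA.
  have [_ [/= [k nk <-] Ak]] := cy ((fun k => (st k).1) @` [set k | (n <= k)%N]) A
    (ex_intro2 _ _ n I (fun k nk => ex_intro2 _ _ k nk erefl)) nA.
  by exists (st k).1; split=> //; exact: tail.
have yR : enorm (y - x0) <= R0.
  by have := yball 0%N; rewrite /ball_ /=; move: R0_gt0; lra.
have [d d0 hd] := u_c yR.
pose n := Num.truncn d^-1.
apply: (@avoid n y); first exact: yball.
move=> w _ wy; apply: hd; apply: lt_le_trans wy _.
by rewrite invf_ple ?posrE ?ltr0n // ltW // truncnS_gt.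
Qed.

Lemma locinj_center : locinj u x0.
Proof.
apply: contrapT => /uniform_bad_point[z0 [n [rho [zR nz rho0 hE]]]].
pose c : R := n.+1%:R^-1; have c0 : 0 < c by rewrite invr_gt0 ltr0n.
(* Points within [t] of [z0] lie in the ball of [hE], have mutual distance at most [2 * t < c], and
   stay within [R0] of [x0]. *)
pose t := Num.min (rho / 2) (Num.min (c / 3) (R0 - enorm (z0 - x0))).
have t0 : 0 < t by rewrite !lt_min subr_gt0 zR !divr_gt0.
have : t <= t by []; rewrite {2}/t !le_min => /and3P[t1 t2 t3].
have cE : n.+1%:R^-1 = c by [].
clearbody t c.
(* Radial retraction onto the ball of radius [t]: it makes [v] continuous on the whole space, as the
   degree requires. *)
pose rt (x : V) : V := (t / Num.max t (enorm x)) *: x.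
have M0 (x : V) : 0 < Num.max t (enorm x) by rewrite lt_max t0.
have rt_id (x : V) : enorm x <= t -> rt x = x.
  by move=> xt; rewrite /rt max_l // divff ?scale1r // gt_eqF.
have rt_le (x : V) : enorm (rt x) <= t.
  rewrite /rt enormZ ger0_norm; last by rewrite divr_ge0 ?ltW.
  by rewrite mulrAC ler_pdivrMr // ler_wpM2l ?(ltW t0) // le_max lexx orbT.
have rt_cts : continuous rt.
  move=> x; apply: (@contZV R _ _ x (fun y : V => t / Num.max t (enorm y)) id); last exact: cont_id.
  apply: (@continuousM _ _ (fun=> t) (fun y : V => (Num.max t (enorm y))^-1)); first exact: cst_continuous.
  apply: (@continuousV _ _ (fun y : V => Num.max t (enorm y))); first by rewrite gt_eqF.
  apply: (@contmax _ _ _ (fun=> t) (@enorm R N)); first exact: cst_continuous.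
  exact: enorm_cts.
have inball (x : V) : enorm x <= t -> enorm (z0 + x - x0) <= R0.
  by move=> xt; have := enormD (z0 - x0) x; rewrite addrAC; lra.
pose v (x : V) := u (z0 + rt x) - u z0.
have vE (x : V) : enorm x <= t -> v x = u (z0 + x) - u z0 by move=> xt; rewrite /v rt_id.
have v0 : v 0 = 0 by rewrite vE ?enorm0 ?(ltW t0) // addr0 subrr.
have vB (a b : V) : v a - v b = u (z0 + rt a) - u (z0 + rt b) by rewrite /v opprB addrA subrK.
have vL' (a b : V) : enorm (v a - v b) <= K * enorm (rt a - rt b).
  rewrite vB; apply: le_trans (lipschitz_of_local (inball _ (rt_le b)) (inball _ (rt_le a))) _.
  by rewrite opprD addrACA subrr add0r.
have cv : continuous v.
  move=> x P /nbhs_rVP[e e0 he].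
  have [d d0 hd] := near_enorm (rt x) (divr_gt0 e0 K0).
  have /nbhs_rVP[d' d'0 hd'] : nbhs x [set y | `|rt y - rt x| < d].
    have nb : nbhs (rt x) [set y | `|y - rt x| < d] by apply/nbhs_rVP; exists d.
    exact: (rt_cts x _ nb).
  apply/nbhs_rVP; exists d' => // y /hd' /ltW /hd yx; apply: he.
  apply: le_lt_trans (norm_le_enorm _) _.
  by apply: le_lt_trans (vL' _ _) _; rewrite mulrC -ltr_pdivlMr.
have locE (z : V) : enorm z < t -> locinj v z <-> locinj u (z0 + z).
  move=> zt; split=> -[r r0 hr].
    exists (Num.min r (t - enorm z)) => [|a b]; first by rewrite lt_min r0 subr_gt0.
    rewrite !lt_min => /andP[a1 a2] /andP[b1 b2] uab.
    have sh (x : V) : x - (z0 + z) = (x - z0) - z by rewrite opprD addrA.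
    have ball_t (x : V) : enorm (x - (z0 + z)) < t - enorm z -> enorm (x - z0) <= t.
      by rewrite sh => xt; have := enormD (x - z0 - z) z; rewrite subrK; lra.
    apply: (addIr (- z0)); apply: hr; rewrite -?sh // !vE ?ball_t //.
    by rewrite !subrKC uab.
  exists (Num.min r (t - enorm z)) => [|a b]; first by rewrite lt_min r0 subr_gt0.
  rewrite !lt_min => /andP[a1 a2] /andP[b1 b2].
  have ball_t (x : V) : enorm (x - z) < t - enorm z -> enorm x <= t.
    by move=> xt; have := enormD (x - z) z; rewrite subrK; lra.
  rewrite !vE ?ball_t // => /addIr uab; apply: (addrI z0).
  by apply: hr => //; rewrite opprD addrACA subrr add0r.
suff : locinj v 0 by move=> /(locE _ _).1; rewrite enorm0 addr0; move=> /(_ t0).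
apply: (@locinj_at_0 R N v t H K) => //.
- by move=> a b at_ bt; have := vL' a b; rewrite !rt_id.
- move=> P oP Pt; have -> : v @` P = [set y | (u @` [set x | P (x - z0)]) (y + u z0)].
    apply/seteqP; split=> y /=.
      move=> [x Px <-]; exists (z0 + x); first by rewrite addrAC subrr add0r.
      by rewrite vE ?subrK //; apply/ltW/Pt.
    move=> [x Px ux]; exists (x - z0) => //.
    by rewrite vE ?subrKC ?ux ?addrK //; apply/ltW/Pt.
  have shift_open (Q : set V) (p : V) : open Q -> open [set y | Q (y + p)].
    move=> oQ; apply: open_rV => y Qy; have [d d0 hd] := openP_rV oQ Qy.
    by exists d => // w wy; apply: hd; rewrite opprD addrACA subrr addr0.
  apply: (shift_open _ (u z0)); apply: u_open; first exact: (shift_open _ (- z0)).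
  by move=> x /= /Pt xt; have := enorm_dist z0 x x0; rewrite /= in xt; lra.
- move=> z w zt /(locE _ zt) nl wt; rewrite vB !rt_id ?(ltW zt) //.
  have -> : w - z = z0 + w - (z0 + z) by rewrite opprD addrACA subrr add0r.
  apply: hE => //; first by rewrite addrAC subrr add0r; lra.
    exact: inball.
  rewrite opprD addrACA subrr add0r; rewrite cE; have := enormD w (- z); rewrite enormN; lra.
Qed.

End Local.

(** The limsups may equal [H x] and [K x]; only strictly larger constants bound the quotients
    themselves near a point. *)
Lemma product_lt2_slack (R : realType) (H K : R) : 0 < H -> 0 < K -> H * K < 2 ->
  exists H' K', [/\ H < H', K < K' & H' * K' < 2].
Proof.
move=> H0 K0 HK; pose q := 2 / K.
have Hq : H < q by rewrite ltr_pdivlMr.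
pose H' := (H + q) / 2; have H'0 : 0 < H' by rewrite /H'; lra.
have Kq : K < 2 / H'.
  rewrite ltr_pdivlMr // mulrC -ltr_pdivlMr // -/q /H'; lra.
exists H', ((K + 2 / H') / 2); split; [rewrite /H'; lra|lra|].
rewrite mulrC -ltr_pdivlMr //; lra.
Qed.

Theorem theorem2p16 (R : realType) (N : nat)
  (Omega Y : set 'rV[R]_N)
  (mu nu : probability (BorelRV R N) R)
  (H K : 'rV[R]_N -> R)
  (A : set ('rV[R]_N * R))
  (u : 'rV[R]_N -> 'rV[R]_N) :
  Omega !=set0 -> open Omega -> bounded_set Omega -> connected Omega ->
  (* mu is a probability measure on X = closure Omega *)
  mu (closure Omega : set (BorelRV R N)) = 1%E ->
  (* nu is a probability measure on Y *)
  (forall B : set (BorelRV R N), measurable B -> B `&` Y = set0 -> nu B = 0%E) ->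
  (* H, K : X -> (0, +oo), in L^1(X, mu), with H K < 2 on X *)
  (forall x, closure Omega x -> 0 < H x) ->
  (forall x, closure Omega x -> 0 < K x) ->
  mu.-integrable (closure Omega : set (BorelRV R N))
     (fun x : BorelRV R N => (H x)%:E) ->
  mu.-integrable (closure Omega : set (BorelRV R N))
     (fun x : BorelRV R N => (K x)%:E) ->
  (forall x, closure Omega x -> H x * K x < 2) ->
  (* A is a family of (open Euclidean) balls covering X *)
  (forall c r, A (c, r) -> 0 < r) ->
  closure Omega `<=` \bigcup_(b in A) eball b.1 b.2 ->
  (* u in Refo(mu; nu)^{H,K} *)
  Refo Omega Y mu nu H K A u ->
  (* u restricted to Omega is an open map *)
  (forall U : set 'rV[R]_N, open U -> U `<=` Omega -> open (u @` U)) ->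
  (* conclusion: u|_Omega is locally invertible *)
  forall x, Omega x ->
    exists V : set 'rV[R]_N, nbhs x V /\ V `<=` Omega /\
      (forall y z, V y -> V z -> u y = u z -> y = z).
Proof.
move=> _ oO _ _ _ _ H0 K0 _ _ HK Apos _ [_ [_ dil]] uO x Ox.
have cOx : closure Omega x by exact: subset_closure.
have [r [Axr uHK]] := dil x cOx; have r0 := Apos _ _ Axr.
have [s s0 sO] : exists2 s : R, 0 < s & forall z, enorm (z - x) < s -> Omega z.
  by apply: nbhs_eball; exact: open_nbhs_nbhs.
have [H' [K' [HH' KK' HK']]] := product_lt2_slack (H0 _ cOx) (K0 _ cOx) (HK _ cOx).
(* [s / 2] puts the closed ball inside [Omega], and [r] keeps it where the dilatation bounds at [x]
   hold. *)
pose R0 := Num.min (s / 2) r.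
have R00 : 0 < R0 by rewrite lt_min r0 divr_gt0.
have R0O z : enorm (z - x) <= R0 -> Omega z.
  by rewrite le_min => /andP[zs _]; apply: sO; lra.
have nO y : Omega y -> nbhs y (closure Omega).
  move=> Oy; apply: (@filterS _ _ _ Omega); first exact: subset_closure.
  exact: open_nbhs_nbhs.
have bounds y : enorm (y - x) <= R0 ->
    (c_u (closure Omega) u y <= (H x)%:E)%E /\ (e_u (closure Omega) u y <= (K x)%:E)%E.
  by move=> yx; apply: uHK; [move: yx; rewrite le_min => /andP[]|exact: R0O].
have [t t0 inj] : locinj u x.
  apply: (@locinj_center R N u x R0 H' K') => //.
  - exact: lt_trans (H0 _ cOx) HH'.
  - exact: lt_trans (K0 _ cOx) KK'.
  - move=> y yx; apply: (@e_u_lt R N (closure Omega)); last exact/nO/R0O.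
    by apply: le_lt_trans (bounds y yx).2 _; rewrite lte_fin.
  - move=> y yx; apply: (@c_u_lt R N (closure Omega)); last exact/nO/R0O.
    by apply: le_lt_trans (bounds y yx).1 _; rewrite lte_fin.
  - by move=> P oP PR; apply: uO => // y /PR /= /ltW /R0O.
exists [set y | enorm (y - x) < Num.min t R0]; split; last split.
- have m0 : 0 < Num.min t R0 by rewrite lt_min t0.
  by have [d d0 hd] := near_enorm x m0; apply/nbhs_rVP; exists d => // y /ltW /hd.
- by move=> y /=; rewrite lt_min => /andP[_ /ltW /R0O].
- by move=> y z /=; rewrite !lt_min => /andP[yt _] /andP[zt _]; exact: inj.
Qed.
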